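(* (Gandy selection) There is a selection operator $\nu$, a partial functional computable in $\mathcal{I}$, such that for all $e\in\mathbb{N}$, all finite sequences $\vec F$ of total functionals $\mathbb{N}^{\mathbb{N}}\to\mathbb{N}$, all finite sequences $\vec f$ from $\mathbb{N}^{\mathbb{N}}$ and all finite sequences $\vec a$ from $\mathbb{N}$: $$\exists n\ \{e\}(\mathcal{I},\vec F,\vec f,n,\vec a)\!\downarrow\ \ \Rightarrow\ \ \{e\}(\mathcal{I},\vec F,\vec f,\nu(e,\vec F,\vec f,\vec a),\vec a)\!\downarrow .$$
   Context: Non-monotone induction. Let $C=\{0,1\}^{\mathbb{N}}$ with the pointwise order. For a possibly partial $F:C\to C$ (each $F(f)$ is an element of $C$ or undefined) define $f_0$ = constant $0$, $f_{\beta+1}=\max\{f_\beta,F(f_\beta)\}$, $f_\beta=\sup_{\gamma<\beta}f_\gamma$ for limit $\beta$, where for $\beta>0$, $f_\beta$ is defined iff $f_\gamma$ and $F(f_\gamma)$ are defined for all $\gamma<\beta$. $\mathcal{I}(F)$ is defined iff there is $\alpha$ with $f_{\alpha+1}$ defined and $f_\alpha=f_{\alpha+1}$; then, for the least such $\alpha$, $\mathcal{I}(F)=f_\alpha$. For possibly partial $G:\mathbb{N}^{\mathbb{N}}\to\mathbb{N}$ let $F_G(f)(n)=\min\{G(n^\frown f),1\}$ for $f\in C$, where $(n^\frown f)(0)=n$, $(n^\frown f)(k+1)=f(k)$; $F_G(f)$ is defined iff all $G(n^\frown f)$ are. Kleene computability. $\{e\}(\mathcal{I},\vec F,\vec f,\vec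 a)=c$ is the least relation given by: S1: $e=\langle1\rangle$, value $a_1+1$. S2: $e=\langle2,q\rangle$, value $q$. S3: $e=\langle3\rangle$, value $a_1$. S4: $e=\langle4,e_1,e_2\rangle$, value $\{e_1\}(\mathcal{I},\vec F,\vec f,b,\vec a)$ where $b=\{e_2\}(\mathcal{I},\vec F,\vec f,\vec a)$. S6: $e=\langle6,e_1,\tau_1,\tau_2,\tau_3\rangle$, value $\{e_1\}(\mathcal{I},\vec F_{\tau_1},\vec f_{\tau_2},\vec a_{\tau_3})$ ($\tau_i$ permutations of index sets). S7: $e=\langle7\rangle$, value $f_1(a_1)$. S8.2: $e=\langle8,2,d\rangle$, value $F_1(g)$ when $g(a)=\{d\}(\mathcal{I},\vec F,\vec f,a,\vec a)$ is total. S8.3: $e=\langle8,3,d\rangle$, $\{e\}(\mathcal{I},\vec F,\vec f,b,\vec a)=\mathcal{I}(F_G)(b)$ where $G(h)=\{d\}(\mathcal{I},\vec F,h,\vec f,\vec a)$, provided $\mathcal{I}(F_G)$ is defined. S9: $e=\langle9\rangle$, $\{e\}(\mathcal{I},\vec F,\vec f,d,\vec a)=\{d\}(\mathcal{I},\vec F,\vec f,\vec a)$. (These are the paper's ''$p$-computations''.) $\{e\}(\dots)\!\downarrow$ means that the computation has a value. A partial functional is computable in $\mathcal{I}$ if it is given by $\{e\}(\mathcal{I},\cdot)$ for some index $e$.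
   Formalization: A single index giving ν on sequences of all lengths cannot exist, since S6 permutations fix the lengths; the formal theorem instead has one number that computes in 𝓘, from the lengths of F, f and (e,a), an index giving ν for those lengths. *)

(* Defs.v *)
From Stdlib Require Export Arith List Permutation.
From Stdlib Require Import Cantor.
Export ListNotations.

(** * Non-monotone induction *)

(** Functions on [C] and on Baire space that may be partial are given by their
    graphs; "[F x] is defined" reads [exists y, F x y]. *)
Definition C : Type := nat -> bool.

Definition czero : C := fun _ => false.

Definition cmax (x y : C) : C := fun n => (x n || y n)%bool.

Definition is_csup {I : Type} (P : I -> Prop) (x : I -> C) (s : C) : Prop :=
  forall n, s n = true <-> exists i, P i /\ x i n = true.

(** Ordinals are the elements of an arbitrary well-ordered type. *)
Section WellOrder.
Context {W : Type} (lt : W -> W -> Prop).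

Definition well_order : Prop :=
  well_founded lt /\
  (forall a b c, lt a b -> lt b c -> lt a c) /\
  (forall a b, lt a b \/ a = b \/ lt b a).

Definition is_zero (b : W) : Prop := forall c, ~ lt c b.

Definition is_succ (c b : W) : Prop :=
  lt c b /\ forall d, lt d b -> d = c \/ lt d c.

Definition is_limit (b : W) : Prop :=
  (exists c, lt c b) /\ forall c, ~ is_succ c b.
End WellOrder.

(** [stage lt F b x]: the [b]-th iterate of [F] is defined and equal to [x].
    In [stage_succ], the iterates below [c], and [F] at them, are defined
    because the [c]-th one is. *)
Inductive stage {W : Type} (lt : W -> W -> Prop) (F : C -> C -> Prop) :
    W -> C -> Prop :=
| stage_zero b : is_zero lt b -> stage lt F b czero
| stage_succ b c x y :
    is_succ lt c b -> stage lt F c x -> F x y -> stage lt F b (cmax x y)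
| stage_limit b (x : W -> C) (s : C) :
    is_limit lt b ->
    (forall c, lt c b -> stage lt F c (x c)) ->
    (forall c, lt c b -> exists y, F (x c) y) ->
    is_csup (fun c => lt c b) x s ->
    stage lt F b s.

(** [NI F x]: the non-monotone induction along [F] is defined, with value [x].
    The last conjunct is the leastness of [a]; it asserts [f_c <> f_{c+1}] for
    [c < a] in a form in which [F] occurs only positively, as [kleene] below
    requires (these stages are defined, as the [a]-th one is). *)
Definition NI (F : C -> C -> Prop) (x : C) : Prop :=
  exists (W : Type) (lt : W -> W -> Prop), well_order lt /\
  exists a a' : W, is_succ lt a a' /\
    stage lt F a x /\ stage lt F a' x /\
    forall c c', lt c a -> is_succ lt c c' ->
      exists y y', stage lt F c y /\ stage lt F c' y' /\ y <> y'.

Definition ncons (n : nat) (x : C) : nat -> nat :=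
  fun k => match k with 0 => n | S j => Nat.b2n (x j) end.

Definition FG (G : (nat -> nat) -> nat -> Prop) : C -> C -> Prop :=
  fun x y => forall n, exists m, G (ncons n x) m /\ Nat.b2n (y n) = Nat.min m 1.

(** * Kleene computability relative to [NI] *)

(** A bijection between finite sequences of numbers and numbers. *)
Fixpoint code (s : list nat) : nat :=
  match s with
  | [] => 0
  | a :: s' => S (to_nat (a, code s'))
  end.

(** [ys] is [xs_t], where [t] codes a permutation of [{0, ..., length xs - 1}]
    as the sequence of its values. *)
Definition permuted {A : Type} (t : nat) (xs ys : list A) : Prop :=
  exists p : list nat,
    t = code p /\ Permutation p (seq 0 (length xs)) /\
    map (nth_error xs) p = map Some ys.

Inductive kleene : nat -> list ((nat -> nat) -> nat) -> list (nat -> nat) ->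
    list nat -> nat -> Prop :=
| S1 F f a1 a : kleene (code [1]) F f (a1 :: a) (a1 + 1)
| S2 q F f a : kleene (code [2; q]) F f a q
| S3 F f a1 a : kleene (code [3]) F f (a1 :: a) a1
| S4 e1 e2 F f a b c :
    kleene e2 F f a b ->
    kleene e1 F f (b :: a) c ->
    kleene (code [4; e1; e2]) F f a c
| S6 e1 t1 t2 t3 F f a F' f' a' c :
    permuted t1 F F' -> permuted t2 f f' -> permuted t3 a a' ->
    kleene e1 F' f' a' c ->
    kleene (code [6; e1; t1; t2; t3]) F f a c
| S7 F f1 f a1 a : kleene (code [7]) F (f1 :: f) (a1 :: a) (f1 a1)
| S8_2 d F1 F f a (g : nat -> nat) :
    (forall n, kleene d (F1 :: F) f (n :: a) (g n)) ->
    kleene (code [8; 2; d]) (F1 :: F) f a (F1 g)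
| S8_3 d F f b a (x : C) :
    NI (FG (fun h m => kleene d F (h :: f) a m)) x ->
    kleene (code [8; 3; d]) F f (b :: a) (Nat.b2n (x b))
| S9 d F f a c :
    kleene d F f a c ->
    kleene (code [9]) F f (d :: a) c.

Definition converges (e : nat) (F : list ((nat -> nat) -> nat))
    (f : list (nat -> nat)) (a : list nat) : Prop :=
  exists c, kleene e F f a c.

(** Value at [F, f, a] of the functional of finite sequences (of arbitrary
    lengths) with index [i]. The indices of [kleene] carry no arities and S6
    acts only on sequences of a given length, so an index defines a functional
    for fixed lengths; a functional of sequences of all lengths is computable
    when an index for each choice of lengths is computed, by [i], from these
    lengths. *)
Definition seq_value (i : nat) (F : list ((nat -> nat) -> nat))
    (f : list (nat -> nat)) (a : list nat) (c : nat) : Prop :=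
  exists j, kleene i [] [] [length F; length f; length a] j /\ kleene j F f a c.

(* Main.v *)
(* Two computations [c] and [d], at least one of which converges, can be raced inside
   the calculus: there is a computation that finds one of them that converges, with
   its value. By S9 it may call itself. If [c] passes to a single computation, that
   one is raced against [d] with the roles exchanged. Otherwise a non-monotone
   induction accumulates the values of the subcomputations of [c] - for S8.3 they
   depend on the stage reached by the induction that [c] performs, which is simulated
   alongside - where each of them is found by racing [d] against it; as soon as [d]
   wins one of these races, the induction records this and stops. That the race
   converges follows by induction on the derivation of the value of [c] or [d].

   For the selection, let H(k) race {e}(k) against H(k+1). If {e}(k) wins, H(k)
   returns k; if H(k+1) wins with value w, found by asking for w = 0, 1, ... in turn,
   it returns the winner of the race between {e}(k) and {e}(w). If {e}(n) converges,
   then by downward induction from n every H(k) with k <= n has a value v such that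
   {e}(v) converges.

   There is no primitive recursion and no way to discard a number, so arithmetic is
   recovered from non-monotone inductions: first-order definable relations are
   decided by nested inductions, and definable functions are computed by a search
   whose counter consists of numbers that, when run as indices, remove themselves. *)

Require Import Defs.
From Stdlib Require Import Lia Cantor Classical ClassicalEpsilon FunctionalExtensionality PropExtensionality.

(** * Towers and non-monotone induction *)

(** A race is a decision procedure for questions about its outcome and not a search for a value,
    because an induction delivers only bits: [FG] truncates at 1. The obstacle is totality: the
    operator of an induction is undefined at a stage as soon as one of its bits is, so every race
    posed at a reached stage must converge. When [d] beats a subcomputation, the value of the latter
    stays unknown and the simulated stage of S8.3 need no longer belong to the induction of [c];
    races posed there need not converge. So the operator has to give up its races at the first
    victory of [d], and this is where its non-monotonicity is used. If [d] converges, every stage is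
    safe, since [d] guarantees each race; if [c] converges, the simulated stages up to the first
    victory of [d] are true stages of [c]. References to functions are counted from the end of the
    sequence and races are stated for arbitrary surrounding sequences, because each nested induction
    puts one more function in front. Since S6 fixes lengths, every index that a program runs is
    computed for the lengths at hand. *)

Definition tb (P : Prop) : bool :=
  if excluded_middle_informative P then true else false.

Lemma tb_true (P : Prop) : tb P = true <-> P.
Proof.
  unfold tb; destruct (excluded_middle_informative P); split; intros; auto; congruence.
Qed.

Lemma tb_false (P : Prop) : tb P = false <-> ~ P.
Proof.
  unfold tb; destruct (excluded_middle_informative P); split; intros; auto; congruence.
Qed.

Lemma tb_iff (P Q : Prop) : (P <-> Q) -> tb P = tb Q.
Proof.
  intros H. destruct (tb Q) eqn:E.
  - rewrite tb_true in *. tauto.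
  - rewrite tb_false in *. tauto.
Qed.

Lemma bool_tb (b : bool) : b = tb (b = true).
Proof.
  destruct b; symmetry; [rewrite tb_true | rewrite tb_false]; congruence.
Qed.

Definition cle (x y : C) : Prop := forall n, x n = true -> y n = true.

Lemma cle_refl x : cle x x.
Proof. intros n H; auto. Qed.

Lemma cle_trans x y z : cle x y -> cle y z -> cle x z.
Proof. intros H H' n Hn; auto. Qed.

Lemma cle_antisym x y : cle x y -> cle y x -> x = y.
Proof.
  intros H H'. apply functional_extensionality; intros n.
  specialize (H n); specialize (H' n).
  destruct (x n), (y n); auto. symmetry; auto.
Qed.

Lemma cmax_l x y : cle x (cmax x y).
Proof. intros n H. unfold cmax. rewrite H. auto. Qed.

Lemma cmax_r x y : cle y (cmax x y).
Proof. intros n H. unfold cmax. rewrite H. apply Bool.orb_true_r. Qed.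

Lemma cmax_lub x y z : cle x z -> cle y z -> cle (cmax x y) z.
Proof.
  intros H H' n Hn. unfold cmax in Hn. apply Bool.orb_true_iff in Hn.
  destruct Hn; auto.
Qed.

Lemma cmax_absorb x y : cle y x -> cmax x y = x.
Proof.
  intros H. apply cle_antisym; [| apply cmax_l].
  apply cmax_lub; auto using cle_refl.
Qed.

Definition csup (P : C -> Prop) : C := fun n => tb (exists x, P x /\ x n = true).

Lemma csup_ub (P : C -> Prop) x : P x -> cle x (csup P).
Proof. intros H n Hn. unfold csup. rewrite tb_true. eauto. Qed.

Lemma csup_lub (P : C -> Prop) z : (forall x, P x -> cle x z) -> cle (csup P) z.
Proof. intros H n Hn. unfold csup in Hn. rewrite tb_true in Hn. destruct Hn as (x & Hx & Hn). apply (H x); auto. Qed.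

Lemma czero_le x : cle czero x.
Proof. intros n H. discriminate. Qed.

Lemma csup_empty : csup (fun _ => False) = czero.
Proof.
  apply cle_antisym; [| apply czero_le]. apply csup_lub. tauto.
Qed.

(** Iterates without ordinals, in the style of Zermelo's proof of the well-ordering theorem: the
    class is closed under steps and arbitrary suprema, and the empty supremum gives [czero]. *)
Inductive tower (g : C -> C) : C -> Prop :=
| tower_step x : tower g x -> tower g (cmax x (g x))
| tower_sup (P : C -> Prop) : (forall x, P x -> tower g x) -> tower g (csup P).

Lemma not_all_le (P : C -> Prop) x :
  ~ (forall p, P p -> cle p x) -> exists p, P p /\ ~ cle p x.
Proof.
  intros H. apply not_all_ex_not in H. destruct H as (p & Hp).
  exists p. tauto.
Qed.

Section Tower.
Variable g : C -> C.
Let s x := cmax x (g x).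

(* Double induction: the outer one is on [x], the middle claim on [y]. *)
Lemma tower_cmp x y : tower g x -> tower g y -> cle x y \/ cle (s y) x.
Proof.
  intros Hx Hy. revert y Hy.
  induction Hx as [x Hx IH | P HP IH]; intros y Hy.
  - assert (Q : forall z, tower g z -> cle (s x) z \/ cle z x).
    { clear y Hy. intros z Hz. induction Hz as [z Hz IHz | P HP IHP].
      - destruct IHz as [H | H].
        + left. eapply cle_trans; [exact H | apply cmax_l].
        + destruct (IH z Hz) as [H' | H'].
          * rewrite (cle_antisym _ _ H H'). left. apply cle_refl.
          * right. exact H'.
      - destruct (classic (forall p, P p -> cle p x)) as [H | H].
        + right. apply csup_lub. auto.
        + apply not_all_le in H. destruct H as (p & Hp & Hn).
          destruct (IHP p Hp) as [H | H]; [| tauto].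
          left. eapply cle_trans; [exact H | apply csup_ub; auto]. }
    destruct (Q y Hy) as [H | H]; [left; exact H |].
    destruct (IH y Hy) as [H' | H'].
    + rewrite (cle_antisym _ _ H H'). right. apply cle_refl.
    + right. eapply cle_trans; [exact H' | apply cmax_l].
  - destruct (classic (forall p, P p -> cle p y)) as [H | H].
    + left. apply csup_lub. auto.
    + apply not_all_le in H. destruct H as (p & Hp & Hn).
      destruct (IH p Hp y Hy) as [H | H]; [tauto |].
      right. eapply cle_trans; [exact H | apply csup_ub; auto].
Qed.

Definition nival : C := csup (tower g).

Lemma nival_tower : tower g nival.
Proof. apply tower_sup. auto. Qed.

Lemma nival_closed : cmax nival (g nival) = nival.
Proof.
  apply cle_antisym; [| apply cmax_l].
  apply csup_ub. apply tower_step. apply nival_tower.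
Qed.

(** By [tower_cmp] no element of the tower passes a closed one. Exhibiting a closed element of the
    tower is thus a way to evaluate an induction. *)
Lemma nival_unique x : tower g x -> cle (g x) x -> x = nival.
Proof.
  intros Hx Hc. apply cle_antisym; [apply csup_ub; auto |].
  apply csup_lub. intros y Hy. induction Hy as [z Hz IH | P HP IH].
  - destruct (tower_cmp x z Hx Hz) as [H | H]; [| exact H].
    rewrite (cle_antisym _ _ IH H). apply cmax_lub; auto using cle_refl.
  - apply csup_lub. auto.
Qed.

(** [m] is the supremum of the lower bounds of [S] in the tower. Were it outside [S], its successor
    would be a lower bound too, so [m] would be closed, hence the top, and the elements of [S] above
    it would equal it. *)
Lemma tower_least (S : C -> Prop) :
  (exists x, S x) -> (forall x, S x -> tower g x) ->
  exists m, S m /\ forall x, S x -> cle m x.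
Proof.
  intros (x0 & Hx0) HS.
  set (m := csup (fun t => tower g t /\ forall x, S x -> cle t x)).
  assert (Hm : tower g m) by (apply tower_sup; tauto).
  assert (Hl : forall x, S x -> cle m x) by (intros x Hx; apply csup_lub; intros t [_ H]; auto).
  exists m. split; [| exact Hl].
  apply NNPP. intros Hn.
  assert (Hs : cle (s m) m).
  { apply csup_ub. split; [apply tower_step; auto |].
    intros x Hx. destruct (tower_cmp x m (HS x Hx) Hm) as [H | H]; [| exact H].
    exfalso. apply Hn. rewrite <- (cle_antisym _ _ H (Hl x Hx)). exact Hx. }
  assert (E : m = nival).
  { apply nival_unique; auto. eapply cle_trans; [apply cmax_r | exact Hs]. }
  apply Hn. rewrite <- (cle_antisym x0 m); auto.
  rewrite E. apply csup_ub. auto.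
Qed.

(** [NI] requires a position after the closing one; [None] provides it above the top of the tower,
    where the iterate repeats. *)
Let W := option {x : C | tower g x}.
Let lt (a b : W) : Prop :=
  match a, b with
  | Some x, Some y => cle (proj1_sig x) (proj1_sig y) /\ proj1_sig x <> proj1_sig y
  | Some _, None => True
  | None, _ => False
  end.

Lemma sig_eq (x y : {x : C | tower g x}) : proj1_sig x = proj1_sig y -> x = y.
Proof.
  destruct x, y; simpl; intros ->. f_equal. apply proof_irrelevance.
Qed.

Lemma tower_wf : well_founded lt.
Proof.
  assert (HS : forall x, Acc lt (Some x)).
  { apply NNPP. intros H. apply not_all_ex_not in H. destruct H as (x & Hx).
    destruct (tower_least (fun t => exists p : tower g t, ~ Acc lt (Some (exist _ t p))))
      as (m & (p & Hm) & Hl).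
    - exists (proj1_sig x). exists (proj2_sig x). destruct x; auto.
    - intros t (p & _); auto.
    - apply Hm. constructor. intros [[y q] |]; simpl; [| tauto].
      intros [H1 H2]. apply NNPP. intros Hy. apply H2.
      apply cle_antisym; auto. apply Hl. exists q. exact Hy. }
  intros [x |]; auto. constructor. intros [y |]; simpl; [auto | tauto].
Qed.

Lemma tower_wo : well_order lt.
Proof.
  split; [apply tower_wf | split].
  - intros [[a pa] |] [[b pb] |] [[c pc] |]; simpl; try tauto.
    intros [H1 H2] [H3 H4]. split; [eapply cle_trans; eauto |].
    intros ->. apply H2. apply cle_antisym; auto.
  - intros [a |] [b |]; simpl; auto.
    destruct (classic (proj1_sig a = proj1_sig b)) as [E | E].
    + right; left. f_equal. apply sig_eq; auto.
    + destruct (tower_cmp (proj1_sig a) (proj1_sig b) (proj2_sig a) (proj2_sig b)) as [H | H].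
      * left; auto.
      * right; right. split; auto. eapply cle_trans; [apply cmax_l | exact H].
Qed.

Variable F : C -> C -> Prop.
Hypothesis HF : forall x, tower g x -> F x (g x).

Lemma lt_step a b : lt (Some a) (Some b) -> cle (s (proj1_sig a)) (proj1_sig b).
Proof.
  simpl. intros [H1 H2].
  destruct (tower_cmp (proj1_sig b) (proj1_sig a) (proj2_sig b) (proj2_sig a)) as [H | H]; auto.
  exfalso. apply H2. apply cle_antisym; auto.
Qed.

(** If [s a] differed from [b], it would lie below [b] and hence be at most [a]; then [a] is closed,
    so it is the top, and [b] cannot lie above it. *)
Lemma succ_value a b : is_succ lt (Some a) (Some b) -> proj1_sig b = s (proj1_sig a).
Proof.
  intros [H1 H2]. apply lt_step in H1 as H3.
  set (c := exist (tower g) (s (proj1_sig a)) (tower_step g _ (proj2_sig a)) : {x | tower g x}).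
  apply NNPP. intros Hn.
  destruct (H2 (Some c)) as [E | E].
  - simpl. split; auto.
  - injection E as E. apply (f_equal (@proj1_sig _ _)) in E. simpl in E.
    destruct H1 as [Ha Hb]. apply Hn.
    set (m := proj1_sig a) in *.
    assert (m = nival).
    { apply nival_unique; [apply (proj2_sig a) |]. rewrite <- E at 2. apply cmax_r. }
    exfalso. apply Hb. apply cle_antisym; auto. rewrite H. apply csup_ub. apply (proj2_sig b).
  - simpl in E. destruct E as [E1 E2]. apply E2. apply cle_antisym; auto. apply cmax_l.
Qed.

Lemma tower_stage (a : {x : C | tower g x}) : stage lt F (Some a) (proj1_sig a).
Proof.
  remember (Some a) as w eqn:Ew. revert a Ew.
  induction (tower_wf w) as [w _ IH]. intros a ->.
  destruct (classic (is_zero lt (Some a))) as [Hz | Hz].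
  { replace (proj1_sig a) with czero; [constructor; auto |].
    apply NNPP. intros Hn.
    assert (Ht : tower g czero) by (rewrite <- csup_empty; apply tower_sup; tauto).
    apply (Hz (Some (exist _ czero Ht))). simpl. split; auto. apply czero_le. }
  destruct (classic (exists c, is_succ lt c (Some a))) as [(c & Hc) | Hs].
  { destruct c as [c |]; [| destruct Hc as [[] _]].
    rewrite (succ_value _ _ Hc). eapply stage_succ; [exact Hc | | apply HF; apply (proj2_sig c)].
    apply IH with (y := Some c); auto. apply Hc. }
  assert (Hl : is_limit lt (Some a)).
  { split.
    - apply NNPP. intros H. apply Hz. intros c Hc. apply H. eauto.
    - intros c Hc. apply Hs. eauto. }
  set (val := fun w : W => match w with Some c => proj1_sig c | None => nival end).
  apply stage_limit with (x := val); auto.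
  - intros [c |] Hc; [| destruct Hc]. apply IH with (y := Some c); auto.
  - intros [c |] Hc; [| destruct Hc]. exists (g (proj1_sig c)). apply HF. apply (proj2_sig c).
  (* If the supremum [u] of the earlier elements were not [a] itself, it would be an immediate
     predecessor of [a], which a limit does not have. *)
  - assert (E : proj1_sig a = csup (fun x => exists c, lt (Some c) (Some a) /\ x = proj1_sig c)).
    { set (u := csup _).
      assert (Hu : cle u (proj1_sig a)).
      { apply csup_lub. intros x (c & Hc & ->). apply Hc. }
      assert (Tu : tower g u).
      { apply tower_sup. intros x (c & _ & ->). apply (proj2_sig c). }
      apply NNPP. intros Hn. apply (proj2 Hl (Some (exist _ u Tu))). split.
      - simpl. split; auto.
      - intros [d |] Hd; [| destruct Hd].
        assert (Hdu : cle (proj1_sig d) u) by (apply csup_ub; eauto).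
        destruct (classic (proj1_sig d = u)) as [E | E].
        + left. f_equal. apply sig_eq. auto.
        + right. simpl. auto. }
    intros n. rewrite E. unfold csup. rewrite tb_true. split.
    + intros (x & (c & Hc & ->) & Hn). exists (Some c). auto.
    + intros ([c |] & Hc & Hn); [| destruct Hc]. exists (proj1_sig c). eauto.
Qed.

(** [F] has to follow [g] on the tower only, so a program that converges merely at the stages
    actually reached can serve as operator. *)
Lemma NI_nival : NI F nival.
Proof.
  exists W, lt. split; [apply tower_wo |].
  set (a := exist (tower g) nival nival_tower : {x | tower g x}).
  assert (Hs : is_succ lt (Some a) None).
  { split; [simpl; auto |]. intros [d |] Hd; [| destruct Hd].
    destruct (classic (proj1_sig d = nival)) as [E | E].
    - left. f_equal. apply sig_eq. auto.
    - right. simpl. split; auto. apply csup_ub. apply (proj2_sig d). }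
  exists (Some a), None. split; [exact Hs |].
  assert (Ha := tower_stage a). split; [exact Ha |]. split.
  - rewrite <- nival_closed. eapply stage_succ; [exact Hs | exact Ha | apply HF; apply nival_tower].
  - intros [c |] c' Hc Hcc'; [| destruct Hc].
    destruct c' as [c' |].
    + exists (proj1_sig c), (proj1_sig c'). split; [apply tower_stage | split; [apply tower_stage |]].
      destruct Hcc' as [H _]. apply H.
    + exfalso. destruct Hcc' as [_ H]. destruct (H (Some a)) as [E | E]; [exact I | |].
      * rewrite E in Hc. destruct Hc as [_ Hc]. apply Hc. auto.
      * apply (proj2 E). apply cle_antisym; [apply E | apply Hc].
Qed.
End Tower.

(** * Stages of a converging induction *)

Section Elim.
Context {W : Type} (lt : W -> W -> Prop) (Hwo : well_order lt).
Variable F : C -> C -> Prop.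
(** Determinacy is assumed at stages only, because in [NI_agree] it is established for the second
    relation only there. *)
Hypothesis HF : forall b z y y', stage lt F b z -> F z y -> F z y' -> y = y'.

Let Hwf : well_founded lt := proj1 Hwo.
Let Htr : forall a b c, lt a b -> lt b c -> lt a c := proj1 (proj2 Hwo).
Let Htot : forall a b, lt a b \/ a = b \/ lt b a := proj2 (proj2 Hwo).

Lemma wo_irrefl a : ~ lt a a.
Proof. intros H. induction (Hwf a) as [a _ IH]. exact (IH a H H). Qed.

Lemma succ_pred_unique c d b : is_succ lt c b -> is_succ lt d b -> c = d.
Proof.
  intros [H1 H2] [H3 H4].
  destruct (H2 d H3) as [E | E]; auto. destruct (H4 c H1) as [E' | E']; auto.
  exfalso. apply (wo_irrefl c). eauto.
Qed.

Lemma stage_unique b x x' : stage lt F b x -> stage lt F b x' -> x = x'.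
Proof.
  revert x x'. induction (Hwf b) as [b _ IH]. intros x x' H H'.
  inversion H as [? Hz | ? c z y Hs Hst Hy | ? u ? Hl Hu Hd Hsup]; subst;
  inversion H' as [? Hz' | ? c' z' y' Hs' Hst' Hy' | ? u' ? Hl' Hu' Hd' Hsup']; subst; auto.
  - exfalso. apply (Hz c'). apply Hs'.
  - exfalso. destruct Hl' as [[d Hd1] _]. apply (Hz d); auto.
  - exfalso. apply (Hz' c). apply Hs.
  - assert (c = c') by (eapply succ_pred_unique; eauto). subst c'.
    assert (z = z') by (eapply IH; eauto; apply Hs). subst z'.
    f_equal. eauto.
  - exfalso. apply (proj2 Hl' c); auto.
  - exfalso. destruct Hl as [[d Hd1] _]. apply (Hz' d); auto.
  - exfalso. apply (proj2 Hl c'); auto.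
  - apply cle_antisym; intros n Hn.
    + apply Hsup in Hn. destruct Hn as (c & Hc & Hn). apply Hsup'. exists c.
      split; auto. rewrite (IH c Hc (u' c) (u c)); auto.
    + apply Hsup' in Hn. destruct Hn as (c & Hc & Hn). apply Hsup. exists c.
      split; auto. rewrite (IH c Hc (u c) (u' c)); auto.
Qed.

Lemma stage_below b x c : stage lt F b x -> lt c b ->
  exists z, stage lt F c z /\ exists y, F z y.
Proof.
  intros H. revert c. induction H as [b Hz | b c x y Hs Hst IH Hy | b u s Hl Hu IH Hd Hsup];
    intros d Hlt.
  - exfalso. apply (Hz d Hlt).
  - destruct (proj2 Hs d Hlt) as [-> | H]; eauto.
  - eauto.
Qed.

Lemma stage_le b x b' x' : stage lt F b x -> stage lt F b' x' -> lt b b' -> cle x x'.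
Proof.
  intros Hx Hx' Hlt.
  induction Hx' as [b' Hz | b' c z y Hs Hst IH Hy | b' u s Hl Hu IH Hd Hsup].
  - exfalso. apply (Hz b Hlt).
  - eapply cle_trans; [| apply cmax_l].
    destruct (proj2 Hs b Hlt) as [-> | H]; auto.
    rewrite (stage_unique _ _ _ Hx Hst). apply cle_refl.
  - rewrite (stage_unique _ _ _ Hx (Hu b Hlt)). intros n Hn. apply Hsup. eauto.
Qed.

Lemma exists_least (P : W -> Prop) :
  (exists b, P b) -> exists b, P b /\ forall c, P c -> b = c \/ lt b c.
Proof.
  intros (b & Hb). revert Hb. induction (Hwf b) as [b _ IH]. intros Hb.
  destruct (classic (exists c, P c /\ lt c b)) as [(c & Hc & Hl) | H]; eauto.
  exists b. split; auto. intros c Hc. destruct (Htot b c) as [H' | [H' | H']]; auto.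
  exfalso. eauto.
Qed.

Variables a a' : W.
Variable x : C.
Hypothesis Hs : is_succ lt a a'.
Hypothesis Ha : stage lt F a x.
Hypothesis Ha' : stage lt F a' x.
Hypothesis Hleast : forall c c', lt c a -> is_succ lt c c' ->
      exists y y', stage lt F c y /\ stage lt F c' y' /\ y <> y'.

Definition low (z : C) : Prop := exists b, (b = a \/ lt b a) /\ stage lt F b z.

Lemma low_top : low x.
Proof. exists a. auto. Qed.

Lemma top_closed : exists y, F x y /\ cmax x y = x.
Proof.
  inversion Ha' as [? Hz | ? c z y Hs' Hst Hy | ? u ? Hl Hu Hd Hsup]; subst.
  - exfalso. apply (Hz a). apply Hs.
  - assert (c = a) by (eapply succ_pred_unique; eauto). subst c.
    set (w := cmax z y) in *.
    assert (z = w) by (eapply stage_unique; eauto). exists y. rewrite <- H. split; auto.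
  - exfalso. apply (proj2 Hl a); auto.
Qed.

Lemma low_le z : low z -> cle z x.
Proof.
  intros (b & [-> | Hb] & H).
  - rewrite (stage_unique _ _ _ H Ha). apply cle_refl.
  - exact (stage_le b z a x H Ha Hb).
Qed.

Lemma low_def z : low z -> exists y, F z y.
Proof.
  intros (b & [-> | Hb] & H).
  - rewrite (stage_unique _ _ _ H Ha). destruct top_closed as (y & Hy & _). eauto.
  - destruct (stage_below a x b Ha Hb) as (z' & Hz' & y & Hy).
    rewrite (stage_unique _ _ _ H Hz'). eauto.
Qed.

Lemma next_exists b : lt b a -> exists b', is_succ lt b b' /\ (b' = a \/ lt b' a).
Proof.
  intros Hb. destruct (exists_least (fun c => lt b c)) as (b' & Hb' & Hl); eauto.
  exists b'. split.
  - split; auto. intros d Hd. destruct (Htot d b) as [H | [H | H]]; auto.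
    exfalso. destruct (Hl d H) as [-> | H']; [exact (wo_irrefl _ Hd) | exact (wo_irrefl _ (Htr _ _ _ Hd H'))].
  - apply Hl; auto.
Qed.

Lemma low_step z y : low z -> F z y -> low (cmax z y).
Proof.
  intros (b & [-> | Hb] & H) Hy.
  - assert (z = x) by (eapply stage_unique; eauto). subst z.
    destruct top_closed as (y' & Hy' & E). rewrite (HF a x y y'); auto. rewrite E. apply low_top.
  - destruct (next_exists b Hb) as (b' & Hb' & Hl). exists b'. split; auto.
    eapply stage_succ; eauto.
Qed.

Lemma low_closed z y : low z -> F z y -> cmax z y = z -> z = x.
Proof.
  intros (b & [-> | Hb] & H) Hy E; [eapply stage_unique; eauto |].
  exfalso. destruct (next_exists b Hb) as (b' & Hb' & _).
  destruct (Hleast b b' Hb Hb') as (y1 & y2 & H1 & H2 & Hn). apply Hn.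
  rewrite (stage_unique _ _ _ H1 H).
  eapply stage_unique; [| exact H2]. rewrite <- E. eapply stage_succ; eauto.
Qed.

(** Take the least position [b] whose stage bounds [P]. Each earlier stage is exceeded by a member
    of [P]: if [b] is a successor, some member sits at [b] or later; if [b] is a limit, the members
    are cofinal below it. In both cases the stage at [b] is the supremum. *)
Lemma low_sup (P : C -> Prop) : (forall z, P z -> low z) -> low (csup P).
Proof.
  intros HP.
  destruct (exists_least (fun b => (b = a \/ lt b a) /\
     exists z, stage lt F b z /\ forall t, P t -> cle t z)) as (b & (Hba & z & Hz & Hub) & Hl).
  { exists a. split; auto. exists x. split; auto. intros t Ht. apply low_le. auto. }
  exists b. split; auto. replace (csup P) with z; auto.
  apply cle_antisym; [| apply csup_lub; auto].
  assert (Hbig : forall c y, stage lt F c y -> lt c b -> exists t c1, P t /\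
            stage lt F c1 t /\ lt c c1).
  { intros c y Hy Hc.
    assert (Hca : c = a \/ lt c a) by (right; destruct Hba as [-> | ?]; eauto).
    destruct (classic (forall t, P t -> cle t y)) as [H | H].
    - exfalso. destruct (Hl c (conj Hca (ex_intro _ y (conj Hy H)))) as [-> | H'].
      + exact (wo_irrefl _ Hc).
      + exact (wo_irrefl _ (Htr _ _ _ Hc H')).
    - apply not_all_le in H. destruct H as (t & Ht & Hn).
      destruct (HP t Ht) as (c1 & Hc1 & Hst). exists t, c1. split; auto. split; auto.
      destruct (Htot c c1) as [H | [H | H]]; auto; exfalso; apply Hn.
      + subst c1. rewrite (stage_unique _ _ _ Hst Hy). apply cle_refl.
      + exact (stage_le c1 t c y Hst Hy H). }
  inversion Hz as [? Hz0 | ? c z0 y Hs' Hst Hy | ? u ? Hlim Hu Hd Hsup]; subst.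
  - apply czero_le.
  - destruct (Hbig c z0 Hst (proj1 Hs')) as (t & c1 & Ht & Hst1 & Hlt).
    eapply cle_trans; [| apply csup_ub; exact Ht].
    destruct (Htot b c1) as [H | [H | H]].
    + eapply stage_le; [exact Hz | exact Hst1 | exact H].
    + subst c1. rewrite (stage_unique _ _ _ Hst1 Hz). apply cle_refl.
    + exfalso. destruct (proj2 Hs' c1 H) as [-> | H']; [exact (wo_irrefl _ Hlt) |].
      exact (wo_irrefl _ (Htr _ _ _ Hlt H')).
  - intros n Hn. apply Hsup in Hn. destruct Hn as (c & Hc & Hn).
    destruct (Hbig c (u c) (Hu c Hc) Hc) as (t & c1 & Ht & Hst1 & Hlt).
    apply (csup_ub P t Ht). eapply stage_le; [exact (Hu c Hc) | exact Hst1 | exact Hlt | exact Hn].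
Qed.
End Elim.

(* [S] is the set of stages of the converging induction. *)
Lemma NI_elim (F : C -> C -> Prop) x :
  (forall z y y', F z y -> F z y' -> y = y') -> NI F x ->
  exists S : C -> Prop,
    (forall z y, S z -> F z y -> S (cmax z y)) /\
    (forall P : C -> Prop, (forall z, P z -> S z) -> S (csup P)) /\
    (forall z, S z -> exists y, F z y) /\
    S x /\ (exists y, F x y /\ cmax x y = x) /\
    (forall z y, S z -> F z y -> cmax z y = z -> z = x).
Proof.
  intros HF (W & lt & Hwo & a & a' & Hs & Ha & Ha' & Hl).
  assert (HF' : forall b z y y', stage lt F b z -> F z y -> F z y' -> y = y') by eauto.
  exists (low lt F a). repeat split.
  - intros z y. eapply low_step; eauto.
  - intros P. eapply low_sup; eauto.
  - intros z. eapply low_def; eauto.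
  - eapply low_top; eauto.
  - eapply top_closed; eauto.
  - intros z y. eapply low_closed; eauto.
Qed.

(** Every stage of [F2] stays inside the closed set [S] of stages of [F1], where [F1] is defined and
    so agrees with [F2]; the closed stage [x'] is then the closed element of [S]. All assumptions
    start from values of [F1], since in [kleene_det] only one of the two derivations carries an
    induction hypothesis. *)
Lemma NI_agree (F1 F2 : C -> C -> Prop) x x' :
  (forall z y y', F1 z y -> F1 z y' -> y = y') ->
  (forall z y y', F1 z y -> F2 z y' -> y = y') ->
  NI F1 x -> NI F2 x' -> x = x'.
Proof.
  intros HF HA H1 (W & lt & Hwo & a & a' & Hs & Ha & Ha' & Hl).
  destruct (NI_elim F1 x HF H1) as (S & Sstep & Ssup & Sdef & Stop & _ & Sclosed).
  assert (HS : forall b z, stage lt F2 b z -> S z).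
  { intros b z H. induction H as [b Hz | b c z y Hs' Hst IH Hy | b u s Hlim Hu IH Hd Hsup].
    - rewrite <- csup_empty. apply Ssup. tauto.
    - destruct (Sdef z IH) as (y1 & Hy1). rewrite <- (HA z y1 y Hy1 Hy). auto.
    - replace s with (csup (fun z => exists c, lt c b /\ z = u c)).
      + apply Ssup. intros z (c & Hc & ->). auto.
      + apply cle_antisym.
        * apply csup_lub. intros z (c & Hc & ->) n Hn. apply Hsup. eauto.
        * intros n Hn. apply Hsup in Hn. destruct Hn as (c & Hc & Hn).
          apply (csup_ub (fun z => exists c, lt c b /\ z = u c) (u c)); eauto. }
  assert (HF2 : forall b z y y', stage lt F2 b z -> F2 z y -> F2 z y' -> y = y').
  { intros b z y y' Hst Hy Hy'. destruct (Sdef z (HS b z Hst)) as (y1 & Hy1).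
    rewrite <- (HA z y1 y); auto. eauto. }
  destruct (top_closed lt Hwo F2 HF2 a a' x' Hs Ha Ha') as (y & Hy & E).
  destruct (Sdef x' (HS a x' Ha)) as (y1 & Hy1).
  rewrite (HA x' y1 y Hy1 Hy) in Hy1. symmetry. eapply Sclosed; eauto.
Qed.

(** * Induction on derivations and determinacy of values *)

Definition stage_mono {W : Type} {lt : W -> W -> Prop} {F F' : C -> C -> Prop}
    (H : forall x y, F x y -> F' x y) :
    forall b x, stage lt F b x -> stage lt F' b x :=
  fix go b x (s : stage lt F b x) {struct s} : stage lt F' b x :=
    match s in stage _ _ b0 x0 return stage lt F' b0 x0 with
    | stage_zero _ _ b hz => stage_zero lt F' b hz
    | stage_succ _ _ b c x y hs s1 k =>
        stage_succ lt F' b c x y hs (go c x s1) (H x y k)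
    | stage_limit _ _ b x s hl hx hd hs =>
        stage_limit lt F' b x s hl (fun c l => go c (x c) (hx c l))
          (fun c l => match hd c l with ex_intro _ y k => ex_intro _ y (H (x c) y k) end) hs
    end.

(** Like [stage_mono], this is a transparent term, so that the guard condition of [kleene_strong]
    can be checked through it: there [H] calls the fixpoint on derivations nested inside [NI]. *)
Definition NI_mono {F F' : C -> C -> Prop} (H : forall x y, F x y -> F' x y)
    (x : C) (k : NI F x) : NI F' x :=
  match k with
  | ex_intro _ W (ex_intro _ lt (conj wo (ex_intro _ a (ex_intro _ a'
      (conj hs (conj s1 (conj s2 hl))))))) =>
    ex_intro _ W (ex_intro _ lt (conj wo (ex_intro _ a (ex_intro _ a'
      (conj hs (conj (stage_mono H a x s1) (conj (stage_mono H a' x s2)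
        (fun c c' l i => match hl c c' l i with
           ex_intro _ y (ex_intro _ y' (conj t1 (conj t2 n))) =>
           ex_intro _ y (ex_intro _ y'
             (conj (stage_mono H c y t1) (conj (stage_mono H c' y' t2) n))) end))))))))
  end.

Section KleeneInd.
Variable P : nat -> list ((nat -> nat) -> nat) -> list (nat -> nat) -> list nat -> nat -> Prop.
Hypothesis H1 : forall F f a1 a, P (code [1]) F f (a1 :: a) (a1 + 1).
Hypothesis H2 : forall q F f a, P (code [2; q]) F f a q.
Hypothesis H3 : forall F f a1 a, P (code [3]) F f (a1 :: a) a1.
Hypothesis H4 : forall e1 e2 F f a b c,
  kleene e2 F f a b -> P e2 F f a b ->
  kleene e1 F f (b :: a) c -> P e1 F f (b :: a) c -> P (code [4; e1; e2]) F f a c.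
Hypothesis H6 : forall e1 t1 t2 t3 F f a F' f' a' c,
  permuted t1 F F' -> permuted t2 f f' -> permuted t3 a a' ->
  kleene e1 F' f' a' c -> P e1 F' f' a' c -> P (code [6; e1; t1; t2; t3]) F f a c.
Hypothesis H7 : forall F f1 f a1 a, P (code [7]) F (f1 :: f) (a1 :: a) (f1 a1).
Hypothesis H82 : forall d F1 F f a (g : nat -> nat),
  (forall n, kleene d (F1 :: F) f (n :: a) (g n)) ->
  (forall n, P d (F1 :: F) f (n :: a) (g n)) -> P (code [8; 2; d]) (F1 :: F) f a (F1 g).
Hypothesis H83 : forall d F f b a (x : C),
  NI (FG (fun h m => kleene d F (h :: f) a m /\ P d F (h :: f) a m)) x ->
  P (code [8; 3; d]) F f (b :: a) (Nat.b2n (x b)).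
Hypothesis H9 : forall d F f a c,
  kleene d F f a c -> P d F f a c -> P (code [9]) F f (d :: a) c.

(** Derivations for S8.3 are nested inside [NI]; the hypothesis in that case is therefore an [NI]
    whose relation carries [P] beside [kleene]. *)
Fixpoint kleene_strong e F f a c (k : kleene e F f a c) {struct k} : P e F f a c :=
  match k in kleene e F f a c return P e F f a c with
  | S1 F f a1 a => H1 F f a1 a
  | S2 q F f a => H2 q F f a
  | S3 F f a1 a => H3 F f a1 a
  | S4 e1 e2 F f a b c k2 k1 =>
      H4 e1 e2 F f a b c k2 (kleene_strong _ _ _ _ _ k2) k1 (kleene_strong _ _ _ _ _ k1)
  | S6 e1 t1 t2 t3 F f a F' f' a' c p1 p2 p3 k1 =>
      H6 e1 t1 t2 t3 F f a F' f' a' c p1 p2 p3 k1 (kleene_strong _ _ _ _ _ k1)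
  | S7 F f1 f a1 a => H7 F f1 f a1 a
  | S8_2 d F1 F f a g k1 =>
      H82 d F1 F f a g k1 (fun n => kleene_strong _ _ _ _ _ (k1 n))
  | S8_3 d F f b a x k1 =>
      H83 d F f b a x
        (NI_mono (fun x y k => fun n => match k n with
           ex_intro _ m (conj km e) => ex_intro _ m (conj (conj km (kleene_strong _ _ _ _ _ km)) e) end) x k1)
  | S9 d F f a c k1 => H9 d F f a c k1 (kleene_strong _ _ _ _ _ k1)
  end.
End KleeneInd.

Lemma code_inj s t : code s = code t -> s = t.
Proof.
  revert t. induction s as [| a s IH]; intros [| b t]; cbn [code]; intros H; try discriminate; auto.
  apply eq_add_S, to_nat_inj in H. injection H as -> H. f_equal. auto.
Qed.

Lemma permuted_det {A : Type} t (xs ys ys' : list A) :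
  permuted t xs ys -> permuted t xs ys' -> ys = ys'.
Proof.
  intros (p & -> & _ & H) (p' & Hc & _ & H'). apply code_inj in Hc. subst p'.
  rewrite H in H'. revert H'. clear. revert ys'.
  induction ys as [| y ys IH]; intros [| y' ys'] H; simpl in H; try discriminate; auto.
  injection H as -> H. f_equal; auto.
Qed.

Lemma b2n_min_inj (b b' : bool) m : Nat.b2n b = Nat.min m 1 -> Nat.b2n b' = Nat.min m 1 -> b = b'.
Proof. destruct b, b'; simpl; intros; auto; lia. Qed.

(** For S8.3 the first relation given to [NI_agree] is the one carrying the induction hypothesis:
    compared with itself it yields determinacy, compared with the other derivation agreement. *)
Lemma kleene_det e F f a c c' : kleene e F f a c -> kleene e F f a c' -> c = c'.
Proof.
  intros H. revert c'.
  induction H as [F f a1 a | q F f a | F f a1 a | e1 e2 F f a b c K2 IH2 K1 IH1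
    | e1 t1 t2 t3 F f a F' f' a' c P1 P2 P3 K IH | F f1 f a1 a | d F1 F f a g K IH
    | d F f b a x HNI | d F f a c K IH] using kleene_strong; intros c' H';
  match type of H' with kleene ?e _ _ _ _ => remember e as e0 eqn:Ee end;
  inversion H'; subst; clear H'; 
  try match goal with H : _ = code _ |- _ => apply code_inj in H; try discriminate H; injection H; intros; subst end;
  auto.
  - match goal with H : kleene e2 _ _ _ _ |- _ => apply IH2 in H; subst end. auto.
  - repeat match goal with
    | H : permuted ?t ?x ?y, H' : permuted ?t ?x ?y' |- _ =>
        assert (y = y') by (eapply permuted_det; eauto); subst; clear H'
    end. auto.
  - f_equal. apply functional_extensionality. auto.
  - f_equal.
    match goal with H : NI _ ?y |- _ => assert (x = y); [| subst; auto] end.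
    eapply NI_agree; [| | exact HNI | eassumption].
    + intros z y y' H1' H2'. apply functional_extensionality. intros n.
      destruct (H1' n) as (m & (Km & IHm) & E). destruct (H2' n) as (m' & (Km' & _) & E').
      apply IHm in Km'. subst. eapply b2n_min_inj; eauto.
    + intros z y y' H1' H2'. apply functional_extensionality. intros n.
      destruct (H1' n) as (m & (Km & IHm) & E). destruct (H2' n) as (m' & Km' & E').
      apply IHm in Km'. subst. eapply b2n_min_inj; eauto.
Qed.

(** * Templates of indices *)

(* S6 needs permutations of the exact lengths, so an index depends on the lengths
   [K], [L], [M] of the three sequences that it is run on. [Tl i c] and [Tm i c d]
   are the tails from [i] of the identity permutations of [L + c] and [M + c - d]. *)
Inductive tm : Type :=
| Tn (n : nat)
| Tc (t u : tm)
| Tk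
| Tl (i c : nat)
| Tm (i c d : nat).

Fixpoint ev (t : tm) (K L M : nat) : nat :=
  match t with
  | Tn n => n
  | Tc t u => S (to_nat (ev t K L M, ev u K L M))
  | Tk => code (seq 0 K)
  | Tl i c => code (seq i (L + c - i))
  | Tm i c d => code (seq i (M + c - d - i))
  end.

(** Shifts of context: a program meant for a sequence one entry longer or shorter is expressed over
    the lengths at the place where it is mentioned. *)
Fixpoint upM (t : tm) : tm :=
  match t with
  | Tc t u => Tc (upM t) (upM u)
  | Tm i c d => Tm i (S c) d
  | _ => t
  end.

Fixpoint dnM (t : tm) : tm :=
  match t with
  | Tc t u => Tc (dnM t) (dnM u)
  | Tm i c d => Tm i c (S d)
  | _ => t
  end.

Fixpoint upL (t : tm) : tm :=
  match t with
  | Tc t u => Tc (upL t) (upL u)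
  | Tl i c => Tl i (S c)
  | _ => t
  end.

Arguments to_nat : simpl never.

Lemma ev_upM t K L M : ev (upM t) K L M = ev t K L (S M).
Proof. induction t; cbn [ev upM]; first [congruence | do 2 f_equal; lia]. Qed.

Lemma ev_dnM t K L M : ev (dnM t) K L (S M) = ev t K L M.
Proof. induction t; cbn [ev dnM]; first [congruence | do 2 f_equal; lia]. Qed.

Lemma ev_upL t K L M : ev (upL t) K L M = ev t K (S L) M.
Proof. induction t; cbn [ev upL]; first [congruence | do 2 f_equal; lia]. Qed.

Definition tcode (l : list tm) : tm := fold_right Tc (Tn 0) l.

Lemma ev_tcode l K L M : ev (tcode l) K L M = code (map (fun t => ev t K L M) l).
Proof. induction l; simpl; auto; congruence. Qed.

Definition tpre (l : list nat) (t : tm) : tm := fold_right (fun n => Tc (Tn n)) t l.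

Lemma ev_tpre l t s K L M : ev t K L M = code s -> ev (tpre l t) K L M = code (l ++ s).
Proof. intros H. induction l; simpl; auto. congruence. Qed.

(** The permutation that brings position [i] to the front and keeps the order of the rest. Its
    prefix is spelled out, and only the tail depends on the length. *)
Definition tmoveL (i : nat) : tm := tpre (i :: seq 0 i) (Tl (S i) 0).
Definition tmoveM (i : nat) : tm := tpre (i :: seq 0 i) (Tm (S i) 0 0).

Definition moved (i n : nat) : list nat := i :: seq 0 i ++ seq (S i) (n - S i).

Lemma ev_tmoveL i K L M : ev (tmoveL i) K L M = code (moved i L).
Proof.
  unfold tmoveL. rewrite ev_tpre with (s := seq (S i) (L - S i)); auto.
  simpl. repeat f_equal. lia.
Qed.

Lemma ev_tmoveM i K L M : ev (tmoveM i) K L M = code (moved i M).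
Proof.
  unfold tmoveM. rewrite ev_tpre with (s := seq (S i) (M - S i)); auto.
  simpl. repeat f_equal. lia.
Qed.

Lemma map_nth_error_seq {A : Type} (l1 l2 : list A) l3 :
  map (nth_error (l1 ++ l2 ++ l3)) (seq (length l1) (length l2)) = map Some l2.
Proof.
  revert l1. induction l2 as [| x l2 IH]; intros l1; simpl; auto.
  f_equal.
  - rewrite nth_error_app2, Nat.sub_diag; auto.
  - specialize (IH (l1 ++ [x])). rewrite <- app_assoc in IH. simpl in IH.
    rewrite length_app, Nat.add_1_r in IH. exact IH.
Qed.

Lemma permuted_id {A : Type} (xs : list A) : permuted (code (seq 0 (length xs))) xs xs.
Proof.
  exists (seq 0 (length xs)). repeat split; auto.
  pose proof (map_nth_error_seq [] xs []) as H. simpl in H. rewrite app_nil_r in H. exact H.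
Qed.

Lemma permuted_move {A : Type} (l1 l2 : list A) x :
  permuted (code (moved (length l1) (length (l1 ++ x :: l2)))) (l1 ++ x :: l2) (x :: l1 ++ l2).
Proof.
  unfold moved. set (n := length (l1 ++ x :: l2)).
  assert (En : n - S (length l1) = length l2) by (unfold n; rewrite length_app; simpl; lia).
  rewrite En. eexists. split; [reflexivity | split].
  - rewrite length_app. change (length (x :: l2)) with (1 + length l2).
    rewrite seq_app. simpl. apply Permutation_middle.
  - simpl. f_equal.
    + rewrite nth_error_app2, Nat.sub_diag; auto.
    + rewrite !map_app. f_equal.
      * exact (map_nth_error_seq [] l1 (x :: l2)).
      * pose proof (map_nth_error_seq (l1 ++ [x]) l2 []) as H.
        rewrite app_nil_r, <- app_assoc, length_app in H. simpl in H.
        rewrite Nat.add_1_r in H. exact H.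
Qed.

(** * Program combinators *)

Section Run.
Variable F : list ((nat -> nat) -> nat).

Definition run (t : tm) (f : list (nat -> nat)) (a : list nat) (c : nat) : Prop :=
  kleene (ev t (length F) (length f) (length a)) F f a c.

Definition tLet (p q : tm) : tm := tcode [Tn 4; upM q; p].

Lemma run_let p q f a b c : run p f a b -> run q f (b :: a) c -> run (tLet p q) f a c.
Proof.
  unfold run, tLet. rewrite ev_tcode. simpl. rewrite ev_upM. apply S4.
Qed.

Definition tQuote (p : tm) : tm := tcode [Tn 2; p].

Lemma run_quote p f a : run (tQuote p) f a (ev p (length F) (length f) (length a)).
Proof. unfold run, tQuote. rewrite ev_tcode. apply S2. Qed.

Definition tConst (n : nat) : tm := tQuote (Tn n).

Lemma run_const n f a : run (tConst n) f a n.
Proof. apply run_quote. Qed.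

Definition tExec (p : tm) : tm := tcode [Tn 4; Tn (code [9]); p].

Lemma run_exec p f a z c : run p f a z -> kleene z F f a c -> run (tExec p) f a c.
Proof.
  unfold run, tExec. rewrite ev_tcode. intros H H'. eapply S4; [exact H | apply S9; exact H'].
Qed.

Definition tVar (i : nat) : tm := tcode [Tn 6; Tn (code [3]); Tk; Tl 0 0; tmoveM i].

Lemma run_var i f a v : nth_error a i = Some v -> run (tVar i) f a v.
Proof.
  intros H. apply nth_error_split in H. destruct H as (l1 & l2 & -> & <-).
  unfold run, tVar. rewrite ev_tcode. cbn [map]. rewrite ev_tmoveM. cbn [ev].
  rewrite Nat.add_0_r, Nat.sub_0_r.
  eapply S6; [apply permuted_id | apply permuted_id | apply permuted_move | apply S3].
Qed.

Definition tApp (j i : nat) : tm := tcode [Tn 6; Tn (code [7]); Tk; tmoveL j; tmoveM i].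

Lemma run_app j i f a g v :
  nth_error f j = Some g -> nth_error a i = Some v -> run (tApp j i) f a (g v).
Proof.
  intros H H'. apply nth_error_split in H, H'.
  destruct H as (l1 & l2 & -> & <-). destruct H' as (l1' & l2' & -> & <-).
  unfold run, tApp. rewrite ev_tcode. cbn [map]. rewrite ev_tmoveM, ev_tmoveL. cbn [ev].
  eapply S6; [apply permuted_id | apply permuted_move | apply permuted_move | apply S7].
Qed.

Definition tSuc (p : tm) : tm := tLet p (Tn (code [1])).

Lemma run_suc p f a v : run p f a v -> run (tSuc p) f a (S v).
Proof.
  intros H. eapply run_let; [exact H |]. replace (S v) with (v + 1) by lia. apply S1.
Qed.

Definition tAdd (n : nat) (p : tm) : tm := Nat.iter n tSuc p.

Lemma run_add n p f a v : run p f a v -> run (tAdd n p) f a (n + v).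
Proof. intros H. induction n; simpl; auto. apply run_suc. exact IHn. Qed.

(* [code [3] = 7] returns the first number and [code [2; 0] = 8] returns [0]:
   running the index [7 + b] is a case distinction on [b]. *)
Definition tNimp (p q : tm) : tm := tLet q (tExec (tAdd 7 p)).

Lemma run_nimp p q f a (b : bool) y :
  run q f a y -> run p f (y :: a) (Nat.b2n b) -> run (tNimp p q) f a (if b then 0 else y).
Proof.
  intros H H'. eapply run_let; [exact H |]. eapply run_exec; [apply run_add; exact H' |].
  destruct b; simpl.
  - exact (S2 0 F f (y :: a)).
  - exact (S3 F f y a).
Qed.

(** An index for the constant [c] that is at least [code [9]], so that [tIfc] can reach it from
    there by addition; the plain index [code [2; c]] may be too small. *)
Definition wc (c : nat) : nat := code [4; code [2; c]; code [2; 0]].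

Lemma to_nat_ge x y : x + y <= to_nat (x, y).
Proof.
  pose proof (to_nat_spec x y) as H. nia.
Qed.

Lemma wc_ge c : code [9] <= wc c.
Proof.
  unfold wc. set (s := [code [2; c]; code [2; 0]]).
  change (code (4 :: s)) with (S (to_nat (4, code s))).
  assert (9 <= code s).
  { unfold s. change (code [code [2; c]; code [2; 0]]) with
      (S (to_nat (code [2; c], code [code [2; 0]]))).
    assert (9 <= code [code [2; 0]]) by (vm_compute; lia).
    pose proof (to_nat_ge (code [2; c]) (code [code [2; 0]])). lia. }
  pose proof (to_nat_spec 4 (code s)). change (code [9]) with 46. nia.
Qed.

Lemma run_wc c f a : kleene (wc c) F f a c.
Proof. eapply S4; apply S2. Qed.

(* Unlike in [tNimp], [q] need not converge when [p] holds: the number added to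
   [code [9]] yields either [code [9]], which runs [q], or the index [wc c] of [c]. *)
Definition tIfc (c : nat) (p q : tm) : tm :=
  tLet (tQuote q) (tExec (tAdd (code [9])
    (tLet (tConst (wc c - code [9])) (tExec (tAdd 7 p))))).

(** The test runs below two pushed numbers, the quoted [q] and the offset of [wc c]. It has to
    return the negated condition because [tNimp] keeps its number exactly when the test gives 0. *)
Lemma run_ifc c p q f a (b : bool) v :
  (forall y z, run p f (y :: z :: a) (Nat.b2n (negb b))) ->
  (b = true -> v = c) -> (b = false -> run q f a v) -> run (tIfc c p q) f a v.
Proof.
  intros Hp Ht Hf. unfold tIfc. eapply run_let; [apply run_quote |].
  set (z := ev q _ _ _).
  eapply run_exec.
  - apply run_add. eapply run_nimp; [apply run_const | apply Hp].
  - destruct b; cbn [negb].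
    + rewrite Ht by auto. replace (code [9] + (wc c - code [9])) with (wc c).
      * apply run_wc.
      * pose proof (wc_ge c). lia.
    + rewrite Nat.add_0_r. apply S9. apply Hf. auto.
Qed.

Definition tNi (D b : tm) : tm := tcode [Tn 4; tcode [Tn 8; Tn 3; upL D]; b].

Lemma run_ni_gen (g : C -> C) D b f a v :
  (forall x n, tower g x ->
     exists m, run D (ncons n x :: f) a m /\ Nat.b2n (g x n) = Nat.min m 1) ->
  run b f a v -> run (tNi D b) f a (Nat.b2n (nival g v)).
Proof.
  intros H Hb. unfold run, tNi. rewrite ev_tcode. eapply S4; [exact Hb |].
  rewrite ev_tcode. cbn [map ev]. rewrite ev_upL. apply S8_3. apply NI_nival.
  intros x Hx n. apply H. exact Hx.
Qed.

(** Inside an induction the topmost function is [ncons n x]; its value at 0 is the number of the bit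
    that is asked for. *)
Definition tH : tm := tLet (tConst 0) (Tn (code [7])).

Lemma run_tH h f a : run tH (h :: f) a (h 0).
Proof. eapply run_let; [apply run_const | apply S7]. Qed.
End Run.

#[global] Opaque run tLet tQuote tExec tVar tApp tSuc tAdd tNimp tIfc tNi tH code to_nat.

(** * Formulas closed under non-monotone induction *)

Definition scons {A : Type} (x : A) (f : nat -> A) : nat -> A :=
  fun i => match i with 0 => x | S j => f j end.

(** The primitives are what the schemes give before any arithmetic exists: the test for nonzero
    comes from truncation, [fNimp] from [tNimp], and the predecessor in [fMemP] from the layout of
    [ncons], where bit [n] stands at place [n + 1]. *)
Inductive fm : Type :=
| fNZ (i : nat)
| fMem (j i : nat)
| fMemP (j i : nat)
| fNimp (p q : fm)
| fTrue
| fEx (p : fm)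
| fNi (p : fm) (i : nat).

Fixpoint sem (p : fm) (X : nat -> C) (v : nat -> nat) : Prop :=
  match p with
  | fNZ i => v i <> 0
  | fMem j i => X j (v i) = true
  | fMemP j i => exists n, v i = S n /\ X j n = true
  | fNimp p q => sem q X v /\ ~ sem p X v
  | fTrue => True
  | fEx p => exists n, sem p X (scons n v)
  | fNi p i => nival (fun x n => tb (sem p (scons x X) (scons n v))) (v i) = true
  end.

Fixpoint used (p : fm) (i : nat) : Prop :=
  match p with
  | fNZ k | fMem _ k | fMemP _ k => i = k
  | fNimp p q => used p i \/ used q i
  | fTrue => False
  | fEx p => used p (S i)
  | fNi p k => used p (S i) \/ i = k
  end.

Fixpoint usedX (p : fm) (j : nat) : Prop :=
  match p with
  | fNZ _ | fTrue => False
  | fMem k _ | fMemP k _ => j = k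
  | fNimp p q => usedX p j \/ usedX q j
  | fEx p => usedX p j
  | fNi p _ => usedX p (S j)
  end.

(** The operator ignores the stage and returns the number of the bit; truncation at 1 turns this
    into the set of nonzero numbers, which is reached in one step. *)
Definition tNZ (i : nat) : tm := tNi tH (tVar i).
Definition tNot (p : tm) : tm := tNimp p (tConst 1).

(* By [nival_below], the induction in [fEx] yields [0] iff [p] has a witness. *)
Fixpoint comp (p : fm) (sg rh : nat -> nat) : tm :=
  match p with
  | fNZ i => tNZ (sg i)
  | fMem j i => tLet (tSuc (tVar (sg i))) (tApp (rh j) 0)
  | fMemP j i => tNimp (tNot (tNZ (S (S (sg i))))) (tApp (rh j) (sg i))
  | fNimp p q => tNimp (comp p (fun i => S (sg i)) rh) (comp q sg rh)
  | fTrue => tConst 1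
  | fEx p =>
      let p' := comp p (fun i => S (S (scons 0 (fun i => S (sg i)) i))) (fun j => S (rh j)) in
      tNi (tLet tH (tNot (tNimp p' (tNot (tLet (tSuc (tSuc (tVar 2))) (tApp 0 0)))))) (tConst 0)
  | fNi p i =>
      tNi (tLet tH (comp p (scons 0 (fun i => S (sg i))) (scons 0 (fun j => S (rh j))))) (tVar (sg i))
  end.

Lemma nival_const (y : C) : nival (fun _ => y) = y.
Proof.
  set (g := fun _ : C => y).
  assert (E : cmax czero y = y) by (apply cle_antisym;
    [apply cmax_lub; auto using czero_le, cle_refl | apply cmax_r]).
  symmetry. apply nival_unique; [| apply cle_refl].
  rewrite <- E. apply (tower_step g). rewrite <- csup_empty. apply tower_sup. tauto.
Qed.

(** Each bit copies its upper neighbour, so truth travels downwards from a witness; this makes an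
    existential quantifier a single bit. *)
Lemma nival_below (P : nat -> bool) n :
  nival (fun x n => (P n || x (S n))%bool) n = true <-> exists m, n <= m /\ P m = true.
Proof.
  set (g := fun (x : C) n => (P n || x (S n))%bool). split.
  - assert (H : forall x, tower g x -> forall n, x n = true -> exists m, n <= m /\ P m = true).
    { intros x Hx. induction Hx as [x Hx IH | S HS IH]; intros k Hk.
      - unfold cmax in Hk. apply Bool.orb_true_iff in Hk. destruct Hk as [Hk | Hk]; auto.
        unfold g in Hk. apply Bool.orb_true_iff in Hk. destruct Hk as [Hk | Hk]; eauto.
        destruct (IH _ Hk) as (m & Hm & Hp). exists m. split; auto. lia.
      - unfold csup in Hk. rewrite tb_true in Hk. destruct Hk as (x & Hx & Hk). eauto. }
    apply H. apply nival_tower.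
  - intros (m & Hm & HP).
    assert (Hc : forall k, g (nival g) k = true -> nival g k = true).
    { intros k Hk. rewrite <- nival_closed. unfold cmax. rewrite Hk. apply Bool.orb_true_r. }
    assert (Hg : forall x k, g x k = (P k || x (S k))%bool) by reflexivity.
    replace n with (m - (m - n)) by lia. generalize (m - n). intros k.
    induction k as [| k IH].
    + apply Hc. rewrite Hg, Nat.sub_0_r, HP. auto.
    + destruct (Nat.le_gt_cases (S k) m) as [H | H].
      * apply Hc. rewrite Hg. replace (S (m - S k)) with (m - k) by lia. rewrite IH. apply Bool.orb_true_r.
      * replace (m - S k) with (m - k) by lia. auto.
Qed.

Definition reads (p : fm) (sg rh : nat -> nat) (f : list (nat -> nat)) (a : list nat)
    (X : nat -> C) (v : nat -> nat) : Prop :=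
  (forall i, used p i -> nth_error a (sg i) = Some (v i)) /\
  (forall j, usedX p j -> exists k, nth_error f (rh j) = Some (ncons k (X j))).

Section Comp.
Variable F : list ((nat -> nat) -> nat).

Lemma run_eq t f a c c' : c = c' -> run F t f a c -> run F t f a c'.
Proof. intros ->. auto. Qed.

Lemma b2n_nz n : Nat.b2n (tb (n <> 0)) = Nat.min n 1.
Proof.
  destruct (tb (n <> 0)) eqn:E; rewrite ?tb_true, ?tb_false in E; cbn [Nat.b2n]; lia.
Qed.

Lemma run_NZ i f a v : nth_error a i = Some v -> run F (tNZ i) f a (Nat.b2n (tb (v <> 0))).
Proof.
  intros H. set (y := fun n => tb (n <> 0)).
  change (tb (v <> 0)) with (y v). rewrite <- (nival_const y).
  apply run_ni_gen; [| apply run_var; auto].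
  intros x n _. exists n. split; [apply (run_tH F (ncons n x)) |].
  apply b2n_nz.
Qed.

Lemma run_not p f a b : run F p f (1 :: a) (Nat.b2n b) -> run F (tNot p) f a (Nat.b2n (negb b)).
Proof.
  intros H. unfold tNot. eapply run_eq; [| eapply run_nimp; [apply run_const | exact H]].
  destruct b; auto.
Qed.

Lemma b2n_min (b : bool) : Nat.b2n b = Nat.min (Nat.b2n b) 1.
Proof. destruct b; auto. Qed.

Lemma run_comp p : forall sg rh f a X v, reads p sg rh f a X v ->
  run F (comp p sg rh) f a (Nat.b2n (tb (sem p X v))).
Proof.
  induction p as [i | j i | j i | p IHp q IHq | | p IHp | p IHp i];
    intros sg rh f a X v (Hv & HX); cbn [comp sem used usedX] in *.
  - apply run_NZ. auto.
  - destruct (HX j eq_refl) as (k & Hk).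
    rewrite <- bool_tb. eapply run_let; [apply run_suc, run_var; auto |].
    exact (run_app F (rh j) 0 f (S (v i) :: a) _ (S (v i)) Hk eq_refl).
  - destruct (HX j eq_refl) as (k & Hk).
    eapply run_eq; [| eapply run_nimp; [eapply run_app; [exact Hk | auto] |]].
    2:{ apply run_not. apply run_NZ. simpl. auto. }
    destruct (v i) as [| n] eqn:E; simpl.
    + rewrite !(proj2 (tb_false _)); auto. intros (n & H & _). discriminate.
    + rewrite (proj2 (tb_true (S n <> 0))) by lia. simpl. f_equal.
      rewrite (bool_tb (X j n)). apply tb_iff. split.
      * intros H. eauto.
      * intros (m & H & H'). injection H as ->. auto.
  - eapply run_eq; [| eapply run_nimp; [apply (IHq sg rh f a X v) | apply (IHp _ rh f _ X v)]].
    + destruct (tb (sem p X v)) eqn:E; rewrite ?tb_true, ?tb_false in E.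
      * rewrite (proj2 (tb_false _)); [reflexivity | tauto].
      * f_equal. apply tb_iff. tauto.
    + split; auto.
    + split; auto. intros i Hi. simpl. auto.
  - rewrite (proj2 (tb_true True)) by auto. apply run_const.
  - set (P := fun n => tb (sem p X (scons n v))).
    eapply run_eq; [| apply run_ni_gen with (g := fun x n => (P n || x (S n))%bool); [| apply run_const]].
    + f_equal. rewrite bool_tb at 1. apply tb_iff. rewrite nival_below. unfold P. split.
      * intros (m & _ & H). rewrite tb_true in H. eauto.
      * intros (m & H). exists m. rewrite tb_true. split; auto. lia.
    + intros x n _. exists (Nat.b2n (P n || x (S n))%bool). split; [| apply b2n_min].
      eapply run_let; [apply run_tH |].
      replace (P n || x (S n))%bool with (negb (if P n then false else negb (x (S n))))
        by (destruct (P n), (x (S n)); auto).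
      apply run_not.
      eapply run_eq with (c := if P n then 0 else Nat.b2n (negb (x (S n)))); [destruct (P n); auto |].
      apply run_nimp.
      * apply run_not.
        eapply run_let; [apply run_suc, run_suc, run_var; reflexivity |].
        exact (run_app F 0 0 (ncons n x :: f) (S (S n) :: 1 :: 1 :: n :: a) _ _ eq_refl eq_refl).
      * apply (IHp _ _ (ncons n x :: f) _ X (scons n v)). split.
        -- intros [| i] Hi; simpl; auto.
        -- intros j Hj. simpl. auto.
  - rewrite <- bool_tb. apply run_ni_gen; [| apply run_var; auto].
    intros x n _. eexists. split; [| apply b2n_min].
    eapply run_let; [apply run_tH |]. apply IHp. split.
    + intros [| k] Hk; simpl; auto.
    + intros [| j] Hj; simpl; auto. exists n. auto.
Qed.
End Comp.

(** * First-order definability *)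

Definition Dfn (n s : nat) (R : (nat -> C) -> (nat -> nat) -> Prop) : Prop :=
  exists p, (forall i, used p i -> i < n) /\ (forall j, usedX p j -> j < s) /\
    forall X v, sem p X v <-> R X v.

Definition DfnF (n s : nat) (t : (nat -> C) -> (nat -> nat) -> nat) : Prop :=
  Dfn (S n) s (fun X w => w 0 = t X (fun i => w (S i))).

Lemma dfn_iff n s (R R' : _ -> _ -> Prop) :
  (forall X v, R X v <-> R' X v) -> Dfn n s R -> Dfn n s R'.
Proof.
  intros H (p & H1 & H2 & H3). exists p. split; [exact H1 | split; [exact H2 |]].
  intros X v. rewrite H3. apply H.
Qed.

Lemma dfn_True n s : Dfn n s (fun _ _ => True).
Proof. exists fTrue. simpl. tauto. Qed.

Lemma dfn_nimp n s P Q : Dfn n s P -> Dfn n s Q -> Dfn n s (fun X v => Q X v /\ ~ P X v).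
Proof.
  intros (p & H1 & H2 & H3) (q & H1' & H2' & H3'). exists (fNimp p q). simpl.
  repeat split; intros; firstorder.
Qed.

Lemma dfn_not n s P : Dfn n s P -> Dfn n s (fun X v => ~ P X v).
Proof.
  intros H. eapply dfn_iff; [| exact (dfn_nimp _ _ _ _ H (dfn_True n s))]. simpl. tauto.
Qed.

Lemma dfn_and n s P Q : Dfn n s P -> Dfn n s Q -> Dfn n s (fun X v => P X v /\ Q X v).
Proof.
  intros H H'. eapply dfn_iff; [| exact (dfn_nimp _ _ _ _ (dfn_not _ _ _ H) H')].
  intros X v. simpl. tauto.
Qed.

Lemma dfn_or n s P Q : Dfn n s P -> Dfn n s Q -> Dfn n s (fun X v => P X v \/ Q X v).
Proof.
  intros H H'. eapply dfn_iff; [| exact (dfn_not _ _ _ (dfn_and _ _ _ _ (dfn_not _ _ _ H) (dfn_not _ _ _ H')))].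
  intros X v. simpl. tauto.
Qed.

Lemma dfn_imp n s P Q : Dfn n s P -> Dfn n s Q -> Dfn n s (fun X v => P X v -> Q X v).
Proof.
  intros H H'. eapply dfn_iff; [| exact (dfn_or _ _ _ _ (dfn_not _ _ _ H) H')].
  intros X v. simpl. tauto.
Qed.

Lemma dfn_ex n s (R : _ -> _ -> nat -> Prop) :
  Dfn (S n) s (fun X w => R X (fun i => w (S i)) (w 0)) ->
  Dfn n s (fun X v => exists y, R X v y).
Proof.
  intros (p & H1 & H2 & H3). exists (fEx p). simpl. repeat split.
  - intros i Hi. apply H1 in Hi. lia.
  - auto.
  - intros (y & H). exists y. apply (H3 X (scons y v)). exact H.
  - intros (y & H). exists y. apply (H3 X (scons y v)). exact H.
Qed.

Lemma dfn_all n s (R : _ -> _ -> nat -> Prop) :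
  Dfn (S n) s (fun X w => R X (fun i => w (S i)) (w 0)) ->
  Dfn n s (fun X v => forall y, R X v y).
Proof.
  intros H. eapply dfn_iff; [| exact (dfn_not _ _ _ (dfn_ex _ _ (fun X v y => ~ R X v y) (dfn_not _ _ _ H)))].
  intros X v. simpl. split.
  - intros Hn y. apply NNPP. eauto.
  - intros Hy (y & Hn). auto.
Qed.

Lemma dfn_mem n s j i : j < s -> i < n -> Dfn n s (fun X v => X j (v i) = true).
Proof.
  intros Hj Hi. exists (fMem j i). simpl. repeat split; intros; subst; auto.
Qed.

Lemma dfn_memP n s j i : j < s -> i < n ->
  Dfn n s (fun X v => exists k, v i = S k /\ X j k = true).
Proof.
  intros Hj Hi. exists (fMemP j i). simpl. repeat split; intros; subst; auto.
Qed.

Lemma dfn_nz n s i : i < n -> Dfn n s (fun X v => v i <> 0).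
Proof. intros Hi. exists (fNZ i). simpl. repeat split; intros; subst; tauto. Qed.

Lemma dfn_z n s i : i < n -> Dfn n s (fun X v => v i = 0).
Proof.
  intros Hi. eapply dfn_iff; [| exact (dfn_not _ _ _ (dfn_nz n s i Hi))]. intros. simpl. lia.
Qed.

Lemma dfn_ni n s (R : C -> _ -> nat -> _ -> Prop) i : i < n ->
  Dfn (S n) (S s) (fun X w => R (X 0) (fun j => X (S j)) (w 0) (fun i => w (S i))) ->
  Dfn n s (fun X v => nival (fun x m => tb (R x X m v)) (v i) = true).
Proof.
  intros Hi (p & H1 & H2 & H3). exists (fNi p i). simpl. split; [| split].
  - intros k [Hk | ->]; auto. apply H1 in Hk. lia.
  - intros j Hj. apply H2 in Hj. lia.
  - intros X v. match goal with |- nival ?f _ = _ <-> nival ?g _ = _ => replace g with f; [tauto |] end.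
    apply functional_extensionality; intros x. apply functional_extensionality; intros m.
    apply tb_iff. apply (H3 (scons x X) (scons m v)).
Qed.

Definition lift (r : nat -> nat) : nat -> nat := scons 0 (fun i => S (r i)).

Fixpoint ren (p : fm) (r q : nat -> nat) : fm :=
  match p with
  | fNZ i => fNZ (r i)
  | fMem j i => fMem (q j) (r i)
  | fMemP j i => fMemP (q j) (r i)
  | fNimp p p' => fNimp (ren p r q) (ren p' r q)
  | fTrue => fTrue
  | fEx p => fEx (ren p (lift r) q)
  | fNi p i => fNi (ren p (lift r) (lift q)) (r i)
  end.

Lemma scons_lift {A : Type} (y : A) (v : nat -> A) (r : nat -> nat) :
  (fun i => scons y v (lift r i)) = scons y (fun i => v (r i)).
Proof. apply functional_extensionality. intros [| i]; auto. Qed.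

Lemma sem_ren p : forall r q X v,
  sem (ren p r q) X v <-> sem p (fun j => X (q j)) (fun i => v (r i)).
Proof.
  induction p as [i | j i | j i | p IHp p' IHq | | p IHp | p IHp i]; intros r q X v; simpl; try tauto.
  - rewrite IHp, IHq. tauto.
  - split; intros (y & H); exists y; [rewrite IHp, scons_lift in H | rewrite IHp, scons_lift]; auto.
  - match goal with |- nival ?f _ = _ <-> nival ?g _ = _ => replace g with f; [tauto |] end.
    apply functional_extensionality; intros x. apply functional_extensionality; intros m.
    apply tb_iff. rewrite IHp, !scons_lift. tauto.
Qed.

Lemma lift_image (P : nat -> Prop) (r : nat -> nat) i :
  (exists k, P k /\ S i = lift r k) -> exists k, P (S k) /\ i = r k.
Proof. intros ([| k] & H & E); [discriminate |]. injection E as ->. eauto. Qed.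

Lemma used_ren p : forall r q i, used (ren p r q) i -> exists k, used p k /\ i = r k.
Proof.
  induction p as [k | j k | j k | p IHp p' IHq | | p IHp | p IHp k]; intros r q i; simpl.
  - intros ->; eauto.
  - intros ->; eauto.
  - intros ->; eauto.
  - intros [H | H]; [apply IHp in H | apply IHq in H]; firstorder.
  - tauto.
  - intros H. apply IHp in H. apply lift_image. exact H.
  - intros [H | ->]; eauto. apply IHp, lift_image in H. firstorder.
Qed.

Lemma usedX_ren p : forall r q j, usedX (ren p r q) j -> exists k, usedX p k /\ j = q k.
Proof.
  induction p as [k | j k | j k | p IHp p' IHq | | p IHp | p IHp k]; intros r q i; simpl.
  - tauto.
  - intros ->; eauto.
  - intros ->; eauto.
  - intros [H | H]; [apply IHp in H | apply IHq in H]; firstorder.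
  - tauto.
  - intros H. eapply IHp. exact H.
  - intros H. apply IHp, lift_image in H. firstorder.
Qed.

Lemma dfn_ren2 n m s s' R (r q : nat -> nat) :
  (forall i, i < n -> r i < m) -> (forall j, j < s -> q j < s') ->
  Dfn n s R -> Dfn m s' (fun X v => R (fun j => X (q j)) (fun i => v (r i))).
Proof.
  intros Hr Hq (p & H1 & H2 & H3). exists (ren p r q). split; [| split].
  - intros i Hi. apply used_ren in Hi. destruct Hi as (k & Hk & ->). auto.
  - intros j Hj. apply usedX_ren in Hj. destruct Hj as (k & Hk & ->). auto.
  - intros X v. rewrite sem_ren. apply H3.
Qed.

Lemma dfn_ren n m s R (r : nat -> nat) :
  (forall i, i < n -> r i < m) -> Dfn n s R -> Dfn m s (fun X v => R X (fun i => v (r i))).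
Proof. intros Hr. apply (dfn_ren2 n m s s R r (fun j => j)); auto. Qed.

Lemma dfn_let n s (R : _ -> nat -> _ -> Prop) t :
  DfnF n s t -> Dfn (S n) s (fun X w => R X (w 0) (fun i => w (S i))) ->
  Dfn n s (fun X v => R X (t X v) v).
Proof.
  intros Ht HR.
  assert (H : Dfn n s (fun X v => exists y, y = t X v /\ R X y v)).
  { apply dfn_ex. apply dfn_and; auto. }
  eapply dfn_iff; [| exact H]. intros X v. split.
  - intros (y & -> & H'). auto.
  - eauto.
Qed.

Lemma dfnF_wk n s t : DfnF n s t -> DfnF (S n) s (fun X w => t X (fun i => w (S i))).
Proof.
  intros H. unfold DfnF in *.
  exact (dfn_ren (S n) (S (S n)) s _ (fun i => match i with 0 => 0 | S k => S (S k) end)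
    ltac:(intros [| i]; cbn; lia) H).
Qed.

Lemma dfnF_let n s (g : _ -> nat -> _ -> nat) t :
  DfnF n s t -> DfnF (S n) s (fun X w => g X (w 0) (fun i => w (S i))) ->
  DfnF n s (fun X v => g X (t X v) v).
Proof.
  intros Ht Hg. unfold DfnF.
  apply (dfn_let (S n) s (fun X y w => w 0 = g X y (fun i => w (S i))) (fun X w => t X (fun i => w (S i)))).
  - apply dfnF_wk. exact Ht.
  - exact (dfn_ren (S (S n)) (S (S n)) s _ (fun i => match i with 0 => 1 | 1 => 0 | k => k end)
      ltac:(intros [| [| i]]; cbn; lia) Hg).
Qed.

Lemma dfn_rel1 n s (R : nat -> Prop) t :
  Dfn 1 0 (fun _ v => R (v 0)) -> DfnF n s t -> Dfn n s (fun X v => R (t X v)).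
Proof.
  intros H Ht. apply (dfn_let n s (fun X y v => R y)); auto.
  destruct H as (p & H1 & H2 & H3). exists p. repeat split.
  - intros i Hi. apply H1 in Hi. lia.
  - intros j Hj. apply H2 in Hj. lia.
  - apply H3.
  - apply H3.
Qed.

Lemma dfn_weaken n s R : Dfn n 0 R -> Dfn n s R.
Proof.
  intros (p & H1 & H2 & H3). exists p. repeat split; auto.
  - intros j Hj. apply H2 in Hj. lia.
  - apply H3.
  - apply H3.
Qed.

Lemma dfn_rel2 n s (R : nat -> nat -> Prop) t u :
  Dfn 2 0 (fun _ v => R (v 0) (v 1)) -> DfnF n s t -> DfnF n s u ->
  Dfn n s (fun X v => R (t X v) (u X v)).
Proof.
  intros H Ht Hu. apply (dfn_let n s (fun X y v => R y (u X v))); auto.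
  apply (dfn_let (S n) s (fun X y w => R (w 0) y) (fun X w => u X (fun i => w (S i)))).
  - apply dfnF_wk; auto.
  - apply dfn_weaken with (s := s) in H.
    exact (dfn_ren 2 (S (S n)) s _ (fun i => match i with 0 => 1 | _ => 0 end) ltac:(intros [| i]; cbn; lia) H).
Qed.

Lemma dfnF_fun1 n s (g : nat -> nat) t :
  Dfn 2 0 (fun _ v => v 0 = g (v 1)) -> DfnF n s t -> DfnF n s (fun X v => g (t X v)).
Proof.
  intros H Ht. apply (dfnF_let n s (fun X y v => g y)); auto. unfold DfnF.
  apply dfn_weaken with (s := s) in H.
  exact (dfn_ren 2 (S (S n)) s _ (fun i => i) ltac:(intros; lia) H).
Qed.

Lemma dfnF_fun2 n s (g : nat -> nat -> nat) t u :
  Dfn 3 0 (fun _ v => v 0 = g (v 1) (v 2)) -> DfnF n s t -> DfnF n s u ->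
  DfnF n s (fun X v => g (t X v) (u X v)).
Proof.
  intros H Ht Hu. apply (dfnF_let n s (fun X y v => g y (u X v))); auto.
  apply (dfnF_let (S n) s (fun X y w => g (w 0) y) (fun X w => u X (fun i => w (S i)))).
  - apply dfnF_wk; auto.
  - unfold DfnF. apply dfn_weaken with (s := s) in H.
    exact (dfn_ren 3 (S (S (S n))) s _ (fun i => match i with 0 => 0 | 1 => 2 | _ => 1 end)
      ltac:(intros [| [| i]]; cbn; lia) H).
Qed.

(** The initial segment grows by one number per step until the negative guard on [m] stops it. If
    [m] never entered, the guard would stay open and every number would enter, [m] included. This
    obtains the order from zero and predecessor alone. *)
Lemma nival_le m n :
  nival (fun x k => tb (~ x m = true /\ (k = 0 \/ exists j, k = S j /\ x j = true))) n = true <-> n <= m.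
Proof.
  set (g := fun (x : C) (k : nat) => tb _).
  assert (Hg : forall x k, g x k = true <-> ~ x m = true /\ (k = 0 \/ exists j, k = S j /\ x j = true))
    by (intros; apply tb_true).
  assert (Ht : forall x, tower g x -> (forall k, x k = true -> k <= m) /\
      (forall k, x (S k) = true -> x k = true)).
  { intros x Hx. induction Hx as [x Hx [IH1 IH2] | P HP IH].
    - assert (Hs : forall k, cmax x (g x) k = true <-> x k = true \/ g x k = true)
        by (intros k; unfold cmax; apply Bool.orb_true_iff).
      split; intros k Hk; rewrite ?Hs, ?Hg in *.
      + destruct Hk as [Hk | (Hm & [-> | (j & -> & Hk)])]; auto; [lia |].
        pose proof (IH1 j Hk). assert (j <> m) by (intros ->; auto). lia.
      + destruct Hk as [Hk | (Hm & [Hk | (j & Hk & Hj)])]; auto; [lia |].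
        injection Hk as <-. auto.
    - split; intros k Hk; unfold csup in *; rewrite tb_true in *.
      + destruct Hk as (x & Hx & Hk). eapply IH; eauto.
      + destruct Hk as (x & Hx & Hk). exists x. split; auto. eapply IH; eauto. }
  destruct (Ht _ (nival_tower g)) as [H1 H2].
  assert (Hc : forall k, g (nival g) k = true -> nival g k = true)
    by (intros k Hk; rewrite <- nival_closed; unfold cmax; rewrite Hk; apply Bool.orb_true_r).
  assert (H3 : forall d, nival g d = true -> forall k, k <= d -> nival g k = true).
  { induction d as [| d IH]; intros Hd k Hk.
    - replace k with 0 by lia. auto.
    - destruct (Nat.eq_dec k (S d)) as [-> | E]; auto. apply IH; auto. lia. }
  split; [apply H1 |]. intros Hn.
  destruct (nival g m) eqn:Em; [apply (H3 m); auto |].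
  assert (H4 : forall k, nival g k = true).
  { induction k; apply Hc, Hg; rewrite Em; split; eauto; congruence. }
  rewrite H4 in Em. discriminate.
Qed.

Lemma dfn_le0 n s i j : i < n -> j < n -> Dfn n s (fun X v => v i <= v j).
Proof.
  intros Hi Hj.
  eapply dfn_iff; [intros X v; apply nival_le |].
  apply (dfn_ni n s (fun x X m v => ~ x (v j) = true /\ (m = 0 \/ exists k, m = S k /\ x k = true))); auto.
  apply dfn_and.
  - apply dfn_not. apply (dfn_mem (S n) (S s) 0 (S j)); lia.
  - apply dfn_or; [apply dfn_z | apply dfn_memP]; lia.
Qed.

Lemma dfn_eq0 n s i j : i < n -> j < n -> Dfn n s (fun X v => v i = v j).
Proof.
  intros Hi Hj. eapply dfn_iff; [| exact (dfn_and _ _ _ _ (dfn_le0 n s i j Hi Hj) (dfn_le0 n s j i Hj Hi))].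
  intros; simpl; lia.
Qed.

Lemma dfn_S0 n s i j : i < n -> j < n -> Dfn n s (fun X v => v i = S (v j)).
Proof.
  intros Hi Hj.
  assert (H : Dfn n s (fun X v => ~ v i <= v j /\ ~ exists k, ~ v i <= k /\ ~ k <= v j)).
  { apply dfn_and; [apply dfn_not, dfn_le0; lia |]. apply dfn_not, dfn_ex.
    apply dfn_and; apply dfn_not.
    - apply (dfn_le0 (S n) s (S i) 0); lia.
    - apply (dfn_le0 (S n) s 0 (S j)); lia. }
  eapply dfn_iff; [| exact H]. intros X v. simpl. split.
  - intros [H1 H2]. apply NNPP. intros H3. apply H2. exists (S (v j)). lia.
  - intros ->. split; [lia |]. intros (k & H1 & H2). lia.
Qed.

Lemma dfnF_var n s i : i < n -> DfnF n s (fun X v => v i).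
Proof. intros Hi. apply (dfn_eq0 (S n) s 0 (S i)); lia. Qed.

Lemma dfnF_S n s t : DfnF n s t -> DfnF n s (fun X v => S (t X v)).
Proof. apply dfnF_fun1. apply (dfn_S0 2 0 0 1); lia. Qed.

Lemma dfnF_const n s c : DfnF n s (fun _ _ => c).
Proof.
  induction c as [| c IH]; [apply dfn_z; lia |]. apply (dfnF_S n s (fun _ _ => c)). exact IH.
Qed.

Lemma dfn_le n s t u : DfnF n s t -> DfnF n s u -> Dfn n s (fun X v => t X v <= u X v).
Proof. apply dfn_rel2. apply dfn_le0; lia. Qed.

Lemma dfn_eq n s t u : DfnF n s t -> DfnF n s u -> Dfn n s (fun X v => t X v = u X v).
Proof. apply dfn_rel2. apply dfn_eq0; lia. Qed.

Lemma dfn_lt n s t u : DfnF n s t -> DfnF n s u -> Dfn n s (fun X v => t X v < u X v).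
Proof. intros. apply (dfn_le n s (fun X v => S (t X v))); auto. apply dfnF_S; auto. Qed.

Lemma dfn_memF n s j t : j < s -> DfnF n s t -> Dfn n s (fun X v => X j (t X v) = true).
Proof.
  intros Hj Ht. apply (dfn_let n s (fun X y v => X j y = true)); auto.
  apply (dfn_mem (S n) s j 0); lia.
Qed.

Lemma dfn_niF n s (R : C -> _ -> nat -> _ -> Prop) t : DfnF n s t ->
  Dfn (S n) (S s) (fun X w => R (X 0) (fun j => X (S j)) (w 0) (fun i => w (S i))) ->
  Dfn n s (fun X v => nival (fun x m => tb (R x X m v)) (t X v) = true).
Proof.
  intros Ht H.
  apply (dfn_let n s (fun X y v => nival (fun x m => tb (R x X m v)) y = true)); auto.
  apply (dfn_ni (S n) s (fun x X m w => R x X m (fun i => w (S i))) 0); [lia |].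
  exact (dfn_ren (S n) (S (S n)) (S s) _ (fun i => match i with 0 => 0 | S k => S (S k) end)
    ltac:(intros [| i]; cbn; lia) H).
Qed.

Ltac dfn_step := idtac;
  match goal with
  | |- _ < _ => lia
  | |- Dfn _ _ (fun X v => @?A X v /\ @?B X v) => apply (dfn_and _ _ A B)
  | |- Dfn _ _ (fun X v => @?A X v \/ @?B X v) => apply (dfn_or _ _ A B)
  | |- Dfn _ _ (fun X v => ~ @?A X v) => apply (dfn_not _ _ A)
  | |- Dfn _ _ (fun X v => @?A X v -> False) => apply (dfn_not _ _ A)
  | |- Dfn _ _ (fun X v => exists y : nat, @?R X v y) => apply (dfn_ex _ _ R)
  | |- Dfn _ _ (fun X v => @?A X v -> @?B X v) => apply (dfn_imp _ _ A B)
  | |- Dfn _ _ (fun X v => forall y : nat, @?R X v y) => apply (dfn_all _ _ R)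
  | |- Dfn _ _ (fun X v => @?t X v <= @?u X v) => apply (dfn_le _ _ t u)
  | |- Dfn _ _ (fun X v => @?t X v < @?u X v) => apply (dfn_lt _ _ t u)
  | |- Dfn _ _ (fun X v => X ?j (@?t X v) = true) => apply (dfn_memF _ _ j t)
  | |- Dfn _ _ (fun X v => @?t X v = @?u X v) => apply (dfn_eq _ _ t u)
  | |- Dfn _ _ (fun X v => @?t X v = @?u X v :> nat) => apply (dfn_eq _ _ t u)
  | |- Dfn _ _ (fun X v => True) => apply dfn_True
  | |- DfnF _ _ (fun X v => v ?i) => apply dfnF_var
  | |- DfnF _ _ (fun X v => ?c) => apply dfnF_const
  | |- DfnF _ _ (fun X v => S (@?t X v)) => apply (dfnF_S _ _ t)
  end.

(** A hook, redefined each time further functions have been shown definable. *)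
Ltac dfn_ext := fail.
Ltac dfn := repeat (cbn beta; first [assumption | dfn_ext | dfn_step]).

(** * Arithmetic *)

(* Two fronts move in parallel, one from [0] and one from [b], until the first reaches [a]. *)
Lemma nival_add (a b : nat) : 0 < a -> a <= b -> forall n,
  nival (fun x k => tb (~ (exists j, a = S j /\ x j = true) /\
     (k = 0 \/ k = b \/ exists j, k = S j /\ x j = true))) n = true <->
  n < a \/ b <= n < a + b.
Proof.
  intros Ha Hab. set (g := fun (x : C) (k : nat) => tb _).
  assert (Hg : forall x k, g x k = true <-> ~ (exists j, a = S j /\ x j = true) /\
     (k = 0 \/ k = b \/ exists j, k = S j /\ x j = true)) by (intros; apply tb_true).
  set (T := fun t : nat => (fun k => tb (k < t \/ b <= k < b + t)) : C).
  assert (HT : forall t k, T t k = true <-> k < t \/ b <= k < b + t) by (intros; apply tb_true).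
  assert (Hx : forall x, tower g x -> exists t, t <= a /\ x = T t).
  { intros x Hx. induction Hx as [x Hx (t & Ht & ->) | P HP IH].
    - destruct (Nat.eq_dec t a) as [-> | E].
      + exists a. split; auto. apply cmax_absorb. intros k Hk. apply Hg in Hk.
        exfalso. apply (proj1 Hk). exists (a - 1). split; [lia |]. apply HT. lia.
      + exists (S t). split; [lia |]. apply cle_antisym; intros k Hk.
        * unfold cmax in Hk. apply Bool.orb_true_iff in Hk. rewrite Hg, HT in Hk. apply HT.
          destruct Hk as [Hk | (_ & [-> | [-> | (j & -> & Hj)]])]; try lia.
          apply HT in Hj. lia.
        * apply HT in Hk. unfold cmax. apply Bool.orb_true_iff. rewrite Hg, HT.
          destruct (Nat.eq_dec k t) as [-> | E1]; [| destruct (Nat.eq_dec k (b + t)) as [-> | E2]].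
          -- right. split.
             ++ intros (j & -> & Hj). apply HT in Hj. lia.
             ++ destruct t; [auto |]. right; right. exists t. split; auto. apply HT. lia.
          -- right. split.
             ++ intros (j & -> & Hj). apply HT in Hj. lia.
             ++ right. destruct t; [left; lia |]. right. exists (b + t). split; [lia |]. apply HT. lia.
          -- left. lia.
    - destruct (classic (exists t, P (T t) /\ t <= a /\ forall t', t' <= a -> P (T t') -> t' <= t)) as [(t & Hp & Ht & Hm) | Hn].
      + exists t. split; auto. apply cle_antisym; [| apply csup_ub; auto].
        apply csup_lub. intros x Hp'. destruct (IH x Hp') as (t' & Ht' & ->).
        specialize (Hm t' Ht' Hp'). intros k. rewrite !HT. lia.
      + exists 0. split; [lia |]. apply cle_antisym; [| intros k; rewrite HT; lia].
        assert (HE : forall d t, t <= a -> a - t <= d -> ~ P (T t)).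
        { induction d as [| d IHd]; intros t Ht Hd Hp; apply Hn; exists t; repeat split; auto; intros t' Ht' Hp'.
          - lia.
          - destruct (Nat.le_gt_cases t' t); auto. exfalso. apply (IHd t'); auto. lia. }
        apply csup_lub. intros x Hp. destruct (IH x Hp) as (t & Ht & ->). exfalso.
        eapply HE; eauto. }
  destruct (Hx _ (nival_tower g)) as (t & Ht & E).
  assert (Hc : forall k, g (nival g) k = true -> nival g k = true)
    by (intros k Hk; rewrite <- nival_closed; unfold cmax; rewrite Hk; apply Bool.orb_true_r).
  assert (t = a).
  { apply NNPP. intros Hn.
    assert (H : nival g t = true).
    { apply Hc. rewrite Hg, E. split.
      - intros (j & -> & Hj). apply HT in Hj. lia.
      - destruct t; auto. right; right. exists t. split; auto. apply HT. lia. }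
    rewrite E, HT in H. lia. }
  subst t. intros n. rewrite E, HT. lia.
Qed.

(** When the first front reaches [a], the second has filled the numbers from [b] up to [a + b], so
    the sum is the end of the second front. The condition [b < v 0] rules out the end of the first
    one, and the requirement [0 < a <= b] of [nival_add] explains the swap and the separate case
    [a = 0]. *)
Lemma dfnF_add n s t u : DfnF n s t -> DfnF n s u -> DfnF n s (fun X v => t X v + u X v).
Proof.
  apply dfnF_fun2.
  assert (H : Dfn 3 0 (fun X v =>
    exists a b, ((a = v 1 /\ b = v 2) \/ (a = v 2 /\ b = v 1)) /\ a <= b /\
     ((a = 0 /\ v 0 = b) \/ (a <> 0 /\ b < v 0 /\
      ~ (nival (fun x k => tb (~ (exists j, a = S j /\ x j = true) /\
          (k = 0 \/ k = b \/ exists j, k = S j /\ x j = true))) (v 0) = true) /\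
      exists c, v 0 = S c /\
      (nival (fun x k => tb (~ (exists j, a = S j /\ x j = true) /\
          (k = 0 \/ k = b \/ exists j, k = S j /\ x j = true))) c = true))))).
  { pose (R := fun (x : C) (X : nat -> C) (k : nat) (w : nat -> nat) =>
       ~ (exists j, w 1 = S j /\ x j = true) /\ (k = 0 \/ k = w 0 \/ exists j, k = S j /\ x j = true)).
    assert (HR : Dfn 6 1 (fun X w => R (X 0) (fun j => X (S j)) (w 0) (fun i => w (S i)))).
    { unfold R. dfn. }
    dfn.
    - apply (dfn_niF 5 0 R (fun _ v => v 2)); dfn.
    - apply (dfn_niF 6 0 (fun x X k w => R x X k (fun i => w (S i))) (fun _ v => v 0)); [dfn |].
      unfold R. dfn. }
  eapply dfn_iff; [| exact H]. intros X v. simpl. split.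
  - intros (a & b & Hab & Hle & [[-> ->] | (Ha & Hb & Hn & c & Ec & Hc)]).
    + destruct Hab as [[<- <-] | [<- <-]]; lia.
    + rewrite nival_add in Hn, Hc by lia. destruct Hab as [[<- <-] | [<- <-]]; lia.
  - intros E.
    assert (W : forall a b, a <= b -> v 0 = a + b ->
      (a = 0 /\ v 0 = b) \/ (a <> 0 /\ b < v 0 /\
      ~ (nival (fun x k => tb (~ (exists j, a = S j /\ x j = true) /\
          (k = 0 \/ k = b \/ exists j, k = S j /\ x j = true))) (v 0) = true) /\
      exists c, v 0 = S c /\
      (nival (fun x k => tb (~ (exists j, a = S j /\ x j = true) /\
          (k = 0 \/ k = b \/ exists j, k = S j /\ x j = true))) c = true))).
    { intros a b Hab E'. destruct (Nat.eq_dec a 0) as [-> | Ha]; [left; lia |]. right.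
      split; auto. split; [lia |]. split; [rewrite nival_add; lia |].
      exists (v 0 - 1). rewrite nival_add; lia. }
    destruct (Nat.le_ge_cases (v 1) (v 2)) as [H1 | H1].
    + exists (v 1), (v 2). auto.
    + exists (v 2), (v 1). split; auto. split; auto. apply W; auto. lia.
Qed.

Definition pr (a b : nat) : nat := to_nat (a, b).
Definition p1 (z : nat) : nat := fst (of_nat z).
Definition p2 (z : nat) : nat := snd (of_nat z).

Lemma p1_pr a b : p1 (pr a b) = a.
Proof. unfold p1, pr. rewrite cancel_of_to. auto. Qed.

Lemma p2_pr a b : p2 (pr a b) = b.
Proof. unfold p2, pr. rewrite cancel_of_to. auto. Qed.

Lemma pr_eta z : pr (p1 z) (p2 z) = z.
Proof. unfold p1, p2, pr. rewrite <- surjective_pairing. apply cancel_to_of. Qed.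

Lemma pr_inj a b c d : pr a b = pr c d -> a = c /\ b = d.
Proof. intros H. apply to_nat_inj in H. injection H. auto. Qed.

Lemma pr_spec a b : 2 * pr a b = 2 * b + (a + b) * S (a + b).
Proof. pose proof (to_nat_spec a b). unfold pr. lia. Qed.

Definition tri (i : nat) : nat := pr i 0.

Lemma tri_S i : tri (S i) = tri i + S i.
Proof. unfold tri. pose proof (pr_spec (S i) 0). pose proof (pr_spec i 0). nia. Qed.

Lemma tri_lt i j : i < j -> tri i < tri j.
Proof. induction 1; rewrite tri_S; lia. Qed.

Lemma pr_tri a b : pr a b = tri (a + b) + b.
Proof. unfold tri. pose proof (pr_spec a b). pose proof (pr_spec (a + b) 0). nia. Qed.

Definition istri (y : nat) : Prop := exists i, y = tri i.

(** Triangular numbers without multiplication: after consecutive [p < q] comes [q + (q - p) + 1].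
    That [p] and [q] are neighbours in [x] is a negative condition; it identifies consecutive
    triangular numbers because every stage is an initial segment of them. *)
Definition triop (x : C) (n : nat) : Prop :=
  n = 0 \/ n = 1 \/ exists p q, p < q /\ x p = true /\ x q = true /\
    (forall r, p < r -> r < q -> ~ x r = true) /\ n + p = S (q + q).

Lemma nival_tri n : nival (fun x k => tb (triop x k)) n = true <-> istri n.
Proof.
  set (g := fun (x : C) (k : nat) => tb (triop x k)).
  assert (Hg : forall x k, g x k = true <-> triop x k) by (intros; apply tb_true).
  assert (Hx : forall x, tower g x -> (forall k, x k = true -> exists i, k = tri i) /\
     (forall i, x (tri (S i)) = true -> x (tri i) = true)).
  { intros x Hx. induction Hx as [x Hx [IH1 IH2] | P HP IH].
    - assert (Hs : forall k, cmax x (g x) k = true <-> x k = true \/ triop x k)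
        by (intros k; rewrite <- Hg; unfold cmax; apply Bool.orb_true_iff).
      assert (Hd : forall i d, x (tri (i + d)) = true -> x (tri i) = true).
      { intros i d. induction d as [| d IHd]; [rewrite Nat.add_0_r; auto |].
        rewrite Nat.add_succ_r. auto. }
      assert (Ht : forall k, triop x k -> k = 0 \/ k = 1 \/ exists i, k = tri (S (S i)) /\ x (tri (S i)) = true).
      { intros k [-> | [-> | (p & q & Hpq & Hp & Hq & Hr & E)]]; auto. right; right.
        destruct (IH1 p Hp) as (i & ->). destruct (IH1 q Hq) as (j & ->).
        assert (i < j) by (destruct (Nat.lt_ge_cases i j); auto; destruct (Nat.eq_dec i j) as [-> |];
          [lia | pose proof (tri_lt j i); lia]).
        assert (j = S i).
        { apply NNPP. intros Hn. apply (Hr (tri (S i))).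
          - apply tri_lt. lia.
          - apply tri_lt. lia.
          - apply (Hd (S i) (j - S i)). replace (S i + (j - S i)) with j by lia. auto. }
        subst j. exists i. split; auto. rewrite !tri_S in *. lia. }
      split.
      + intros k Hk. apply Hs in Hk. destruct Hk as [Hk | Hk]; auto.
        destruct (Ht k Hk) as [-> | [-> | (i & -> & _)]]; [exists 0 | exists 1 |]; eauto.
      + intros i Hi. apply Hs in Hi. apply Hs. destruct Hi as [Hi | Hi]; auto.
        pose proof (tri_lt 0 (S i)). assert (tri 0 = 0) by reflexivity.
        destruct i as [| i]; [right; left; auto |].
        destruct (Ht _ Hi) as [E | [E | (i' & E & Hi')]].
        * lia.
        * pose proof (tri_lt 1 (S (S i))). assert (tri 1 = 1) by reflexivity. lia.
        * assert (i = i').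
          { destruct (Nat.lt_trichotomy i i') as [L | [L | L]]; auto;
            [pose proof (tri_lt (S (S i)) (S (S i'))) | pose proof (tri_lt (S (S i')) (S (S i)))]; lia. }
          subst. auto.
    - split; intros k Hk; unfold csup in *; rewrite tb_true in *.
      + destruct Hk as (x & Hx & Hk). eapply IH; eauto.
      + destruct Hk as (x & Hx & Hk). exists x. split; auto. eapply IH; eauto. }
  destruct (Hx _ (nival_tower g)) as [H1 H2]. split; [apply H1 |].
  assert (Hc : forall k, triop (nival g) k -> nival g k = true).
  { intros k Hk. apply Hg in Hk. rewrite <- nival_closed; unfold cmax; rewrite Hk; apply Bool.orb_true_r. }
  intros (i & ->).
  assert (H3 : nival g (tri i) = true /\ nival g (tri (S i)) = true); [| tauto].
  induction i as [| i [IH1 IH2]].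
  - split; apply Hc; [left | right; left]; reflexivity.
  - split; auto. apply Hc. right; right. exists (tri i), (tri (S i)).
    split; [apply tri_lt; lia |]. split; auto. split; auto. split.
    + intros r Hr1 Hr2 Hr. destruct (H1 r Hr) as (j & ->).
      destruct (Nat.le_gt_cases j i) as [L | L].
      * destruct (Nat.eq_dec i j) as [-> |]; [lia | pose proof (tri_lt j i); lia].
      * destruct (Nat.eq_dec j (S i)) as [-> |]; [lia | pose proof (tri_lt (S i) j); lia].
    + rewrite !tri_S. lia.
Qed.

Ltac dfn_ext ::=
  match goal with
  | |- DfnF _ _ (fun X v => @?t X v + @?u X v) => apply (dfnF_add _ _ t u)
  end.

Lemma dfn_tri n s t : DfnF n s t -> Dfn n s (fun X v => istri (t X v)).
Proof.
  apply (dfn_rel1 n s istri).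
  eapply dfn_iff; [intros X v; apply nival_tri |].
  apply (dfn_niF 1 0 (fun x X k v => triop x k) (fun X v => v 0)); [dfn |].
  unfold triop. dfn.
Qed.

(** [pr a b] is the triangular number of [a + b] plus [b], and that triangular number is recognised
    by the gap [a + b + 1] to the next one. *)
Lemma dfnF_pr n s t u : DfnF n s t -> DfnF n s u -> DfnF n s (fun X v => pr (t X v) (u X v)).
Proof.
  apply dfnF_fun2.
  assert (H : Dfn 3 0 (fun X v => exists t u, istri t /\ istri u /\
    u = S (t + (v 1 + v 2)) /\ (forall r, istri r -> r <= t \/ u <= r) /\ v 0 = t + v 2)).
  { dfn; apply dfn_tri; dfn. }
  eapply dfn_iff; [| exact H]. intros X v. cbv beta. rewrite pr_tri. split.
  - intros (p & q & (i & ->) & (j & ->) & Eu & Hr & ->). f_equal.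
    pose proof (Hr (tri (S i)) (ex_intro _ (S i) eq_refl)) as H1. rewrite tri_S in H1.
    assert (i < j).
    { destruct (Nat.lt_ge_cases i j); auto. destruct (Nat.eq_dec i j) as [-> |]; [lia |].
      pose proof (tri_lt j i). lia. }
    assert (tri (S i) <= tri j) by (destruct (Nat.eq_dec j (S i)) as [-> |]; [lia | pose proof (tri_lt (S i) j); lia]).
    rewrite tri_S in *. f_equal. lia.
  - intros ->. exists (tri (v 1 + v 2)), (tri (S (v 1 + v 2))).
    split; [eexists; eauto |]. split; [eexists; eauto |]. split; [rewrite tri_S; lia |]. split; auto.
    intros r (i & ->). destruct (Nat.le_gt_cases i (v 1 + v 2)).
    + left. destruct (Nat.eq_dec i (v 1 + v 2)) as [-> |]; [lia | pose proof (tri_lt i (v 1 + v 2)); lia].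
    + right. destruct (Nat.eq_dec i (S (v 1 + v 2))) as [-> |]; [lia | pose proof (tri_lt (S (v 1 + v 2)) i); lia].
Qed.

Ltac dfn_ext ::=
  match goal with
  | |- DfnF _ _ (fun X v => @?t X v + @?u X v) => apply (dfnF_add _ _ t u)
  | |- DfnF _ _ (fun X v => pr (@?t X v) (@?u X v)) => apply (dfnF_pr _ _ t u)
  end.

Lemma dfnF_p1 n s t : DfnF n s t -> DfnF n s (fun X v => p1 (t X v)).
Proof.
  apply dfnF_fun1. eapply dfn_iff with (R := fun X v => exists b, v 1 = pr (v 0) b); [| dfn].
  intros X v. cbv beta. split.
  - intros (b & ->). rewrite p1_pr. auto.
  - intros ->. exists (p2 (v 1)). rewrite pr_eta. auto.
Qed.

Lemma dfnF_p2 n s t : DfnF n s t -> DfnF n s (fun X v => p2 (t X v)).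
Proof.
  apply dfnF_fun1. eapply dfn_iff with (R := fun X v => exists b, v 1 = pr b (v 0)); [| dfn].
  intros X v. cbv beta. split.
  - intros (b & ->). rewrite p2_pr. auto.
  - intros ->. exists (p1 (v 1)). rewrite pr_eta. auto.
Qed.

(** * Least fixed points, minimisation and primitive recursion *)

Definition lfp (op : C -> nat -> Prop) (n : nat) : Prop :=
  forall Y : C, (forall m, op Y m -> Y m = true) -> Y n = true.

Lemma nival_lfp (op : C -> nat -> Prop) n :
  (forall x y m, cle x y -> op x m -> op y m) ->
  nival (fun x k => tb (op x k)) n = true <-> lfp op n.
Proof.
  intros Hm. set (g := fun (x : C) k => tb (op x k)). split.
  - intros H Y HY. revert n H. change (cle (nival g) Y).
    apply csup_lub. intros x Hx. induction Hx as [x Hx IH | P HP IH].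
    + apply cmax_lub; auto. intros k Hk. unfold g in Hk. rewrite tb_true in Hk.
      apply HY. eapply Hm; eauto.
    + apply csup_lub. auto.
  - intros H. apply H. intros m Hop. rewrite <- nival_closed. unfold cmax.
    replace (g (nival g) m) with true; [apply Bool.orb_true_r |].
    symmetry. apply tb_true. exact Hop.
Qed.

Lemma dfn_lfp n s (op : _ -> _ -> C -> nat -> Prop) t :
  (forall X v x y m, cle x y -> op X v x m -> op X v y m) ->
  DfnF n s t ->
  Dfn (S n) (S s) (fun X w => op (fun j => X (S j)) (fun i => w (S i)) (X 0) (w 0)) ->
  Dfn n s (fun X v => lfp (op X v) (t X v)).
Proof.
  intros Hm Ht Hop. eapply dfn_iff; [intros X v; apply nival_lfp, Hm |].
  apply (dfn_niF n s (fun x X m v => op X v x m) t Ht Hop).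
Qed.

(** The value is 0 if there is no witness, so that [mu] is total and may occur inside definable
    terms. *)
Definition mu (P : nat -> Prop) : nat :=
  epsilon (inhabits 0) (fun y => (P y /\ forall z, z < y -> ~ P z) \/ ((forall z, ~ P z) /\ y = 0)).

Lemma mu_spec P : (P (mu P) /\ forall z, z < mu P -> ~ P z) \/ ((forall z, ~ P z) /\ mu P = 0).
Proof.
  unfold mu. apply epsilon_spec.
  destruct (classic (exists z, P z)) as [(z & Hz) | H].
  - revert Hz. induction (lt_wf z) as [z _ IH]. intros Hz.
    destruct (classic (exists y, y < z /\ P y)) as [(y & Hy & HP) | Hn]; eauto.
    exists z. left. split; auto. intros y Hy HP. eauto.
  - exists 0. right. split; eauto.
Qed.

Lemma mu_unique (P : nat -> Prop) y : P y -> (forall z, P z -> z = y) -> mu P = y.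
Proof. intros Hy Hu. destruct (mu_spec P) as [[H _] | [H _]]; auto. exfalso. eapply H; eauto. Qed.

Lemma dfnF_mu n s (P : _ -> _ -> nat -> Prop) :
  Dfn (S n) s (fun X w => P X (fun i => w (S i)) (w 0)) ->
  DfnF n s (fun X v => mu (P X v)).
Proof.
  intros H. unfold DfnF.
  assert (H' : Dfn (S (S n)) s (fun X w => P X (fun i => w (S (S i))) (w 0))).
  { exact (dfn_ren (S n) (S (S n)) s _ (fun i => match i with 0 => 0 | S k => S (S k) end)
    ltac:(intros [| i]; cbn; lia) H). }
  eapply dfn_iff with (R := fun X w =>
    (P X (fun i => w (S i)) (w 0) /\ forall z, z < w 0 -> ~ P X (fun i => w (S i)) z) \/
    ((forall z, ~ P X (fun i => w (S i)) z) /\ w 0 = 0)); [| dfn].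
  intros X w. cbv beta.
  destruct (mu_spec (P X (fun i => w (S i)))) as [[H1 H2] | [H1 H2]].
  - split.
    + intros [[H3 H4] | [H3 H4]]; [| exfalso; eapply H3; eauto].
      destruct (Nat.lt_trichotomy (w 0) (mu (P X (fun i => w (S i))))) as [L | [L | L]]; auto; exfalso.
      * eapply H2; eauto.
      * eapply H4; eauto.
    + intros ->. auto.
  - rewrite H2. split; [| auto]. intros [[H3 H4] | [H3 H4]]; auto. exfalso. eapply H1; eauto.
Qed.

Definition ite (P : Prop) (a b : nat) : nat := if tb P then a else b.

Lemma ite_true (P : Prop) a b : P -> ite P a b = a.
Proof. intros H. unfold ite. rewrite (proj2 (tb_true P)); auto. Qed.

Lemma ite_false (P : Prop) a b : ~ P -> ite P a b = b.
Proof. intros H. unfold ite. rewrite (proj2 (tb_false P)); auto. Qed.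

Lemma dfnF_ite n s P t u : Dfn n s P -> DfnF n s t -> DfnF n s u ->
  DfnF n s (fun X v => ite (P X v) (t X v) (u X v)).
Proof.
  intros HP Ht Hu. unfold DfnF in *.
  assert (HP' : Dfn (S n) s (fun X w => P X (fun i => w (S i)))).
  { exact (dfn_ren n (S n) s _ (fun i => S i) ltac:(intros; cbn; lia) HP). }
  eapply dfn_iff with (R := fun X w =>
    (P X (fun i => w (S i)) /\ w 0 = t X (fun i => w (S i))) \/
    (~ P X (fun i => w (S i)) /\ w 0 = u X (fun i => w (S i)))).
  - intros X w. cbv beta. destruct (classic (P X (fun i => w (S i)))) as [H | H].
    + rewrite ite_true by auto. tauto.
    + rewrite ite_false by auto. tauto.
  - apply dfn_or; apply dfn_and; auto. apply dfn_not; auto.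
Qed.

Ltac dfn_ext ::=
  match goal with
  | |- DfnF _ _ (fun X v => @?t X v + @?u X v) => apply (dfnF_add _ _ t u)
  | |- DfnF _ _ (fun X v => pr (@?t X v) (@?u X v)) => apply (dfnF_pr _ _ t u)
  | |- DfnF _ _ (fun X v => p1 (@?t X v)) => apply (dfnF_p1 _ _ t)
  | |- DfnF _ _ (fun X v => p2 (@?t X v)) => apply (dfnF_p2 _ _ t)
  | |- DfnF _ _ (fun X v => mu (@?P X v)) => apply (dfnF_mu _ _ P)
  | |- DfnF _ _ (fun X v => mu (fun y => @?P X v y)) => apply (dfnF_mu _ _ P)
  | |- DfnF _ _ (fun X v => ite (@?P X v) (@?t X v) (@?u X v)) => apply (dfnF_ite _ _ P t u)
  end.

Definition prec (b : nat) (h : nat -> nat -> nat) (n : nat) : nat :=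
  nat_rect (fun _ => nat) b h n.

Lemma lfp_prec b h z :
  lfp (fun x z => z = pr 0 b \/ exists m y, x (pr m y) = true /\ z = pr (S m) (h m y)) z <->
  exists m, z = pr m (prec b h m).
Proof.
  split.
  - intros H. set (Y := (fun z => tb (exists m, z = pr m (prec b h m))) : C).
    apply (tb_true (exists m, z = pr m (prec b h m))). apply (H Y). unfold Y.
    intros k [-> | (m & y & Hx & ->)]; rewrite tb_true in *.
    + exists 0. auto.
    + destruct Hx as (m' & E). apply pr_inj in E. destruct E as [<- ->]. exists (S m). auto.
  - intros (m & ->) Y HY. induction m as [| m IH]; apply HY; auto.
    right. exists m, (prec b h m). auto.
Qed.

Lemma dfnF_prec n s (b : _ -> _ -> nat) (h : _ -> _ -> nat -> nat -> nat) t :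
  DfnF n s b -> DfnF n s t ->
  DfnF (S (S n)) s (fun X w => h X (fun i => w (S (S i))) (w 0) (w 1)) ->
  DfnF n s (fun X v => prec (b X v) (h X v) (t X v)).
Proof.
  intros Hb Ht Hh. unfold DfnF.
  eapply dfn_iff with (R := fun X w =>
    lfp (fun x z => z = pr 0 (b X (fun i => w (S i))) \/ exists m y, x (pr m y) = true /\
      z = pr (S m) (h X (fun i => w (S i)) m y)) (pr (t X (fun i => w (S i))) (w 0))).
  { intros X w. cbv beta. rewrite lfp_prec. split.
    - intros (m & E). apply pr_inj in E. destruct E as [-> ->]. auto.
    - intros ->. eauto. }
  apply (dfn_lfp (S n) s (fun X w x z => z = pr 0 (b X (fun i => w (S i))) \/ exists m y, x (pr m y) = true /\
      z = pr (S m) (h X (fun i => w (S i)) m y)) (fun X w => pr (t X (fun i => w (S i))) (w 0))).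
  - intros X v x y m Hxy [-> | (k & z & Hx & ->)]; auto. right. exists k, z. auto.
  - apply dfnF_pr; [apply dfnF_wk; auto | dfn].
  - apply dfn_or.
    + apply (dfn_eq (S (S n)) (S s) (fun _ w => w 0)); [dfn |].
      apply dfnF_pr; [dfn |].
      exact (dfn_ren2 (S n) (S (S (S n))) s (S s) _ (fun i => match i with 0 => 0 | S k => S (S (S k)) end) S
        ltac:(intros [| i]; cbn; lia) ltac:(intros; cbn; lia) Hb).
    + apply dfn_ex, dfn_ex, dfn_and; [dfn |].
      apply (dfn_eq _ _ (fun _ w => w 2)); [dfn |].
      apply (dfnF_pr _ _ (fun _ w => S (w 1))); [dfn |].
      exact (dfn_ren2 (S (S (S n))) (S (S (S (S (S n))))) s (S s) _
        (fun i => match i with 0 => 0 | 1 => 2 | 2 => 1 | S (S (S k)) => S (S (S (S (S k)))) end) S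
        ltac:(intros [| [| [| i]]]; cbn; lia) ltac:(intros; cbn; lia) Hh).
Qed.

Lemma code_nil : code [] = 0.
Proof. reflexivity. Qed.

Lemma code_cons a s : code (a :: s) = S (pr a (code s)).
Proof. reflexivity. Qed.

(** * Numbers that can be dropped *)

(* No scheme removes a number from the sequence without using it. Run on [k :: a],
   the index [E u] runs [k] on [a], so an entry [E u] can be disposed of. *)
Definition E (u : nat) : nat :=
  code [4; code [9]; code [4; code [2; code [9]]; code [2; u]]].

Lemma kleene_E u F f k a c : kleene k F f a c -> kleene (E u) F f (k :: a) c.
Proof.
  intros H. eapply S4.
  - eapply S4; [apply S2 | apply S2].
  - apply S9, S9, H.
Qed.

Lemma code_cons_inj a s b t : code (a :: s) = code (b :: t) -> a = b /\ code s = code t.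
Proof. intros H. apply code_inj in H. split; congruence. Qed.

Lemma E_inj u u' : E u = E u' -> u = u'.
Proof.
  unfold E. intros H.
  repeat match goal with
  | H : code (_ :: _) = code (_ :: _) |- _ => apply code_cons_inj in H; destruct H as [? H]
  end.
  repeat match goal with
  | H : code (_ :: _) = code (_ :: _) |- _ => apply code_cons_inj in H; destruct H as [? ?]
  end. auto.
Qed.

Lemma dfnF_E n s t : DfnF n s t -> DfnF n s (fun X v => E (t X v)).
Proof.
  intros Ht. unfold E.
  apply (dfnF_let n s (fun X y v => code [4; code [9]; code [4; code [2; code [9]]; code [2; y]]])); auto.
  cbv beta. generalize (code [9]). intros c.
  eapply dfn_iff with (R := fun X w => w 0 = S (pr 4 (S (pr c (S (pr (S (pr 4 (S (pr
    (S (pr 2 (S (pr c 0)))) (S (pr (S (pr 2 (S (pr (w 1) 0)))) 0)))))) 0)))))); [| dfn].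
  intros X w. cbv beta. rewrite !code_cons, !code_nil. tauto.
Qed.

Definition unE (y : nat) : nat := mu (fun u => E u = y).

Lemma unE_E u : unE (E u) = u.
Proof. apply mu_unique; auto. intros z. apply E_inj. Qed.

Lemma dfnF_unE n s t : DfnF n s t -> DfnF n s (fun X v => unE (t X v)).
Proof.
  apply dfnF_fun1. apply (dfn_eq 2 0 (fun _ v => v 0)); [dfn |]. unfold unE. dfn.
  apply dfnF_E. dfn.
Qed.

(** The quoted continuation is pushed, the entry to be dropped is moved in front of it and consumed
    by S9; run on the rest, it runs the continuation. [dnM] accounts for the entry that is gone by
    then. *)
Definition tDrop (q : nat) (cont : tm) : tm :=
  tLet (tQuote (dnM cont)) (tcode [Tn 6; Tn (code [9]); Tk; Tl 0 0; tmoveM (S q)]).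

Lemma run_drop F f l1 l2 u cont c :
  run F cont f (l1 ++ l2) c -> run F (tDrop (length l1) cont) f (l1 ++ E u :: l2) c.
Proof.
  intros H. eapply run_let; [apply run_quote |].
  Transparent run. unfold run in *. rewrite ev_tcode. cbn [map]. rewrite ev_tmoveM. cbn [ev].
  rewrite Nat.add_0_r, Nat.sub_0_r. set (k := ev (dnM cont) _ _ _).
  eapply S6; [apply permuted_id | apply permuted_id | exact (permuted_move (k :: l1) l2 (E u)) |].
  apply S9. apply kleene_E. unfold k.
  replace (length (l1 ++ E u :: l2)) with (S (length (l1 ++ l2))) by (rewrite !length_app; simpl; lia).
  rewrite ev_dnM. exact H.
Qed.
Opaque run.

Fixpoint tDropN (q n : nat) (cont : tm) : tm :=
  match n with 0 => cont | S n => tDrop q (tDropN q n cont) end.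

Lemma run_dropN F f l1 us l2 cont c q n : q = length l1 -> n = length us ->
  run F cont f (l1 ++ l2) c -> run F (tDropN q n cont) f (l1 ++ map E us ++ l2) c.
Proof.
  intros -> -> H. induction us as [| u us IH]; simpl; auto. apply run_drop. exact IH.
Qed.

(* Iterated unpairing splits [t] into [2 ^ D] numbers [l]; a counter with value [t]
   is kept as the corresponding entries [E l]. *)
Fixpoint leaves (D t : nat) : list nat :=
  match D with
  | 0 => [t]
  | S D => leaves D (p1 t) ++ leaves D (p2 t)
  end.

Lemma leaves_length D t : length (leaves D t) = 2 ^ D.
Proof. revert t. induction D; intros t; simpl; auto. rewrite length_app, !IHD. lia. Qed.

Lemma leaves_0 D : leaves D 0 = repeat 0 (2 ^ D).
Proof.
  induction D; simpl; auto. change (p1 0) with 0. change (p2 0) with 0. rewrite IHD.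
  rewrite <- repeat_app. f_equal. lia.
Qed.

Fixpoint tv (D : nat) (v : nat -> nat) (o : nat) : nat :=
  match D with
  | 0 => unE (v o)
  | S D => pr (tv D v o) (tv D v (o + 2 ^ D))
  end.

Lemma tv_spec D v o t :
  (forall i, i < 2 ^ D -> v (o + i) = E (nth i (leaves D t) 0)) -> tv D v o = t.
Proof.
  revert o t. induction D as [| D IH]; intros o t H; simpl in *.
  - rewrite <- (Nat.add_0_r o), H by lia. simpl. apply unE_E.
  - rewrite (IH o (p1 t)), (IH (o + 2 ^ D) (p2 t)).
    + apply pr_eta.
    + intros i Hi. rewrite <- Nat.add_assoc, H by lia.
      rewrite app_nth2; rewrite leaves_length; [f_equal; f_equal |]; lia.
    + intros i Hi. rewrite H by lia. rewrite app_nth1; auto. rewrite leaves_length. auto.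
Qed.

Lemma dfnF_tv n s D o : o + 2 ^ D <= n -> DfnF n s (fun X v => tv D v o).
Proof.
  revert o. induction D as [| D IH]; intros o H; simpl in *.
  - apply (dfnF_unE n s (fun X v => v o)). dfn.
  - apply (dfnF_pr n s (fun X v => tv D v o) (fun X v => tv D v (o + 2 ^ D))); apply IH; lia.
Qed.

(** A definable form of the [j]-th entry of [leaves]; the minimisation stands for the difference
    [j - 2 ^ D]. *)
Fixpoint leafat (D j t : nat) : nat :=
  match D with
  | 0 => t
  | S D => ite (j < 2 ^ D) (leafat D j (p1 t)) (leafat D (mu (fun k => k + 2 ^ D = j)) (p2 t))
  end.

Lemma leafat_spec D j t : j < 2 ^ D -> leafat D j t = nth j (leaves D t) 0.
Proof.
  revert j t. induction D as [| D IH]; intros j t H; simpl in *.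
  - destruct j; auto. lia.
  - destruct (Nat.lt_ge_cases j (2 ^ D)) as [L | L].
    + rewrite ite_true by auto. rewrite IH by auto. rewrite app_nth1; auto. rewrite leaves_length. auto.
    + rewrite ite_false by lia. replace (mu _) with (j - 2 ^ D).
      * rewrite IH by lia. rewrite app_nth2; rewrite leaves_length; auto.
      * symmetry. apply mu_unique; intros; lia.
Qed.

Lemma dfnF_leafat n s D t u :
  DfnF n s t -> DfnF n s u -> DfnF n s (fun X v => leafat D (t X v) (u X v)).
Proof.
  revert n t u. induction D as [| D IH]; intros n t u Ht Hu; cbn [leafat]; auto.
  apply (dfnF_let n s (fun X y v => ite (y < 2 ^ D) (leafat D y (p1 (u X v)))
    (leafat D (mu (fun k => k + 2 ^ D = y)) (p2 (u X v))))); auto.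
  apply dfnF_wk in Hu. generalize dependent (2 ^ D). intros c.
  apply (dfnF_ite (S n) s (fun X w => w 0 < c)); [dfn | apply IH | apply IH].
  - dfn.
  - dfn.
  - apply dfnF_mu. dfn.
  - dfn.
Qed.

(** Each component of a pair [z] has square at most [2 * z], so [D] unpairings take, up to a
    constant factor, a root of order [2 ^ D]. *)
Lemma leaves_bound D t l : In l (leaves D t) -> 2 * l ^ (2 ^ D) <= 2 ^ (2 ^ D) * t.
Proof.
  revert t. induction D as [| D IH]; intros t H; simpl in H.
  - destruct H as [<- | []]. simpl. lia.
  - assert (Hsq : exists t', 2 * l ^ (2 ^ D) <= 2 ^ (2 ^ D) * t' /\ t' * t' <= 2 * t).
    { rewrite <- (pr_eta t). pose proof (pr_spec (p1 t) (p2 t)).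
      apply in_app_or in H. destruct H as [H | H]; apply IH in H; eexists; (split; [exact H | nia]). }
    destruct Hsq as (t' & H1 & H2).
    replace (2 ^ S D) with (2 ^ D + 2 ^ D) by (simpl; lia). rewrite !Nat.pow_add_r.
    set (x := l ^ 2 ^ D) in *. set (y := 2 ^ 2 ^ D) in *.
    assert ((2 * x) * (2 * x) <= (y * t') * (y * t')) by (apply Nat.mul_le_mono; auto).
    assert (y * t' * (y * t') <= y * y * (2 * t)).
    { replace (y * t' * (y * t')) with (y * y * (t' * t')) by lia. apply Nat.mul_le_mono_l; auto. }
    lia.
Qed.

(** For [2 <= u] constants lie below powers of [u], so one exponent absorbs all coefficients of a
    polynomial bound. *)
Definition pbounded (g : nat -> nat) : Prop := exists R, forall u, 2 <= u -> g u <= u ^ R.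

Lemma pow_le2 u a b : 2 <= u -> a <= b -> u ^ a <= u ^ b.
Proof. intros. apply Nat.pow_le_mono_r; lia. Qed.

Lemma pb_const c : pbounded (fun _ => c).
Proof.
  exists c. intros u Hu. pose proof (Nat.pow_gt_lin_r u c). lia.
Qed.

Lemma pb_id : pbounded (fun u => u).
Proof. exists 1. intros u Hu. rewrite Nat.pow_1_r. lia. Qed.

Lemma pb_add g h : pbounded g -> pbounded h -> pbounded (fun u => g u + h u).
Proof.
  intros (R & HR) (R' & HR'). exists (S (R + R')). intros u Hu.
  specialize (HR u Hu). specialize (HR' u Hu).
  pose proof (pow_le2 u R (R + R') Hu ltac:(lia)). pose proof (pow_le2 u R' (R + R') Hu ltac:(lia)).
  rewrite Nat.pow_succ_r'. nia.
Qed.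

Lemma pb_mul g h : pbounded g -> pbounded h -> pbounded (fun u => g u * h u).
Proof.
  intros (R & HR) (R' & HR'). exists (R + R'). intros u Hu. rewrite Nat.pow_add_r.
  apply Nat.mul_le_mono; auto.
Qed.

Lemma pb_le g h : pbounded h -> (forall u, g u <= h u) -> pbounded g.
Proof. intros (R & HR) H. exists R. intros u Hu. specialize (H u). specialize (HR u Hu). lia. Qed.

Lemma pb_cons a s : pbounded a -> pbounded s -> pbounded (fun u => S (pr (a u) (s u))).
Proof.
  intros Ha Hs.
  apply (pb_le _ (fun u => 1 + (s u + (a u + s u) * (1 + (a u + s u))))).
  - auto 10 using pb_const, pb_add, pb_mul.
  - intros u. pose proof (pr_spec (a u) (s u)). nia.
Qed.

Lemma pb_code_cons a s : pbounded a -> pbounded (fun u => code (s u)) ->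
  pbounded (fun u => code (a u :: s u)).
Proof.
  intros Ha Hs. apply (pb_le _ (fun u => S (pr (a u) (code (s u))))); [apply pb_cons; auto |].
  intros u. rewrite code_cons. lia.
Qed.

Lemma pb_E : pbounded E.
Proof.
  unfold E. generalize (code [9]). intros c.
  repeat first [apply pb_const | apply pb_id | apply pb_code_cons].
Qed.

(** [E] grows polynomially, with exponent [R] say, while [leaves] takes roots of any desired order;
    [2 * R < 2 ^ D] suffices. The factor [2 ^ r * 2 ^ r] in the squared estimate is absorbed by
    [u ^ r] when [u] is at least 4, whence the threshold 3. This makes the entries of a counter
    running up to [E u] simpler than [u]. *)
Lemma small_leaves : exists D, forall u t l, 3 < u -> t <= E u -> In l (leaves D t) -> l < u.
Proof.
  destruct pb_E as (R & HR). exists (2 * R + 2). set (D := 2 * R + 2).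
  intros u t l Hu Ht Hl. apply leaves_bound in Hl.
  assert (Hr : 2 * R < 2 ^ D) by (pose proof (Nat.pow_gt_lin_r 2 D); lia).
  set (r := 2 ^ D) in *. destruct (Nat.lt_ge_cases l u) as [L | L]; auto. exfalso.
  assert (H1 : u ^ r <= l ^ r) by (apply Nat.pow_le_mono_l; auto).
  pose proof (HR u ltac:(lia)) as H2.
  assert (H3 : 2 * u ^ r <= 2 ^ r * u ^ R) by nia.
  assert (H4 : 2 ^ r * 2 ^ r <= u ^ r).
  { rewrite <- Nat.pow_mul_l. apply Nat.pow_le_mono_l. lia. }
  assert (H5 : u ^ R * u ^ R <= u ^ r).
  { rewrite <- Nat.pow_add_r. apply pow_le2; lia. }
  assert (H6 : 0 < u ^ r) by (apply Nat.neq_0_lt_0, Nat.pow_nonzero; lia).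
  assert (H7 : (2 * u ^ r) * (2 * u ^ r) <= (2 ^ r * u ^ R) * (2 ^ r * u ^ R)) by (apply Nat.mul_le_mono; auto).
  assert (H8 : (2 ^ r * u ^ R) * (2 ^ r * u ^ R) <= u ^ r * u ^ r).
  { replace ((2 ^ r * u ^ R) * (2 ^ r * u ^ R)) with ((2 ^ r * 2 ^ r) * (u ^ R * u ^ R)) by lia.
    apply Nat.mul_le_mono; auto. }
  nia.
Qed.

(** * Unbounded search *)

(** [fNimp p fTrue] is the negation that [tIfc] expects, and the variables lie below the two numbers
    that it pushes. *)
Definition tIf (p : fm) (c : nat) (q : tm) : tm :=
  tIfc c (comp (fNimp p fTrue) (fun i => S (S i)) (fun j => j)) q.

Lemma run_if F p c q f a X v y :
  reads p (fun i => i) (fun j => j) f a X v ->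
  (sem p X v -> y = c) -> (~ sem p X v -> run F q f a y) -> run F (tIf p c q) f a y.
Proof.
  intros Hr H1 H2. apply (run_ifc F c _ q f a (tb (sem p X v))).
  - intros z z'.
    eapply run_eq; [| apply (run_comp F (fNimp p fTrue) _ _ f (z :: z' :: a) X v)].
    + simpl. destruct (tb (sem p X v)) eqn:E; rewrite ?tb_true, ?tb_false in E; simpl.
      * rewrite (proj2 (tb_false _)); [reflexivity | tauto].
      * rewrite (proj2 (tb_true _)); [reflexivity | tauto].
    + destruct Hr as [Hv HX]. split.
      * intros i [Hi | []]. simpl. auto.
      * intros j [Hj | []]. auto.
  - rewrite tb_true. auto.
  - rewrite tb_false. auto.
Qed.

Definition tRun (k : nat) : tm := tExec (tVar k).

Lemma run_run F k f a z c : nth_error a k = Some z -> kleene z F f a c -> run F (tRun k) f a c.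
Proof. intros H H'. eapply run_exec; [apply run_var; exact H | exact H']. Qed.

Fixpoint upMn (n : nat) (t : tm) : tm := match n with 0 => t | S n => upM (upMn n t) end.

Lemma ev_upMn n t K L M : ev (upMn n t) K L M = ev t K L (n + M).
Proof.
  revert M. induction n; intros M; simpl; auto. rewrite ev_upM, IHn. f_equal. lia.
Qed.

Section Search.
Variable D : nat.
Hypothesis HD : forall u t l, 3 < u -> t <= E u -> In l (leaves D t) -> l < u.
Let r := 2 ^ D.
Let Bt (t : nat) : list nat := map E (leaves D t).

Lemma Bt_length t : length (Bt t) = r.
Proof. unfold Bt. rewrite length_map. apply leaves_length. Qed.

(* The entry of index [i] of [Bt (S t)], on a stack with [c] entries above
   [Bt t] and [w] entries between [Bt t] and the base. *)
Definition tItem (w c i : nat) : tm :=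
  tDropN 0 c (tDropN r w (tLet (tConst (E i)) (tRun (S r)))).

Fixpoint tPush (w n : nat) (cont : tm) : tm :=
  match n with
  | 0 => cont
  | S n => tLet (tItem w (r - S n) n) (tPush w n cont)
  end.

(** The next counter is built above the present one, which is then dropped, and entry [k] of the
    base is run. Since that entry is the quoted loop, programs refer to themselves through the
    stack; the result of the loop is the number of its rounds, added up by successors on the way
    back. *)
Definition tStep (w k : nat) : tm := tPush w r (tDropN r r (tRun (r + w + k))).
Definition tLoop (stop : fm) (w k : nat) : tm := tIf stop 0 (tSuc (tStep w k)).

Fixpoint tZeros (n : nat) (cont : tm) : tm :=
  match n with 0 => cont | S n => tLet (tConst (E 0)) (tZeros n cont) end.

Lemma run_zeros F n cont f a c :
  run F cont f (repeat (E 0) n ++ a) c -> run F (tZeros n cont) f a c.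
Proof.
  revert a. induction n as [| n IH]; intros a H; simpl; auto.
  eapply run_let; [apply run_const |]. apply IH.
  change (E 0 :: a) with ([E 0] ++ a). rewrite app_assoc, <- repeat_cons. exact H.
Qed.

Lemma Bt_0 : Bt 0 = repeat (E 0) r.
Proof. unfold Bt. rewrite leaves_0, map_repeat. reflexivity. Qed.

Lemma tv_Bt t l1 l2 v : (forall i, v i = nth i (l1 ++ Bt t ++ l2) 0) -> tv D v (length l1) = t.
Proof.
  intros Hv. apply tv_spec. intros i Hi. rewrite Hv, app_nth2 by lia.
  replace (length l1 + i - length l1) with i by lia.
  rewrite app_nth1 by (rewrite Bt_length; exact Hi).
  unfold Bt. erewrite nth_indep by (rewrite length_map, leaves_length; exact Hi).
  apply map_nth.
Qed.

Section Base.
Variables (F : list ((nat -> nat) -> nat)) (f : list (nat -> nat)) (base : list nat) (g : nat).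
Hypothesis Hg : nth_error base 0 = Some g.

Definition leaf_ok (t i : nat) : Prop :=
  kleene g F f (E i :: Bt t ++ base) (E (nth i (leaves D (S t)) 0)).

Lemma run_item t i ps us w c : leaf_ok t i -> c = length ps -> w = length us ->
  run F (tItem w c i) f (map E ps ++ Bt t ++ map E us ++ base) (E (nth i (leaves D (S t)) 0)).
Proof.
  intros H -> ->. unfold tItem.
  apply (run_dropN F f [] ps); auto. simpl.
  apply run_dropN; [rewrite Bt_length; auto | auto |].
  eapply run_let; [apply run_const |].
  eapply run_run; [| exact H].
  simpl. rewrite nth_error_app2; rewrite Bt_length; [rewrite Nat.sub_diag; exact Hg | auto].
Qed.

Lemma run_push t us w cont c n ps : w = length us -> n <= r -> length ps = r - n ->
  (forall i, i < r -> leaf_ok t i) ->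
  run F cont f (map E (firstn n (leaves D (S t)) ++ ps) ++ Bt t ++ map E us ++ base) c ->
  run F (tPush w n cont) f (map E ps ++ Bt t ++ map E us ++ base) c.
Proof.
  intros Hw. revert ps. induction n as [| n IH]; intros ps Hn Hp Hl H; simpl; auto.
  eapply run_let.
  - apply run_item; [apply Hl; lia | lia | auto].
  - apply (IH (nth n (leaves D (S t)) 0 :: ps)); simpl; auto; try lia.
    replace (firstn n (leaves D (S t)) ++ nth n (leaves D (S t)) 0 :: ps)
      with (firstn (S n) (leaves D (S t)) ++ ps); auto.
    assert (HL : n < length (leaves D (S t))) by (rewrite leaves_length; exact Hn).
    revert HL. generalize (leaves D (S t)). clear. induction n as [| n IH]; intros [| x l] H; simpl in *; try lia; auto.
    f_equal. apply IH. lia.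
Qed.

Lemma run_step t us w k z c : w = length us -> nth_error base k = Some z ->
  (forall i, i < r -> leaf_ok t i) ->
  kleene z F f (Bt (S t) ++ map E us ++ base) c ->
  run F (tStep w k) f (Bt t ++ map E us ++ base) c.
Proof.
  intros Hw Hz Hl H. unfold tStep.
  apply (run_push t us w _ c r []); auto; [simpl; lia |].
  rewrite firstn_all2, app_nil_r by (rewrite leaves_length; auto).
  apply run_dropN; [rewrite length_map, leaves_length; auto | rewrite leaves_length; auto |].
  eapply run_run; [| exact H].
  change (map E (leaves D (S t))) with (Bt (S t)).
  rewrite app_assoc, nth_error_app2; rewrite length_app, Bt_length, length_map; [| lia].
  replace (r + w + k - (r + length us)) with k by lia. exact Hz.
Qed.

(** The third equation says that entry [k] holds the index of this very loop for the present length
    of the stack. Every round restores that length, so the number of remaining rounds can serve for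
    the induction. *)
Lemma run_loop stop X us w k z :
  w = length us -> nth_error base k = Some z ->
  z = ev (tLoop stop w k) (length F) (length f) (r + (w + length base)) ->
  (forall i, used stop i -> i < r + (w + length base)) ->
  (forall j, usedX stop j -> exists n, nth_error f j = Some (ncons n (X j))) ->
  forall n t,
  (forall d, d < n -> forall i, i < r -> leaf_ok (d + t) i) ->
  (forall d, d < n -> ~ sem stop X (fun i => nth i (Bt (d + t) ++ map E us ++ base) 0)) ->
  sem stop X (fun i => nth i (Bt (n + t) ++ map E us ++ base) 0) ->
  run F (tLoop stop w k) f (Bt t ++ map E us ++ base) n.
Proof.
  intros Hw Hz Ez Hu HX.
  assert (Hlen : forall t, length (Bt t ++ map E us ++ base) = r + (w + length base))
    by (intros t; rewrite !length_app, Bt_length, length_map; lia).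
  induction n as [| n IH]; intros t Hl Hn Hs.
  - eapply run_if with (X := X) (v := fun i => nth i (Bt t ++ map E us ++ base) 0).
    + split; [| exact HX]. intros i Hi. apply nth_error_nth'. rewrite Hlen. auto.
    + auto.
    + intros H. exfalso. apply H. exact Hs.
  - eapply run_if with (X := X) (v := fun i => nth i (Bt t ++ map E us ++ base) 0).
    + split; [| exact HX]. intros i Hi. apply nth_error_nth'. rewrite Hlen. auto.
    + intros H. exfalso. apply (Hn 0); [lia | exact H].
    + intros _. apply run_suc. eapply run_step; eauto.
      * intros i Hi. apply (Hl 0); auto. lia.
      * rewrite Ez, <- (Hlen (S t)). change (run F (tLoop stop w k) f (Bt (S t) ++ map E us ++ base) n).
        apply IH.
        -- intros d Hd i Hi. rewrite Nat.add_succ_r. apply (Hl (S d)); auto. lia.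
        -- intros d Hd. rewrite Nat.add_succ_r. apply (Hn (S d)). lia.
        -- rewrite Nat.add_succ_r. exact Hs.
Qed.
End Base.

Section Leaf.
Variables (pu : nat -> fm) (ps : fm).
Hypothesis Hpu : forall c, (forall i, used (pu c) i -> i < S r) /\ (forall j, usedX (pu c) j -> j < 0) /\
  forall X v, sem (pu c) X v <-> leafat D (unE (v 0)) (S (tv D v 1)) = c.
Hypothesis Hps : (forall i, used ps i -> i < r + S r) /\ (forall j, usedX ps j -> j < 0) /\
  forall X v, sem ps X v <-> tv D v 0 = E (leafat D (unE (v r)) (S (tv D v (S r)))).

(* [tG] returns [E u] for a leaf [u] of the next counter value. When [u] is large
   it runs a second counter from [0] until its value is [E u]; by [HD] the leaves
   of all intermediate values are smaller than [u], so the recursion is well-founded. *)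
Definition tL : tm := tLoop ps (S r) 1.
Definition tG : tm :=
  tIf (pu 0) (E 0) (tIf (pu 1) (E 1) (tIf (pu 2) (E 2) (tIf (pu 3) (E 3)
    (tZeros r (tRun (r + S r + 1)))))).

Variables (F : list ((nat -> nat) -> nat)) (f : list (nat -> nat)) (base : list nat) (g l : nat).
Hypothesis Hg : nth_error base 0 = Some g.
Hypothesis Hl : nth_error base 1 = Some l.
Hypothesis Eg : g = ev tG (length F) (length f) (S r + length base).
Hypothesis El : l = ev tL (length F) (length f) (r + (S r + length base)).

Lemma leaf_correct u : forall t i, i < r -> nth i (leaves D (S t)) 0 = u ->
  leaf_ok F f base g t i.
Proof.
  induction u as [u IH] using lt_wf_ind. intros t i Hi Hu. unfold leaf_ok. rewrite Hu.
  set (st := E i :: Bt t ++ base).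
  assert (Hlen : length st = S r + length base) by (unfold st; simpl; rewrite length_app, Bt_length; auto).
  rewrite Eg, <- Hlen. change (run F tG f st (E u)).
  set (v := fun k => nth k st 0).
  assert (Htv : tv D v 1 = t) by (apply (tv_Bt t [E i] base); auto).
  assert (Hsem : forall c X, sem (pu c) X v <-> u = c).
  { intros c X. destruct (Hpu c) as (_ & _ & H). rewrite H, Htv.
    change (v 0) with (E i). rewrite unE_E, leafat_spec, Hu; tauto. }
  assert (Hr : forall c, reads (pu c) (fun i => i) (fun j => j) f st (fun _ => czero) v).
  { intros c. destruct (Hpu c) as (H1 & H2 & _). split.
    - intros k Hk. apply nth_error_nth'. apply H1 in Hk. lia.
    - intros j Hj. apply H2 in Hj. lia. }
  unfold tG.
  assert (Hc : forall c q, (u <> c -> run F q f st (E u)) -> run F (tIf (pu c) (E c) q) f st (E u)).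
  { intros c q H. eapply run_if; [apply Hr | |]; rewrite Hsem; [intros ->; auto | auto]. }
  do 4 (apply Hc; intros ?).
  apply run_zeros. rewrite <- Bt_0.
  (* Everything above the base has the form [E _], hence counts as droppable material between the
     base and the second counter. *)
  set (us := i :: leaves D t).
  change st with (map E us ++ base).
  assert (Hus : length us = S r) by (unfold us; simpl; rewrite leaves_length; auto).
  eapply run_run.
  { rewrite app_assoc, nth_error_app2; rewrite length_app, Bt_length, length_map, Hus; [| lia].
    replace (r + S r + 1 - (r + S r)) with 1 by lia. exact Hl. }
  rewrite El. replace (r + (S r + length base)) with (length (Bt 0 ++ map E us ++ base))
    by (rewrite !length_app, Bt_length, length_map; lia).
  change (run F tL f (Bt 0 ++ map E us ++ base) (E u)).
  assert (Hst : forall d X, sem ps X (fun i => nth i (Bt d ++ map E us ++ base) 0) <-> d = E u).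
  { intros d X. destruct Hps as (_ & _ & Hs). rewrite Hs.
    rewrite (tv_Bt d [] (map E us ++ base)) by auto.
    rewrite app_nth2; rewrite Bt_length; auto. rewrite Nat.sub_diag. unfold us at 1. cbn [map app nth].
    rewrite unE_E, leafat_spec by auto.
    replace (tv D _ (S r)) with t; [rewrite Hu; tauto |]. symmetry.
    replace (S r) with (length (Bt d ++ [E i])) by (rewrite length_app, Bt_length; simpl; lia).
    apply (tv_Bt t (Bt d ++ [E i]) base). intros k. unfold us. rewrite <- app_assoc. reflexivity. }
  unfold tL. rewrite <- Hus.
  apply (run_loop F f base g Hg ps (fun _ => czero) us (length us) 1 l eq_refl Hl).
  - rewrite Hus. exact El.
  - destruct Hps as (H' & _). intros k Hk. apply H' in Hk. lia.
  - destruct Hps as (_ & H' & _). intros j Hj. apply H' in Hj. lia.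
  - intros d Hd k Hk. rewrite Nat.add_0_r.
    apply (IH (nth k (leaves D (S d)) 0)); auto.
    apply (HD u (S d)); [lia | lia |]. apply nth_In. rewrite leaves_length. exact Hk.
  - intros d Hd. rewrite Hst. lia.
  - rewrite Hst. lia.
Qed.
End Leaf.

Lemma search_D n s (R : (nat -> C) -> nat -> (nat -> nat) -> Prop) :
  Dfn (S n) s (fun X w => R X (w 0) (fun i => w (S i))) ->
  exists t, forall F f a X y, n <= length a ->
    (forall j, j < s -> exists k, nth_error f j = Some (ncons k (X j))) ->
    R X y (fun i => nth i a 0) -> (forall z, z < y -> ~ R X z (fun i => nth i a 0)) ->
    run F t f a y.
Proof.
  intros HR.
  assert (Hpu : forall c, Dfn (S r) 0 (fun X v => leafat D (unE (v 0)) (S (tv D v 1)) = c)).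
  { intros c. apply (dfn_eq _ _ (fun X v => leafat D (unE (v 0)) (S (tv D v 1))) (fun _ _ => c)); [| dfn].
    apply (dfnF_leafat _ _ D (fun X v => unE (v 0)) (fun X v => S (tv D v 1))).
    - apply dfnF_unE. dfn.
    - apply dfnF_S. apply (dfnF_tv (S r) 0 D 1). unfold r. lia. }
  assert (Hps : Dfn (r + S r) 0 (fun X v => tv D v 0 = E (leafat D (unE (v r)) (S (tv D v (S r)))))).
  { apply (dfn_eq _ _ (fun X v => tv D v 0) (fun X v => E (leafat D (unE (v r)) (S (tv D v (S r)))))).
    - apply dfnF_tv. unfold r. lia.
    - apply dfnF_E. apply (dfnF_leafat _ _ D (fun X v => unE (v r)) (fun X v => S (tv D v (S r)))).
      + apply dfnF_unE. apply dfnF_var. lia.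
      + apply dfnF_S. apply dfnF_tv. unfold r. lia. }
  assert (HM : Dfn (r + 3 + n) s (fun X v => R X (tv D v 0) (fun i => v (r + 3 + i)))).
  { apply (dfn_let _ _ (fun X y v => R X y (fun i => v (r + 3 + i))) (fun X v => tv D v 0)).
    - apply dfnF_tv. unfold r. lia.
    - exact (dfn_ren (S n) (S (r + 3 + n)) s _ (fun i => match i with 0 => 0 | S k => S (r + 3 + k) end)
        ltac:(intros [| i]; cbn; lia) HR). }
  apply constructive_indefinite_description in Hps. destruct Hps as (ps & Hps).
  destruct HM as (pm & HM).
  set (pu := fun c => proj1_sig (constructive_indefinite_description _ (Hpu c))).
  assert (Hpu' : forall c, (forall i, used (pu c) i -> i < S r) /\ (forall j, usedX (pu c) j -> j < 0) /\
     forall X v, sem (pu c) X v <-> leafat D (unE (v 0)) (S (tv D v 1)) = c).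
  { intros c. unfold pu. apply (proj2_sig (constructive_indefinite_description _ (Hpu c))). }
  set (m := tLoop pm 0 2).
  (* All three programs will run over the base, which is [a] with three quotations on top. They are
     quoted at the heights [length a], one more and two more, which accounts for the different
     shifts. *)
  exists (tLet (tQuote (upMn (r + 3) m)) (tLet (tQuote (upMn (r + S r + 2) (tL ps)))
    (tLet (tQuote (upMn (S r + 1) (tG pu))) (tZeros r (tRun (r + 2)))))).
  intros F f a X y Ha HX Hy Hz.
  eapply run_let; [apply run_quote |]. eapply run_let; [apply run_quote |].
  eapply run_let; [apply run_quote |]. apply run_zeros. rewrite !ev_upMn, <- Bt_0.
  match goal with |- run F _ f (_ ++ ?x :: ?x' :: ?x'' :: a) _ =>
    set (cg := x); set (cl := x'); set (cm := x'') end.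
  set (base := cg :: cl :: cm :: a).
  eapply run_run.
  { rewrite nth_error_app2; rewrite Bt_length; [| lia]. replace (r + 2 - r) with 2 by lia. reflexivity. }
  assert (Hst : forall d, sem pm X (fun i => nth i (Bt d ++ map E [] ++ base) 0) <-> R X d (fun i => nth i a 0)).
  { intros d. destruct HM as (_ & _ & HM'). rewrite HM'.
    rewrite (tv_Bt d [] base) by auto.
    replace (fun i => nth (r + 3 + i) (Bt d ++ map E [] ++ base) 0) with (fun i => nth i a 0); [tauto |].
    apply functional_extensionality. intros i. rewrite app_nth2; rewrite Bt_length; [| lia].
    replace (r + 3 + i - r) with (3 + i) by lia. reflexivity. }
  assert (Ecg : cg = ev (tG pu) (length F) (length f) (S r + length base)).
  { unfold cg, base. cbn [length]. f_equal. lia. }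
  assert (Ecl : cl = ev (tL ps) (length F) (length f) (r + (S r + length base))).
  { unfold cl, base. cbn [length]. f_equal. lia. }
  assert (Ecm : cm = ev m (length F) (length f) (r + (0 + length base))).
  { unfold cm, base. cbn [length]. f_equal. lia. }
  rewrite Ecm. replace (r + (0 + length base)) with (length (Bt 0 ++ base)) by (rewrite length_app, Bt_length; auto).
  change (run F m f (Bt 0 ++ map E [] ++ base) y).
  apply (run_loop F f base cg eq_refl pm X [] 0 2 cm eq_refl eq_refl Ecm).
  - destruct HM as (H & _). intros i Hi. apply H in Hi. unfold base. cbn [length]. lia.
  - destruct HM as (_ & H & _). auto.
  - intros d Hd i Hi. rewrite Nat.add_0_r.
    exact (leaf_correct pu ps Hpu' Hps F f base cg cl eq_refl eq_refl Ecg Ecl _ d i Hi eq_refl).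
  - intros d Hd. rewrite Nat.add_0_r, Hst. auto.
  - rewrite Nat.add_0_r, Hst. auto.
Qed.
End Search.

Lemma search n s (R : (nat -> C) -> nat -> (nat -> nat) -> Prop) :
  Dfn (S n) s (fun X w => R X (w 0) (fun i => w (S i))) ->
  exists t, forall F f a X y, n <= length a ->
    (forall j, j < s -> exists k, nth_error f j = Some (ncons k (X j))) ->
    R X y (fun i => nth i a 0) -> (forall z, z < y -> ~ R X z (fun i => nth i a 0)) ->
    run F t f a y.
Proof.
  destruct small_leaves as (D & HD). exact (search_D D HD n s R).
Qed.

Lemma dfn_run n s (R : (nat -> C) -> (nat -> nat) -> Prop) : Dfn n s R ->
  exists t, forall F f a X, n <= length a ->
    (forall j, j < s -> exists k, nth_error f j = Some (ncons k (X j))) ->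
    run F t f a (Nat.b2n (tb (R X (fun i => nth i a 0)))).
Proof.
  intros (p & H1 & H2 & H3). exists (comp p (fun i => i) (fun j => j)).
  intros F f a X Ha HX. rewrite <- (tb_iff _ _ (H3 X (fun i => nth i a 0))).
  apply run_comp. split; auto. intros i Hi. apply nth_error_nth'. apply H1 in Hi. lia.
Qed.

Lemma dfnF_run n s (t : (nat -> C) -> (nat -> nat) -> nat) : DfnF n s t ->
  exists p, forall F f a X, n <= length a ->
    (forall j, j < s -> exists k, nth_error f j = Some (ncons k (X j))) ->
    run F p f a (t X (fun i => nth i a 0)).
Proof.
  intros H. destruct (search n s (fun X y v => y = t X v) H) as (p & Hp).
  exists p. intros F f a X Ha HX. apply (Hp F f a X); auto. lia.
Qed.

(** * Coded sequences *)

Definition cons' (a s : nat) : nat := S (pr a s).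
Definition hdc (z : nat) : nat := p1 (Nat.pred z).
Definition tlc (z : nat) : nat := p2 (Nat.pred z).
Definition tlsc (s i : nat) : nat := prec s (fun _ y => tlc y) i.
Definition nthc (s i : nat) : nat := hdc (tlsc s i).
Definition lenc (s : nat) : nat := mu (fun n => tlsc s n = 0).

Lemma hdc_cons a s : hdc (cons' a s) = a.
Proof. unfold hdc, cons'. simpl. apply p1_pr. Qed.

Lemma tlc_cons a s : tlc (cons' a s) = s.
Proof. unfold tlc, cons'. simpl. apply p2_pr. Qed.

Lemma code_cons' a s : code (a :: s) = cons' a (code s).
Proof. apply code_cons. Qed.

Lemma tlc_code l : tlc (code l) = code (tl l).
Proof. destruct l; [reflexivity |]. rewrite code_cons', tlc_cons. reflexivity. Qed.

Lemma hdc_code l : hdc (code l) = hd 0 l.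
Proof. destruct l; [reflexivity |]. rewrite code_cons', hdc_cons. reflexivity. Qed.

Lemma tlsc_S s i : tlsc s (S i) = tlc (tlsc s i).
Proof. reflexivity. Qed.

Lemma tlsc_code l i : tlsc (code l) i = code (skipn i l).
Proof.
  induction i as [| i IH]; [reflexivity |]. rewrite tlsc_S, IH, tlc_code. f_equal.
  clear. revert l. induction i as [| i IH]; intros [| x l]; simpl; auto.
Qed.

Lemma nthc_code l i : nthc (code l) i = nth i l 0.
Proof.
  unfold nthc. rewrite tlsc_code, hdc_code. revert l. induction i as [| i IH]; intros [| x l]; simpl; auto.
Qed.

Lemma code_0 l : code l = 0 -> l = [].
Proof. destruct l; auto. rewrite code_cons. discriminate. Qed.

Lemma lenc_code l : lenc (code l) = length l.
Proof.
  unfold lenc. destruct (mu_spec (fun n => tlsc (code l) n = 0)) as [[H1 H2] | [H _]].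
  - rewrite tlsc_code in H1. apply code_0 in H1.
    assert (~ mu (fun n => tlsc (code l) n = 0) < length l).
    { intros H. apply (f_equal (@length nat)) in H1. rewrite length_skipn in H1. simpl in H1. lia. }
    destruct (Nat.lt_ge_cases (length l) (mu (fun n => tlsc (code l) n = 0))) as [H' | H']; [| lia].
    exfalso. apply (H2 _ H'). rewrite tlsc_code, skipn_all. reflexivity.
  - exfalso. apply (H (length l)). rewrite tlsc_code, skipn_all. reflexivity.
Qed.

Lemma code_surj z : exists l, z = code l.
Proof.
  induction z as [z IH] using lt_wf_ind. destruct z as [| z]; [exists []; reflexivity |].
  destruct (IH (p2 z)) as (l & Hl).
  - pose proof (to_nat_ge (p1 z) (p2 z)) as H. change (to_nat (p1 z, p2 z)) with (pr (p1 z) (p2 z)) in H.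
    rewrite pr_eta in H. lia.
  - exists (p1 z :: l). rewrite code_cons, <- Hl, pr_eta. reflexivity.
Qed.

Lemma code_char l z :
  (lenc z = length l /\ forall i, i < length l -> nthc z i = nth i l 0) <-> z = code l.
Proof.
  split.
  - intros [H1 H2]. destruct (code_surj z) as (l' & ->). f_equal. rewrite lenc_code in H1.
    apply (nth_ext _ _ 0 0); auto. intros i Hi. rewrite H1 in Hi. specialize (H2 i Hi).
    rewrite nthc_code in H2. auto.
  - intros ->. rewrite lenc_code. split; auto. intros. apply nthc_code.
Qed.

(** Every number codes a sequence, so a code is the unique number with the prescribed length and
    entries. Operations on sequences become definable pointwise, without recursion. *)
Lemma mu_code l (P : nat -> Prop) :
  (forall z, P z <-> lenc z = length l /\ forall i, i < length l -> nthc z i = nth i l 0) ->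
  mu P = code l.
Proof.
  intros H. apply mu_unique.
  - rewrite H, code_char. reflexivity.
  - intros z. rewrite H, code_char. auto.
Qed.

Lemma dfnF_pred n s t : DfnF n s t -> DfnF n s (fun X v => Nat.pred (t X v)).
Proof.
  apply dfnF_fun1.
  eapply dfn_iff with (R := fun X v => (v 1 = 0 /\ v 0 = 0) \/ v 1 = S (v 0)); [| dfn].
  intros X v. cbv beta. lia.
Qed.

Lemma dfnF_sub n s t u : DfnF n s t -> DfnF n s u -> DfnF n s (fun X v => t X v - u X v).
Proof.
  apply dfnF_fun2.
  eapply dfn_iff with (R := fun X v => (v 1 <= v 2 /\ v 0 = 0) \/ v 1 = v 0 + v 2); [| dfn].
  intros X v. cbv beta. lia.
Qed.

Ltac dfn_ext2 :=
  match goal with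
  | |- DfnF _ _ (fun X v => @?t X v + @?u X v) => apply (dfnF_add _ _ t u)
  | |- DfnF _ _ (fun X v => pr (@?t X v) (@?u X v)) => apply (dfnF_pr _ _ t u)
  | |- DfnF _ _ (fun X v => p1 (@?t X v)) => apply (dfnF_p1 _ _ t)
  | |- DfnF _ _ (fun X v => p2 (@?t X v)) => apply (dfnF_p2 _ _ t)
  | |- DfnF _ _ (fun X v => mu (@?P X v)) => apply (dfnF_mu _ _ P)
  | |- DfnF _ _ (fun X v => mu (fun y => @?P X v y)) => apply (dfnF_mu _ _ P)
  | |- DfnF _ _ (fun X v => ite (@?P X v) (@?t X v) (@?u X v)) => apply (dfnF_ite _ _ P t u)
  | |- DfnF _ _ (fun X v => Nat.pred (@?t X v)) => apply (dfnF_pred _ _ t)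
  | |- DfnF _ _ (fun X v => @?t X v - @?u X v) => apply (dfnF_sub _ _ t u)
  end.
Ltac dfn_ext ::= dfn_ext2.

Lemma dfnF_hdc n s t : DfnF n s t -> DfnF n s (fun X v => hdc (t X v)).
Proof. intros H. unfold hdc. dfn. Qed.

Lemma dfnF_tlc n s t : DfnF n s t -> DfnF n s (fun X v => tlc (t X v)).
Proof. intros H. unfold tlc. dfn. Qed.

Lemma dfnF_cons n s t u : DfnF n s t -> DfnF n s u -> DfnF n s (fun X v => cons' (t X v) (u X v)).
Proof. intros H H'. unfold cons'. dfn. Qed.

Lemma dfnF_tlsc n s t u : DfnF n s t -> DfnF n s u -> DfnF n s (fun X v => tlsc (t X v) (u X v)).
Proof.
  intros Ht Hu. unfold tlsc.
  apply (dfnF_prec n s t (fun X v _ y => tlc y) u); auto. apply (dfnF_tlc _ _ (fun _ w => w 1)). dfn.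
Qed.

Lemma dfnF_nthc n s t u : DfnF n s t -> DfnF n s u -> DfnF n s (fun X v => nthc (t X v) (u X v)).
Proof. intros Ht Hu. unfold nthc. apply (dfnF_hdc n s (fun X v => tlsc (t X v) (u X v))). apply dfnF_tlsc; auto. Qed.

Lemma dfnF_lenc n s t : DfnF n s t -> DfnF n s (fun X v => lenc (t X v)).
Proof.
  apply dfnF_fun1. apply (dfn_eq _ _ (fun _ v => v 0) (fun _ v => lenc (v 1))); [dfn |].
  unfold lenc. apply (dfnF_mu 2 0 (fun X v n => tlsc (v 1) n = 0)).
  apply (dfn_eq _ _ (fun _ v => tlsc (v 2) (v 0))); [apply dfnF_tlsc | ]; dfn.
Qed.

Ltac dfn_ext3 :=
  match goal with
  | |- DfnF _ _ (fun X v => hdc (@?t X v)) => apply (dfnF_hdc _ _ t)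
  | |- DfnF _ _ (fun X v => tlc (@?t X v)) => apply (dfnF_tlc _ _ t)
  | |- DfnF _ _ (fun X v => lenc (@?t X v)) => apply (dfnF_lenc _ _ t)
  | |- DfnF _ _ (fun X v => cons' (@?t X v) (@?u X v)) => apply (dfnF_cons _ _ t u)
  | |- DfnF _ _ (fun X v => nthc (@?t X v) (@?u X v)) => apply (dfnF_nthc _ _ t u)
  end.
Ltac dfn_ext ::= first [dfn_ext2 | dfn_ext3].

Definition seqc (i n : nat) : nat := mu (fun z => lenc z = n /\ forall j, j < n -> nthc z j = i + j).

Lemma seqc_eq i n : seqc i n = code (seq i n).
Proof.
  apply mu_code. intros z. rewrite length_seq. split; intros [H1 H2]; split; auto;
  intros j Hj; rewrite H2 by auto; [symmetry |]; apply seq_nth; auto.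
Qed.

Lemma dfnF_seqc n s t u : DfnF n s t -> DfnF n s u -> DfnF n s (fun X v => seqc (t X v) (u X v)).
Proof.
  apply dfnF_fun2. apply (dfn_eq _ _ (fun _ v => v 0) (fun _ v => seqc (v 1) (v 2))); [dfn |].
  unfold seqc. dfn.
Qed.

Lemma nth_moved i n j : i < n -> j < n ->
  nth j (moved i n) 0 = ite (j = 0) i (ite (j <= i) (Nat.pred j) j).
Proof.
  intros Hi Hj. unfold moved. destruct j as [| j]; [rewrite ite_true; auto |].
  rewrite ite_false by lia. cbn [nth Nat.pred].
  destruct (Nat.lt_ge_cases j i) as [H | H].
  - rewrite ite_true by lia. rewrite app_nth1 by (rewrite length_seq; auto). apply seq_nth. auto.
  - rewrite ite_false by lia. rewrite app_nth2; rewrite length_seq; auto.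
    rewrite seq_nth; lia.
Qed.

Lemma moved_length i n : i < n -> length (moved i n) = n.
Proof. intros H. unfold moved. simpl. rewrite length_app, !length_seq. lia. Qed.

Definition movc (i n : nat) : nat :=
  mu (fun z => lenc z = n /\ forall j, j < n -> nthc z j = ite (j = 0) i (ite (j <= i) (Nat.pred j) j)).

Lemma movc_eq i n : i < n -> movc i n = code (moved i n).
Proof.
  intros H. apply mu_code. intros z. rewrite moved_length by auto.
  split; intros [H1 H2]; split; auto; intros j Hj; rewrite H2 by auto; [symmetry |]; apply nth_moved; auto.
Qed.

Lemma dfnF_movc n s t u : DfnF n s t -> DfnF n s u -> DfnF n s (fun X v => movc (t X v) (u X v)).
Proof.
  apply dfnF_fun2. apply (dfn_eq _ _ (fun _ v => v 0) (fun _ v => movc (v 1) (v 2))); [dfn |].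
  unfold movc. dfn.
Qed.

Definition selc (t z : nat) : nat :=
  mu (fun y => lenc y = lenc t /\ forall i, i < lenc t -> nthc y i = nthc z (nthc t i)).

Lemma selc_eq p l : selc (code p) (code l) = code (map (fun i => nth i l 0) p).
Proof.
  apply mu_code. intros z. rewrite length_map, lenc_code.
  assert (Hn : forall i, i < length p -> nthc (code l) (nthc (code p) i) = nth i (map (fun i => nth i l 0) p) 0).
  { intros i Hi. rewrite !nthc_code.
    rewrite (nth_indep (map _ p) 0 (nth 0 l 0)) by (rewrite length_map; auto).
    rewrite (map_nth (fun i => nth i l 0)). reflexivity. }
  split; intros [H1 H2]; split; auto; intros i Hi; rewrite H2 by auto; auto. symmetry. auto.
Qed.

Lemma dfnF_selc n s t u : DfnF n s t -> DfnF n s u -> DfnF n s (fun X v => selc (t X v) (u X v)).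
Proof.
  apply dfnF_fun2. apply (dfn_eq _ _ (fun _ v => v 0) (fun _ v => selc (v 1) (v 2))); [dfn |].
  unfold selc. dfn.
Qed.

Definition isperm (t n : nat) : Prop := lenc t = n /\ forall i, i < n -> exists j, j < n /\ nthc t j = i.

Lemma isperm_eq p n : isperm (code p) n <-> Permutation p (seq 0 n).
Proof.
  unfold isperm. rewrite lenc_code. split.
  - intros [H1 H2]. symmetry. apply NoDup_Permutation_bis.
    + apply seq_NoDup.
    + rewrite length_seq. lia.
    + intros i Hi. apply in_seq in Hi. destruct (H2 i) as (j & Hj & <-); [lia |].
      rewrite nthc_code. apply nth_In. lia.
  - intros H. pose proof (Permutation_length H) as HL. rewrite length_seq in HL. split; auto.
    intros i Hi. assert (Hin : In i p).
    { eapply Permutation_in; [symmetry; exact H |]. apply in_seq. lia. }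
    apply (In_nth _ _ 0) in Hin. destruct Hin as (j & Hj & E). exists j. rewrite nthc_code. split; auto. lia.
Qed.

(** With templates coded as numbers, [ev] becomes a definable function [evc]: a running program can
    compute the index of another template for the lengths at hand. *)
Fixpoint codeT (t : tm) : nat :=
  match t with
  | Tn n => pr 0 n
  | Tc t u => pr 1 (pr (codeT t) (codeT u))
  | Tk => pr 2 0
  | Tl i c => pr 3 (pr i c)
  | Tm i c d => pr 4 (pr i (pr c d))
  end.

Definition evop (q : nat) (x : C) (w : nat) : Prop :=
  exists s z, w = pr s z /\
   (s = pr 0 z \/
    (exists t u y y', s = pr 1 (pr t u) /\ x (pr t y) = true /\ x (pr u y') = true /\ z = cons' y y') \/
    (s = pr 2 0 /\ z = seqc 0 (p1 q)) \/
    (exists i c, s = pr 3 (pr i c) /\ z = seqc i (p1 (p2 q) + c - i)) \/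
    (exists i c d, s = pr 4 (pr i (pr c d)) /\ z = seqc i (p2 (p2 q) + c - d - i))).

Definition ctx (K L M : nat) : nat := pr K (pr L M).
Definition evc (q s : nat) : nat := mu (fun z => lfp (evop q) (pr s z)).

Lemma evc_eq t K L M : evc (ctx K L M) (codeT t) = ev t K L M.
Proof.
  unfold ctx. set (q := pr K (pr L M)).
  assert (Ek : p1 q = K) by apply p1_pr.
  assert (El : p1 (p2 q) = L) by (unfold q; rewrite p2_pr; apply p1_pr).
  assert (Em : p2 (p2 q) = M) by (unfold q; rewrite p2_pr; apply p2_pr).
  apply mu_unique.
  - intros Y HY. induction t as [n | t IHt u IHu | | i c | i c d]; apply HY; eexists _, _;
      (split; [reflexivity |]); cbn [codeT ev].
    + left. reflexivity.
    + right; left. exists (codeT t), (codeT u), (ev t K L M), (ev u K L M). auto.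
    + right; right; left. rewrite seqc_eq, Ek. auto.
    + do 3 right; left. exists i, c. rewrite seqc_eq, El. auto.
    + do 4 right. exists i, c, d. rewrite seqc_eq, Em. auto.
  - intros z Hz.
    set (Y := (fun w => tb (forall t z, w = pr (codeT t) z -> z = ev t K L M)) : C).
    assert (H : Y (pr (codeT t) z) = true).
    { apply Hz. intros w Hw. apply tb_true. clear t z Hz. intros t z ->.
      destruct Hw as (s' & z' & E & Hw). apply pr_inj in E. destruct E as [<- <-].
      destruct t as [n | t u | | i c | i c d]; cbn [codeT ev] in *;
      destruct Hw as [E | [(t1 & u1 & y & y' & E & Ht & Hu & Ez) | [(E & Ez) | [(i1 & c1 & E & Ez) | (i1 & c1 & d1 & E & Ez)]]]];
      apply pr_inj in E; destruct E as [E0 E]; try discriminate E0; auto.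
      - apply pr_inj in E. destruct E as [<- <-]. unfold Y in Ht, Hu. rewrite tb_true in Ht, Hu.
        rewrite Ez, (Ht t y), (Hu u y'); auto.
      - rewrite Ez, seqc_eq, Ek. reflexivity.
      - apply pr_inj in E. destruct E as [<- <-]. rewrite Ez, seqc_eq, El. reflexivity.
      - apply pr_inj in E. destruct E as [<- E]. apply pr_inj in E. destruct E as [<- <-].
        rewrite Ez, seqc_eq, Em. reflexivity. }
    unfold Y in H. rewrite tb_true in H. auto.
Qed.

Lemma dfnF_evc n s t u : DfnF n s t -> DfnF n s u -> DfnF n s (fun X v => evc (t X v) (u X v)).
Proof.
  apply dfnF_fun2. apply (dfn_eq _ _ (fun _ v => v 0) (fun _ v => evc (v 1) (v 2))); [dfn |].
  unfold evc. apply (dfnF_mu 3 0 (fun X v z => lfp (evop (v 1)) (pr (v 2) z))).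
  apply (dfn_lfp 4 0 (fun X v => evop (v 2)) (fun X v => pr (v 3) (v 0))).
  - intros X v x y m Hxy (s' & z & Ew & Hw). exists s', z. split; auto.
    destruct Hw as [H | [(t1 & u1 & y1 & y' & E & Ht & Hu & Ez) | H]]; auto.
    right; left. exists t1, u1, y1, y'. auto.
  - dfn.
  - unfold evop. dfn; apply dfnF_seqc; dfn.
Qed.

Ltac dfn_ext4 :=
  match goal with
  | |- DfnF _ _ (fun X v => seqc (@?t X v) (@?u X v)) => apply (dfnF_seqc _ _ t u)
  | |- DfnF _ _ (fun X v => movc (@?t X v) (@?u X v)) => apply (dfnF_movc _ _ t u)
  | |- DfnF _ _ (fun X v => selc (@?t X v) (@?u X v)) => apply (dfnF_selc _ _ t u)
  | |- DfnF _ _ (fun X v => evc (@?t X v) (@?u X v)) => apply (dfnF_evc _ _ t u)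
  end.
Ltac dfn_ext ::= first [dfn_ext2 | dfn_ext3 | dfn_ext4].

Lemma dfn_isperm n s t u : DfnF n s t -> DfnF n s u -> Dfn n s (fun X v => isperm (t X v) (u X v)).
Proof. apply dfn_rel2. unfold isperm. dfn. Qed.

(** * The programs *)

(** The combinators once more, now as definable functions on indices, because the programs below
    construct at run time what they run next. *)
Definition iLet (q p : nat) : nat := cons' 4 (cons' q (cons' p 0)).
Definition iQuote (v : nat) : nat := cons' 2 (cons' v 0).
Definition iExec (p : nat) : nat := iLet (code [9]) p.
Definition iSuc (p : nat) : nat := iLet (code [1]) p.
Definition iNimp (p q : nat) : nat :=
  iLet (iExec (iSuc (iSuc (iSuc (iSuc (iSuc (iSuc (iSuc p)))))))) q.

Definition i6 (e1 t1 t2 t3 : nat) : nat :=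
  cons' 6 (cons' e1 (cons' t1 (cons' t2 (cons' t3 0)))).
Definition iVar (K L M i : nat) : nat := i6 (code [3]) (seqc 0 K) (seqc 0 L) (movc i M).
(** The function is addressed from the end of the sequence; this address survives when an induction
    puts further functions in front. *)
Definition iApp (K L M q u : nat) : nat :=
  iLet (i6 (code [7]) (seqc 0 K) (movc (L - S q) L) (seqc 0 (S M))) (iQuote u).

(* [s] codes the templates of three interpreters, each of which computes from the
   top of the sequence of numbers the index that is to be run next; this ties the
   knot of the recursion. *)
Definition iU (s K L M : nat) : nat := iExec (evc (ctx K L M) (p1 s)).
Definition iG (s K L M : nat) : nat := iExec (evc (ctx K L M) (p1 (p2 s))).
Definition iN (s K L M : nat) : nat := iExec (evc (ctx K L M) (p2 (p2 s))).

(* The instruction on top of the numbers; [M] counts it as well. Tag [0] is a race,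
   tag [1] collects the given numbers into a code, tags [2], [3], [4] are the
   states of the selection. *)
Definition mk (tag s K L M x : nat) : nat := pr tag (pr s (pr (ctx K L M) x)).
Definition call (tag s K L M x : nat) : nat :=
  iLet (iU s K L (S M)) (iQuote (mk tag s K L (S M) x)).
(** The inner index [code [4; code [7]; code [2; 0]]] reads the number of the bit from the function
    supplied by S8.3; the operator then runs with this number on top and the current instruction
    right below it. *)
Definition niBit (s K L M b : nat) : nat :=
  iLet (cons' 8 (cons' 3 (cons' (iLet (iG s K (S L) (S M)) (code [4; code [7]; code [2; 0]])) 0)))
    (iQuote b).

(* A configuration: an index, the positions of its functionals, references to its
   functions (see [refval]), and its numbers. *)
Definition conf (e ph ps al : nat) : nat := pr e (pr ph (pr ps al)).
Definition c_e (c : nat) : nat := p1 c.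
Definition c_ph (c : nat) : nat := p1 (p2 c).
Definition c_ps (c : nat) : nat := p1 (p2 (p2 c)).
Definition c_al (c : nat) : nat := p2 (p2 (p2 c)).

Definition isS2 (e : nat) : Prop := e = iQuote (nthc e 1).
Definition isS4 (e : nat) : Prop := e = iLet (nthc e 1) (nthc e 2).
Definition isS6 (e : nat) : Prop := e = i6 (nthc e 1) (nthc e 2) (nthc e 3) (nthc e 4).
Definition isS8 (k e : nat) : Prop := e = cons' 8 (cons' k (cons' (nthc e 2) 0)).

Definition okS6 (c : nat) : Prop := isS6 (c_e c) /\
  isperm (nthc (c_e c) 2) (lenc (c_ph c)) /\ isperm (nthc (c_e c) 3) (lenc (c_ps c)) /\
  isperm (nthc (c_e c) 4) (lenc (c_al c)).

(* The computation with the same value that a computation by S6 or S9 passes to. *)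
Definition tailc (c : nat) : nat :=
  ite (okS6 c)
    (conf (nthc (c_e c) 1) (selc (nthc (c_e c) 2) (c_ph c)) (selc (nthc (c_e c) 3) (c_ps c))
       (selc (nthc (c_e c) 4) (c_al c)))
    (ite (c_e c = code [9] /\ c_al c <> 0)
       (conf (hdc (c_al c)) (c_ph c) (c_ps c) (tlc (c_al c))) c).

Definition swap (r : nat) : nat := pr (1 - p1 r) (p2 r).

(** References to all functions of the surrounding sequence, in order: entry [i] has distance
    [L - S i] from the end. *)
Definition refsc (L : nat) : nat := mu (fun z => lenc z = L /\ forall i, i < L -> nthc z i = pr 0 (L - S i)).

Section Act.
Variables cEq cSv : nat.

Definition iTest (K L M p v : nat) : nat :=
  iLet (iLet (evc (ctx K L (S (S M))) cEq) p) (iQuote v).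
(** The argument of the functional is the table of values recorded so far, which [cSv] looks up in
    the topmost function. *)
Definition iFa (K L M i : nat) : nat :=
  i6 (cons' 8 (cons' 2 (cons' (evc (ctx K L (S M)) cSv) 0))) (movc i K) (seqc 0 L) (seqc 0 M).

Definition refTest (K L M r u v : nat) : nat :=
  ite (p1 r = 0) (iTest K L M (iApp K L (S M) (p2 r) u) v)
    (ite (u = 0) (iQuote (ite (p1 (p2 r) = v) 1 0))
       (iTest K L M (iApp K L (S M) (p2 (p2 r)) (S (pr 1 (u - 1)))) v)).

(* The race of [c] against [d] answers questions [r]: [r = pr 0 v] asks whether [c]
   has finished first, with value [v]; [r = pr 1 w] whether [d] has, with value [w];
   [r = pr 2 b] asks for the bit [b] of the induction by which the subcomputations
   of [c] are raced against [d]. *)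
Definition actR (s K L M c d r : nat) : nat :=
  ite (p1 r = 2) (niBit s K L M (p2 r))
  (ite (c_e c = code [1] /\ c_al c <> 0) (iQuote (ite (r = pr 0 (S (hdc (c_al c)))) 1 0))
  (ite (isS2 (c_e c)) (iQuote (ite (r = pr 0 (nthc (c_e c) 1)) 1 0))
  (ite (c_e c = code [3] /\ c_al c <> 0) (iQuote (ite (r = pr 0 (hdc (c_al c))) 1 0))
  (ite (c_e c = code [7] /\ c_ps c <> 0 /\ c_al c <> 0)
     (ite (p1 r = 0) (refTest K L M (hdc (c_ps c)) (hdc (c_al c)) (p2 r)) (iQuote 0))
  (ite (isS4 (c_e c) \/ (isS8 2 (c_e c) /\ c_ph c <> 0))
     (niBit s K L M (pr (ite (p1 r = 0) 4 3) (p2 r)))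
  (ite (isS8 3 (c_e c) /\ c_al c <> 0)
     (ite (p1 r = 1) (niBit s K L M (pr 3 (p2 r)))
     (ite (p2 r = 1)
        (iNimp (call 0 s K L (S M) (pr c (pr d (pr 2 (pr 5 0)))))
               (niBit s K L M (pr 1 (hdc (c_al c)))))
     (ite (p2 r = 0)
        (iNimp (call 0 s K L (S M) (pr c (pr d (pr 2 (pr 5 0)))))
           (iNimp (call 0 s K L (S M) (pr c (pr d (pr 2 (pr 1 (hdc (c_al c))))))) (iQuote 1)))
        (iQuote 0))))
  (call 0 s K L M (pr d (pr (tailc c) (swap r)))))))))).

(* [cE k] runs [e] on [k] and returns [0]; [cH k] is the selection started at [k]. *)
Definition cE (K L e al k : nat) : nat :=
  conf (iLet (iQuote 0) e) (seqc 0 K) (refsc L) (cons' k al).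
Definition cH (s K L e al k : nat) : nat :=
  conf (iU s K L 1) (seqc 0 K) (refsc L) (cons' (mk 2 s K L 1 (pr e (pr al k))) 0).

(** Two phases: a number is computed, either an entry of the given sequence or the answer of a race,
    and [act2'] then chooses the next index from it, with the instruction still below. For tag 1 the
    entry is located from the bottom of the stack, since the top grows with every instruction. *)
Definition actH (tag s K L M x : nat) : nat :=
  iLet (iN s K L (S M))
  (ite (tag = 1) (iVar K L M (M - p1 x + p1 (p2 x)))
  (ite (tag = 2) (call 0 s K L M (pr (cE K L (p1 x) (p1 (p2 x)) (p2 (p2 x)))
     (pr (cH s K L (p1 x) (p1 (p2 x)) (S (p2 (p2 x)))) (pr 0 0))))
  (ite (tag = 3) (call 0 s K L M (pr (cE K L (p1 x) (p1 (p2 x)) (p1 (p2 (p2 x))))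
     (pr (cH s K L (p1 x) (p1 (p2 x)) (S (p1 (p2 (p2 x))))) (pr 1 (p2 (p2 (p2 x)))))))
  (call 0 s K L M (pr (cE K L (p1 x) (p1 (p2 x)) (p1 (p2 (p2 x))))
     (pr (cE K L (p1 x) (p1 (p2 x)) (p2 (p2 (p2 x)))) (pr 0 0))))))).

Definition act2' (r tag s K L M x : nat) : nat :=
  ite (tag = 1)
    (ite (p1 (p2 x) = 0) (call 2 s K L (S M) (pr r (pr (p2 (p2 x)) 0)))
       (call 1 s K L (S M) (pr (p1 x) (pr (p1 (p2 x) - 1) (cons' r (p2 (p2 x)))))))
  (ite (tag = 2)
    (ite (r = 1) (iQuote (p2 (p2 x))) (call 3 s K L (S M) (pr (p1 x) (pr (p1 (p2 x)) (pr (p2 (p2 x)) 0)))))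
  (ite (tag = 3)
    (ite (r = 1) (call 4 s K L (S M) x)
       (call 3 s K L (S M) (pr (p1 x) (pr (p1 (p2 x)) (pr (p1 (p2 (p2 x))) (S (p2 (p2 (p2 x)))))))))
    (ite (r = 1) (iQuote (p1 (p2 (p2 x)))) (iQuote (p2 (p2 (p2 x))))))).

Definition flagged (X : C) : Prop := exists k w, X (pr 2 (pr k w)) = true.

(** For S4 the intermediate value is read off the recorded bits, where [qok] guarantees one. For
    S8.3 the new function is a reference into the stage itself, which will be the function at
    position [L] from the end. *)
Definition query (X : C) (L c k : nat) : nat :=
  ite (isS4 (c_e c))
    (ite (k = 0) (conf (nthc (c_e c) 2) (c_ph c) (c_ps c) (c_al c))
       (conf (nthc (c_e c) 1) (c_ph c) (c_ps c)
          (cons' (mu (fun b => X (pr 0 (pr 0 b)) = true)) (c_al c))))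
  (ite (isS8 2 (c_e c)) (conf (nthc (c_e c) 2) (c_ph c) (c_ps c) (cons' k (c_al c)))
    (conf (nthc (c_e c) 2) (c_ph c) (cons' (pr 1 (pr k L)) (c_ps c)) (tlc (c_al c)))).

Definition qok (X : C) (c k : nat) : Prop :=
  isS4 (c_e c) -> k = 0 \/ (k = 1 /\ exists b, X (pr 0 (pr 0 b)) = true).

(* Bits of the induction: [pr 0 (pr k v)]: the [k]-th subcomputation has value [v];
   [pr 1 k]: bit [k] of the simulated induction, for S8.3; [pr 2 (pr k w)]: [d] has
   won against the [k]-th subcomputation, with value [w]; [pr 4 v]: the value is [v].
   Once [d] has won, only the summary bits [pr 5 0] and [pr 3 w] are added. *)
Definition actG' (X : C) (n s K L M c d : nat) : nat :=
  ite (flagged X)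
    (iQuote (ite (n = pr 5 0 \/ (n = pr 3 (p2 n) /\ exists k, X (pr 2 (pr k (p2 n))) = true)) 1 0))
  (ite (p1 n = 2 /\ qok X c (p1 (p2 n)))
    (call 0 s K (S L) (S M) (pr d (pr (query X L c (p1 (p2 n))) (pr 0 (p2 (p2 n))))))
  (ite (p1 n = 0 /\ qok X c (p1 (p2 n)) /\ ~ isS8 3 (c_e c))
    (call 0 s K (S L) (S M) (pr d (pr (query X L c (p1 (p2 n))) (pr 1 (p2 (p2 n))))))
  (ite (p1 n = 1 /\ isS8 3 (c_e c))
    (iNimp (call 0 s K (S L) (S (S M)) (pr d (pr (query X L c (p2 n)) (pr 1 0)))) (iQuote 1))
  (ite (p1 n = 4 /\ isS4 (c_e c))
    (iQuote (ite (X (pr 0 (pr 1 (p2 n))) = true) 1 0))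
  (ite (p1 n = 4 /\ isS8 2 (c_e c) /\ forall k, exists v, X (pr 0 (pr k v)) = true)
    (iTest K (S L) (S M) (iFa K (S L) (S (S M)) (hdc (c_ph c))) (p2 n))
    (iQuote 0)))))).

Definition gs (p : nat) : nat := p1 (p2 p).
Definition gK (p : nat) : nat := p1 (p1 (p2 (p2 p))).
Definition gL (p : nat) : nat := p1 (p2 (p1 (p2 (p2 p)))).
Definition gM (p : nat) : nat := p2 (p2 (p1 (p2 (p2 p)))).
Definition gx (p : nat) : nat := p2 (p2 (p2 p)).

Definition actU (p : nat) : nat :=
  ite (p1 p = 0)
    (actR (gs p) (gK p) (gL p) (gM p) (p1 (gx p)) (p1 (p2 (gx p))) (p2 (p2 (gx p))))
    (actH (p1 p) (gs p) (gK p) (gL p) (gM p) (gx p)).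
Definition act2 (r p : nat) : nat := act2' r (p1 p) (gs p) (gK p) (gL p) (gM p) (gx p).
Definition actG (X : C) (n p : nat) : nat :=
  actG' X n (gs p) (gK p) (gL p) (gM p) (p1 (gx p)) (p1 (p2 (gx p))).
End Act.

Lemma dfnF_refsc n s t : DfnF n s t -> DfnF n s (fun X v => refsc (t X v)).
Proof.
  apply dfnF_fun1. apply (dfn_eq _ _ (fun _ v => v 0) (fun _ v => refsc (v 1))); [dfn |].
  unfold refsc. dfn.
Qed.

Ltac dfn_ext5 :=
  match goal with
  | |- DfnF _ _ (fun X v => refsc (@?t X v)) => apply (dfnF_refsc _ _ t)
  | |- Dfn _ _ (fun X v => isperm (@?t X v) (@?u X v)) => apply (dfn_isperm _ _ t u)
  end.
Ltac dfn_ext ::= first [dfn_ext2 | dfn_ext3 | dfn_ext4 | dfn_ext5].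

Ltac unfold_act := unfold actU, act2, actG, gs, gK, gL, gM, gx, actR, actH, act2', actG', query, qok, flagged,
  cE, cH, refTest, iFa, iTest, swap, tailc, okS6, isS2, isS4, isS6, isS8, c_e, c_ph, c_ps, c_al, conf,
  niBit, call, mk, iN, iG, iU, iApp, iVar, i6, iNimp, iSuc, iExec, iQuote, iLet, ctx.

Lemma dfn_act2 : DfnF 2 0 (fun X v => act2 (v 0) (v 1)).
Proof. unfold_act. dfn. Qed.

Lemma dfn_actU cEq : DfnF 1 0 (fun X v => actU cEq (v 0)).
Proof. unfold_act. dfn. Qed.

Lemma dfn_actG cEq cSv : DfnF 2 1 (fun X v => actG cEq cSv (X 0) (v 0) (v 1)).
Proof. unfold_act. dfn. Qed.

Record programs (cEq cSv s : nat) : Prop := {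
  prog_eq : forall F f x y a,
    kleene (evc (ctx (length F) (length f) (S (S (length a)))) cEq) F f (x :: y :: a)
      (Nat.b2n (tb (x = y)));
  prog_sv : forall F f n X m a,
    kleene (evc (ctx (length F) (S (length f)) (S (length a))) cSv) F (ncons n X :: f) (m :: a)
      (mu (fun y => X (pr 0 (pr m y)) = true));
  prog_U : forall F f p a,
    kleene (evc (ctx (length F) (length f) (S (length a))) (p1 s)) F f (p :: a) (actU cEq p);
  prog_G : forall F f k X n p a,
    kleene (evc (ctx (length F) (S (length f)) (S (S (length a)))) (p1 (p2 s)))
      F (ncons k X :: f) (n :: p :: a) (actG cEq cSv X n p);
  prog_2 : forall F f r p a,
    kleene (evc (ctx (length F) (length f) (S (S (length a)))) (p2 (p2 s))) F f (r :: p :: a) (act2 r p)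
}.

Lemma nth_ncons_hyp (X : C) n (f : list (nat -> nat)) :
  forall j, j < 1 -> exists k, nth_error (ncons n X :: f) j = Some (ncons k ((fun _ => X) j)).
Proof. intros j Hj. replace j with 0 by lia. simpl. eauto. Qed.

(** No fixed point has to be solved: the programs read [s] from the instruction on the stack, so
    only the codes of the equality test and of the table lookup must be known before the
    interpreters are compiled. *)
Lemma programs_exist : exists cEq cSv s, programs cEq cSv s.
Proof.
  destruct (dfn_run 2 0 (fun X v => v 0 = v 1)) as (tEq & HEq); [dfn |].
  destruct (dfnF_run 1 1 (fun X v => mu (fun y => X 0 (pr 0 (pr (v 0) y)) = true))) as (tSv & HSv); [dfn |].
  exists (codeT tEq), (codeT tSv).
  destruct (dfnF_run _ _ _ (dfn_actU (codeT tEq))) as (tU & HU).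
  destruct (dfnF_run _ _ _ (dfn_actG (codeT tEq) (codeT tSv))) as (tG & HG).
  destruct (dfnF_run _ _ _ dfn_act2) as (t2 & H2).
  exists (pr (codeT tU) (pr (codeT tG) (codeT t2))).
  assert (H0 : forall f : list (nat -> nat), forall j, j < 0 ->
    exists k, nth_error f j = Some (ncons k (czero))) by (intros; lia).
  split; intros; rewrite ?p2_pr, ?p1_pr, ?p2_pr, ?evc_eq.
  - exact (HEq F f (x :: y :: a) (fun _ => czero) ltac:(simpl; lia) (H0 f)).
  - exact (HSv F (ncons n X :: f) (m :: a) (fun _ => X) ltac:(simpl; lia) (nth_ncons_hyp X n f)).
  - exact (HU F f (p :: a) (fun _ => czero) ltac:(simpl; lia) (H0 f)).
  - exact (HG F (ncons k X :: f) (n :: p :: a) (fun _ => X) ltac:(simpl; lia) (nth_ncons_hyp X k f)).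
  - exact (H2 F f (r :: p :: a) (fun _ => czero) ltac:(simpl; lia) (H0 f)).
Qed.

(** * Running composed indices *)

Lemma iLet_code q p : iLet q p = code [4; q; p].
Proof. rewrite !code_cons', code_nil. reflexivity. Qed.

Lemma iQuote_code v : iQuote v = code [2; v].
Proof. rewrite !code_cons', code_nil. reflexivity. Qed.

Lemma i6_code e t1 t2 t3 : i6 e t1 t2 t3 = code [6; e; t1; t2; t3].
Proof. rewrite !code_cons', code_nil. reflexivity. Qed.

Lemma k_let F p q f a b c :
  kleene p F f a b -> kleene q F f (b :: a) c -> kleene (iLet q p) F f a c.
Proof. rewrite iLet_code. intros H H'. exact (S4 q p F f a b c H H'). Qed.

Lemma k_quote F f a v : kleene (iQuote v) F f a v.
Proof. rewrite iQuote_code. apply S2. Qed.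

Lemma k_push F q v f a c : kleene q F f (v :: a) c -> kleene (iLet q (iQuote v)) F f a c.
Proof. apply k_let, k_quote. Qed.

Lemma k_exec F f a p z c : kleene p F f a z -> kleene z F f a c -> kleene (iExec p) F f a c.
Proof. intros H H'. eapply k_let; [exact H | apply S9; exact H']. Qed.

Lemma k_suc F f a p v : kleene p F f a v -> kleene (iSuc p) F f a (S v).
Proof. intros H. eapply k_let; [exact H |]. replace (S v) with (v + 1) by lia. apply S1. Qed.

Lemma k_nimp F f a p q (b : bool) y : kleene q F f a y ->
  kleene p F f (y :: a) (Nat.b2n b) -> kleene (iNimp p q) F f a (if b then 0 else y).
Proof.
  intros H H'. eapply k_let; [exact H |]. eapply k_exec; [do 7 apply k_suc; exact H' |].
  destruct b; simpl.
  - exact (S2 0 F f (y :: a)).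
  - exact (S3 F f y a).
Qed.

Lemma k_var F f l1 l2 x :
  kleene (iVar (length F) (length f) (length (l1 ++ x :: l2)) (length l1)) F f (l1 ++ x :: l2) x.
Proof.
  unfold iVar. rewrite i6_code, !seqc_eq, movc_eq by (rewrite length_app; simpl; lia).
  eapply S6; [apply permuted_id | apply permuted_id | apply permuted_move | apply S3].
Qed.

Definition fbot (f : list (nat -> nat)) (q : nat) : nat -> nat := nth (length f - S q) f (fun _ => 0).

Lemma split_nth {A : Type} (l : list A) i d : i < length l ->
  exists l1 l2, l = l1 ++ nth i l d :: l2 /\ length l1 = i.
Proof. intros H. apply nth_split. exact H. Qed.

Lemma k_app F f a q u : q < length f ->
  kleene (iApp (length F) (length f) (length a) q u) F f a (fbot f q u).
Proof.
  intros H. unfold iApp. apply k_push. rewrite i6_code, !seqc_eq, movc_eq by lia.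
  unfold fbot. destruct (split_nth f (length f - S q) (fun _ => 0)) as (l1 & l2 & E & El); [lia |].
  set (g := nth (length f - S q) f (fun _ => 0)) in *.
  rewrite <- El. clearbody g. rewrite E.
  eapply S6; [apply permuted_id | apply permuted_move | exact (permuted_id (u :: a)) | apply S7].
Qed.

Section Intro.
Variables (cEq cSv s : nat) (HP : programs cEq cSv s) (F : list ((nat -> nat) -> nat)).
Notation K := (length F).

Lemma k_test f a p v y : kleene p F f (v :: a) y ->
  kleene (iTest cEq K (length f) (length a) p v) F f a (Nat.b2n (tb (y = v))).
Proof.
  intros H. unfold iTest. apply k_push. eapply k_let; [exact H |]. apply (prog_eq _ _ _ HP).
Qed.

Lemma k_Fa f a i X n : i < K ->
  kleene (iFa cSv K (S (length f)) (length a) i) F (ncons n X :: f) a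
    (nth i F (fun _ => 0) (fun m => mu (fun y => X (pr 0 (pr m y)) = true))).
Proof.
  intros H. unfold iFa. rewrite i6_code, !seqc_eq, movc_eq by lia.
  destruct (split_nth F i (fun _ => 0)) as (l1 & l2 & E & El); [exact H |].
  set (G := nth i F (fun _ => 0)) in *. set (g := fun m => mu _).
  set (d := evc _ cSv).
  assert (Hd : forall m, kleene d (G :: l1 ++ l2) (ncons n X :: f) (m :: a) (g m)).
  { intros m. unfold d. replace K with (length (G :: l1 ++ l2)).
    - apply (prog_sv _ _ _ HP).
    - rewrite E. simpl. rewrite !length_app. simpl. lia. }
  clearbody d g G. rewrite <- El. rewrite E.
  eapply S6; [apply permuted_move | exact (permuted_id (ncons n X :: f)) | apply permuted_id |].
  assert (Ec : cons' 8 (cons' 2 (cons' d 0)) = code [8; 2; d]) by (rewrite !code_cons', code_nil; reflexivity).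
  rewrite Ec. apply S8_2. exact Hd.
Qed.

Lemma k_U f p a c : kleene (actU cEq p) F f (p :: a) c ->
  kleene (iU s K (length f) (S (length a))) F f (p :: a) c.
Proof. intros H. eapply k_exec; [apply (prog_U _ _ _ HP) | exact H]. Qed.

Lemma k_2 f r p a c : kleene (act2 r p) F f (r :: p :: a) c ->
  kleene (iN s K (length f) (S (S (length a)))) F f (r :: p :: a) c.
Proof. intros H. eapply k_exec; [apply (prog_2 _ _ _ HP) | exact H]. Qed.

Lemma k_call f a tag x c :
  kleene (iU s K (length f) (S (length a))) F f (mk tag s K (length f) (S (length a)) x :: a) c ->
  kleene (call tag s K (length f) (length a) x) F f a c.
Proof. intros H. apply k_push. exact H. Qed.

Lemma k_niBit f p a (g : C -> C) b :
  (forall x n, tower g x -> exists m,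
     kleene (actG cEq cSv x n p) F (ncons n x :: f) (n :: p :: a) m /\ Nat.b2n (g x n) = Nat.min m 1) ->
  kleene (niBit s K (length f) (S (length a)) b) F f (p :: a) (Nat.b2n (nival g b)).
Proof.
  intros H. unfold niBit. apply k_push.
  set (d := iLet _ _).
  assert (Ec : cons' 8 (cons' 3 (cons' d 0)) = code [8; 3; d]) by (rewrite !code_cons', code_nil; reflexivity).
  rewrite Ec. apply S8_3. apply NI_nival. intros x Hx n.
  destruct (H x n Hx) as (m & Hm & E). exists m. split; [| exact E].
  unfold d. eapply k_let.
  - rewrite <- iLet_code. fold (iQuote 0).
    replace n with (ncons n x 0) at 3 by reflexivity.
    replace (code [2; 0]) with (iQuote 0) by apply iQuote_code.
    apply k_push. apply S7.
  - eapply k_exec; [exact (prog_G _ _ _ HP F f n x n p a) | exact Hm].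
Qed.
End Intro.

(** * Races *)

Lemma c_e_conf e ph ps al : c_e (conf e ph ps al) = e.
Proof. apply p1_pr. Qed.
Lemma c_ph_conf e ph ps al : c_ph (conf e ph ps al) = ph.
Proof. unfold c_ph, conf. rewrite p2_pr. apply p1_pr. Qed.
Lemma c_ps_conf e ph ps al : c_ps (conf e ph ps al) = ps.
Proof. unfold c_ps, conf. rewrite !p2_pr. apply p1_pr. Qed.
Lemma c_al_conf e ph ps al : c_al (conf e ph ps al) = al.
Proof. unfold c_al, conf. rewrite !p2_pr. reflexivity. Qed.

Lemma code_nz l : code l <> 0 <-> l <> [].
Proof.
  split; intros H H'; apply H; [rewrite H'; apply code_nil | apply code_0; auto].
Qed.

Definition sel {A : Type} (x : A) (p : list nat) (l : list A) : list A := map (fun i => nth i l x) p.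

Lemma permuted_sel {A : Type} (x : A) p l : Permutation p (seq 0 (length l)) ->
  permuted (code p) l (sel x p l).
Proof.
  intros H. exists p. repeat split; auto. unfold sel. rewrite map_map. apply map_ext_in.
  intros i Hi. eapply Permutation_in in Hi; [| exact H]. apply in_seq in Hi.
  apply nth_error_nth'. lia.
Qed.

Lemma sel_map {A B : Type} (g : A -> B) x y p l :
  Permutation p (seq 0 (length l)) -> sel y p (map g l) = map g (sel x p l).
Proof.
  intros H. unfold sel. rewrite map_map. apply map_ext_in. intros i Hi.
  eapply Permutation_in in Hi; [| exact H]. apply in_seq in Hi.
  rewrite (nth_indep _ y (g x)) by (rewrite length_map; lia). apply map_nth.
Qed.

Lemma sel_Forall {A : Type} (P : A -> Prop) x p l :
  Permutation p (seq 0 (length l)) -> Forall P l -> Forall P (sel x p l).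
Proof.
  intros H HP. unfold sel. rewrite Forall_map, Forall_forall. intros i Hi.
  eapply Permutation_in in Hi; [| exact H]. apply in_seq in Hi.
  rewrite Forall_forall in HP. apply HP. apply nth_In. lia.
Qed.

(* [pr 0 q] refers to the function at position [q] from the end of [f]; a function
   queried by an induction of the simulated computation is [pr 1 (pr n q)], which
   refers to [ncons n x] where [x] is the part tagged [1] of the [q]-th function. *)
Definition refval (f : list (nat -> nat)) (r : nat) : nat -> nat :=
  if Nat.eq_dec (p1 r) 0 then fbot f (p2 r)
  else fun u => match u with 0 => p1 (p2 r) | S k => fbot f (p2 (p2 r)) (S (pr 1 k)) end.

Definition refok (L r : nat) : Prop := if Nat.eq_dec (p1 r) 0 then p2 r < L else p2 (p2 r) < L.

Lemma fbot_cons g f q : q < length f -> fbot (g :: f) q = fbot f q.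
Proof.
  intros H. unfold fbot. simpl. replace (length f - q) with (S (length f - S q)) by lia. reflexivity.
Qed.

Lemma fbot_top g f : fbot (g :: f) (length f) = g.
Proof. unfold fbot. simpl. rewrite Nat.sub_diag. reflexivity. Qed.

Lemma refok_S L r : refok L r -> refok (S L) r.
Proof. unfold refok. destruct (Nat.eq_dec _ _); lia. Qed.

Lemma refval_cons g f r : refok (length f) r -> refval (g :: f) r = refval f r.
Proof.
  unfold refok, refval. destruct (Nat.eq_dec _ _); intros H; rewrite fbot_cons by auto; reflexivity.
Qed.

Lemma refval_new k n (X : C) f :
  refval (ncons n X :: f) (pr 1 (pr k (length f))) = ncons k (fun j => X (pr 1 j)).
Proof.
  unfold refval. rewrite p1_pr, !p2_pr, p1_pr. simpl. rewrite fbot_top. reflexivity.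
Qed.

Record cfg := Cfg { ce : nat; cph : list nat; cfs : list (nat -> nat); cas : list nat }.

(* The computation that has finished first, with its value. *)
Inductive outcome := own (v : nat) | other (v : nat).

Definition codeo (o : outcome) : nat := match o with own v => pr 0 v | other v => pr 1 v end.

Section Race.
Variables (cEq cSv s : nat) (HP : programs cEq cSv s) (F : list ((nat -> nat) -> nat)).
Notation K := (length F).
Notation Fv := (fun i => nth i F (fun _ => 0)).

Definition cfg_val (c : cfg) (v : nat) : Prop := kleene (ce c) (map Fv (cph c)) (cfs c) (cas c) v.

Definition rep (f : list (nat -> nat)) (c : cfg) (x : nat) : Prop :=
  exists ps, x = conf (ce c) (code (cph c)) (code ps) (code (cas c)) /\
    Forall (fun i => i < K) (cph c) /\ Forall (refok (length f)) ps /\ map (refval f) ps = cfs c.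

Definition sound (c d : cfg) (o : outcome) : Prop :=
  match o with own v => cfg_val c v | other v => cfg_val d v end.

(** [f] and [a] are arbitrary because races are run again inside inductions, with more functions and
    numbers around. The functions of [c] and [d] enter through references into [f], and the answers
    must not depend on the representations chosen. *)
Definition race (c d : cfg) (o : outcome) : Prop :=
  forall f a x y r, p1 r < 2 -> rep f c x -> rep f d y ->
    kleene (iU s K (length f) (S (length a))) F f
      (mk 0 s K (length f) (S (length a)) (pr x (pr y r)) :: a) (Nat.b2n (tb (r = codeo o))).

Definition good (c d : cfg) (o : outcome) : Prop := sound c d o /\ race c d o.
Definition claim (c d : cfg) : Prop := exists o, good c d o.

Lemma race_call c d o f a x y r : race c d o -> p1 r < 2 -> rep f c x -> rep f d y ->
  kleene (call 0 s K (length f) (length a) (pr x (pr y r))) F f a (Nat.b2n (tb (r = codeo o))).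
Proof. intros H Hr Hx Hy. apply k_call. apply H; auto. Qed.

Lemma gs_mk t q L M x : gs (mk t q K L M x) = q.
Proof. unfold gs, mk. rewrite p2_pr. apply p1_pr. Qed.
Lemma gK_mk t q L M x : gK (mk t q K L M x) = K.
Proof. unfold gK, mk, ctx. rewrite !p2_pr, !p1_pr. reflexivity. Qed.
Lemma gL_mk t q L M x : gL (mk t q K L M x) = L.
Proof. unfold gL, mk, ctx. rewrite !p2_pr, !p1_pr, p2_pr. apply p1_pr. Qed.
Lemma gM_mk t q L M x : gM (mk t q K L M x) = M.
Proof. unfold gM, mk, ctx. rewrite !p2_pr, !p1_pr, !p2_pr. reflexivity. Qed.
Lemma gx_mk t q L M x : gx (mk t q K L M x) = x.
Proof. unfold gx, mk. rewrite !p2_pr. reflexivity. Qed.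

Lemma k_actR f a x y r c :
  kleene (actR cEq s K (length f) (S (length a)) x y r) F f
    (mk 0 s K (length f) (S (length a)) (pr x (pr y r)) :: a) c ->
  kleene (iU s K (length f) (S (length a))) F f
    (mk 0 s K (length f) (S (length a)) (pr x (pr y r)) :: a) c.
Proof.
  intros H. apply (k_U cEq cSv s HP). unfold actU.
  rewrite gs_mk, gK_mk, gL_mk, gM_mk, gx_mk, ?p1_pr, ?p2_pr, ?p1_pr, ?p2_pr.
  unfold mk at 1. rewrite p1_pr, ite_true by reflexivity. exact H.
Qed.

Lemma actG_mk X n L M x y r :
  actG cEq cSv X n (mk 0 s K L M (pr x (pr y r))) = actG' cEq cSv X n s K L M x y.
Proof.
  unfold actG. rewrite gs_mk, gK_mk, gL_mk, gM_mk, gx_mk, ?p1_pr, ?p2_pr, ?p1_pr. reflexivity.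
Qed.

Lemma hdc_tag k l : hdc (code (k :: l)) = k.
Proof. rewrite code_cons'. apply hdc_cons. Qed.

Lemma hdc_S2 e : isS2 e -> hdc e = 2.
Proof. unfold isS2, iQuote. intros ->. apply hdc_cons. Qed.
Lemma hdc_S4 e : isS4 e -> hdc e = 4.
Proof. unfold isS4, iLet. intros ->. apply hdc_cons. Qed.
Lemma hdc_S6 e : isS6 e -> hdc e = 6.
Proof. unfold isS6, i6. intros ->. apply hdc_cons. Qed.
Lemma hdc_S8 k e : isS8 k e -> hdc e = 8.
Proof. unfold isS8. intros ->. apply hdc_cons. Qed.
Lemma nthc_S8 k e : isS8 k e -> nthc e 1 = k.
Proof.
  unfold isS8. intros ->. replace (cons' 8 (cons' k (cons' (nthc e 2) 0))) with (code [8; k; nthc e 2]).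
  - rewrite nthc_code. reflexivity.
  - rewrite !code_cons', code_nil. reflexivity.
Qed.

Definition okc6 (c : cfg) : Prop := isS6 (ce c) /\
  isperm (nthc (ce c) 2) (length (cph c)) /\ isperm (nthc (ce c) 3) (length (cfs c)) /\
  isperm (nthc (ce c) 4) (length (cas c)).

Definition tail_kind (c : cfg) : Prop :=
  ~ (ce c = code [1] /\ cas c <> []) /\ ~ isS2 (ce c) /\ ~ (ce c = code [3] /\ cas c <> []) /\
  ~ (ce c = code [7] /\ cfs c <> [] /\ cas c <> []) /\ ~ isS4 (ce c) /\
  ~ (isS8 2 (ce c) /\ cph c <> []) /\ ~ (isS8 3 (ce c) /\ cas c <> []).

Definition tails (c d : cfg) : Prop :=
  tail_kind c /\ (forall v, cfg_val d v -> cfg_val c v) /\ (forall f x, rep f c x -> rep f d (tailc x)).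
End Race.

Ltac tags :=
  repeat match goal with
  | H : ?e = code (?k :: ?l) |- _ => apply (f_equal hdc) in H
  | H : isS2 _ |- _ => apply hdc_S2 in H
  | H : isS4 _ |- _ => apply hdc_S4 in H
  | H : isS6 _ |- _ => apply hdc_S6 in H
  | H : isS8 _ _ |- _ => pose proof (nthc_S8 _ _ H); apply hdc_S8 in H
  end;
  repeat match goal with H : context [hdc (code (?k :: ?l))] |- _ => rewrite (hdc_tag k l) in H end.

Ltac notag := unfold tail_kind, not; cbn [ce cph cfs cas]; intros;
  repeat match goal with H : _ /\ _ |- _ => destruct H | H : _ \/ _ |- _ => destruct H
    | |- _ /\ _ => split; intros end;
  tags; try congruence; try lia.

Section Race2.
Variables (cEq cSv s : nat) (HP : programs cEq cSv s) (F : list ((nat -> nat) -> nat)).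
Notation K := (length F).
Notation Fv := (fun i => nth i F (fun _ => 0)).
Notation val := (cfg_val F). Notation rep := (rep F). Notation race := (race s F).
Notation claim := (claim s F). Notation good := (good s F). Notation tails := (tails F).

Lemma b2n_ite (P : Prop) : ite P 1 0 = Nat.b2n (tb P).
Proof. unfold ite. destruct (tb P); reflexivity. Qed.

Ltac confs := rewrite ?c_e_conf, ?c_ph_conf, ?c_ps_conf, ?c_al_conf.

Lemma claim_leaf c d v : val c v ->
  (forall f a x y r, p1 r < 2 -> rep f c x -> rep f d y ->
    kleene (actR cEq s K (length f) (S (length a)) x y r) F f
      (mk 0 s K (length f) (S (length a)) (pr x (pr y r)) :: a) (Nat.b2n (tb (r = pr 0 v)))) ->
  claim c d.
Proof.
  intros Hv H. exists (own v). split; [exact Hv |]. intros f a x y r Hr Hx Hy.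
  apply (k_actR cEq cSv s HP). apply H; auto.
Qed.

Lemma claim_S1 ph fs n a d : claim (Cfg (code [1]) ph fs (n :: a)) d.
Proof.
  apply claim_leaf with (S n).
  - unfold cfg_val. simpl. replace (S n) with (n + 1) by lia. apply S1.
  - intros f a' x y r Hr (ps & -> & _) _. unfold actR. confs. cbn [ce cph cfs cas].
    rewrite ite_false by lia.
    rewrite ite_true by (split; [reflexivity | apply code_nz; discriminate]).
    rewrite hdc_tag, b2n_ite. apply k_quote.
Qed.

Lemma claim_S2 q ph fs a d : claim (Cfg (code [2; q]) ph fs a) d.
Proof.
  assert (HS : isS2 (code [2; q])) by (unfold isS2; rewrite nthc_code; symmetry; apply iQuote_code).
  apply claim_leaf with q.
  - apply S2.
  - intros f a' x y r Hr (ps & -> & _) _. unfold actR. confs. cbn [ce cph cfs cas].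
    rewrite ite_false by lia.
    rewrite ite_false by notag. rewrite ite_true by exact HS.
    rewrite nthc_code, b2n_ite. apply k_quote.
Qed.

Lemma claim_S3 ph fs n a d : claim (Cfg (code [3]) ph fs (n :: a)) d.
Proof.
  apply claim_leaf with n.
  - apply S3.
  - intros f a' x y r Hr (ps & -> & _) _. unfold actR. confs. cbn [ce cph cfs cas].
    rewrite ite_false by lia. rewrite !ite_false by notag.
    rewrite ite_true by (split; [reflexivity | apply code_nz; discriminate]).
    rewrite hdc_tag, b2n_ite. apply k_quote.
Qed.

Lemma k_refTest f a r u v : refok (length f) r ->
  kleene (refTest cEq K (length f) (length a) r u v) F f a (Nat.b2n (tb (refval f r u = v))).
Proof.
  intros Hr. unfold refTest, refok, refval in *. destruct (Nat.eq_dec (p1 r) 0) as [E | E].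
  - rewrite ite_true by auto. apply (k_test cEq cSv s HP). apply (k_app F f (v :: a)). exact Hr.
  - rewrite ite_false by auto. destruct u as [| u].
    + rewrite ite_true, b2n_ite by auto. apply k_quote.
    + rewrite ite_false by lia. simpl. rewrite Nat.sub_0_r.
      apply (k_test cEq cSv s HP). apply (k_app F f (v :: a)). exact Hr.
Qed.

Lemma claim_S7 ph g fs n a d : claim (Cfg (code [7]) ph (g :: fs) (n :: a)) d.
Proof.
  apply claim_leaf with (g n).
  - apply S7.
  - intros f a' x y r Hr (ps & -> & _ & Hps & E) _. cbn [ce cph cfs cas] in *.
    destruct ps as [| p ps]; [discriminate E |]. injection E as <- E. inversion Hps; subst.
    unfold actR. confs.
    rewrite ite_false by lia. rewrite !ite_false by notag.
    rewrite ite_true by (split; [reflexivity | split; apply code_nz; discriminate]).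
    rewrite !hdc_tag. destruct (Nat.eq_dec (p1 r) 0) as [E0 | E0].
    + rewrite ite_true by auto.
      replace (tb (r = _)) with (tb (refval f p n = p2 r)).
      * apply (k_refTest f (mk 0 s K (length f) (S (length a')) _ :: a')). auto.
      * apply tb_iff. rewrite <- (pr_eta r) at 2. rewrite E0. split; [congruence |].
        intros H. apply pr_inj in H. symmetry. apply H.
    + rewrite ite_false by auto. rewrite (proj2 (tb_false _)); [apply k_quote |].
      intros ->. apply E0. apply p1_pr.
Qed.

Definition flip (o : outcome) : outcome := match o with own v => other v | other v => own v end.

Lemma swap_lt r : p1 (swap r) < 2.
Proof. unfold swap. rewrite p1_pr. lia. Qed.

Lemma swap_codeo r o : p1 r < 2 -> swap r = codeo o <-> r = codeo (flip o).
Proof.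
  intros Hr. unfold swap. split; intros H.
  - rewrite <- (pr_eta r). destruct o; apply pr_inj in H; destruct H as [H H'];
      (apply (f_equal2 pr); [lia | exact H']).
  - subst r. destruct o; simpl; rewrite p1_pr, p2_pr; reflexivity.
Qed.

Lemma claim_tail c d c' : tails c c' -> claim d c' -> claim c d.
Proof.
  intros (Hk & Hv & Hrep) (o & Ho & Hr). exists (flip o). split.
  - destruct o; simpl; auto.
  - intros f a x y r H01 Hx Hy. apply (k_actR cEq cSv s HP).
    destruct (Hk) as (N1 & N2 & N3 & N4 & N5 & N6 & N7).
    assert (Hx' := Hrep f x Hx). destruct Hx as (ps & -> & _ & Hps & E).
    assert (Eps : code ps <> 0 -> cfs c <> []).
    { rewrite code_nz. intros H H'. apply H. rewrite H' in E. destruct ps; auto; discriminate. }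
    unfold actR. confs. rewrite ite_false by lia.
    rewrite ite_false by (rewrite code_nz; auto).
    rewrite ite_false by auto. rewrite ite_false by (rewrite code_nz; auto).
    rewrite ite_false by (intros (H1 & H2 & H3); apply N4; rewrite <- code_nz; auto).
    rewrite ite_false by (rewrite code_nz; tauto).
    rewrite ite_false by (rewrite code_nz; auto).
    replace (tb (r = codeo (flip o))) with (tb (swap r = codeo o)).
    + apply (race_call s F d c' o f (mk 0 s K (length f) (S (length a)) _ :: a)); auto using swap_lt.
    + apply tb_iff. apply swap_codeo. exact H01.
Qed.

Lemma tails_S6 e ph fs a p1 p2 p3 :
  Permutation p1 (seq 0 (length ph)) -> Permutation p2 (seq 0 (length fs)) ->
  Permutation p3 (seq 0 (length a)) ->
  tails (Cfg (code [6; e; code p1; code p2; code p3]) ph fs a)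
    (Cfg e (sel 0 p1 ph) (sel (fun _ => 0) p2 fs) (sel 0 p3 a)).
Proof.
  intros H1 H2 H3. set (e' := code [6; _; _; _; _]).
  assert (HS : isS6 e') by (unfold isS6, e'; rewrite !nthc_code; symmetry; apply i6_code).
  split; [| split].
  - notag.
  - intros v Hv. unfold cfg_val in *. cbn [ce cph cfs cas] in *.
    eapply S6; [| apply permuted_sel; exact H2 | apply permuted_sel; exact H3 | exact Hv].
    rewrite <- (sel_map Fv 0 (fun _ => 0)) by auto. apply permuted_sel. rewrite length_map. exact H1.
  - intros f x (ps & -> & Hph & Hps & E). cbn [ce cph cfs cas] in *.
    assert (El : length ps = length fs) by (rewrite <- E, length_map; reflexivity).
    exists (sel 0 p2 ps). cbn [ce cph cfs cas]. repeat split.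
    + unfold tailc. rewrite ite_true.
      * confs. unfold e'. rewrite !nthc_code. cbn [nth]. rewrite !selc_eq. reflexivity.
      * unfold okS6. confs. unfold e'. rewrite !nthc_code. cbn [nth]. rewrite !lenc_code, !isperm_eq, El. auto.
    + apply sel_Forall; auto; rewrite ?El; auto.
    + apply sel_Forall; auto; rewrite ?El; auto.
    + rewrite <- E. symmetry. apply sel_map. rewrite El. auto.
Qed.

Lemma tails_S9 e ph fs a : tails (Cfg (code [9]) ph fs (e :: a)) (Cfg e ph fs a).
Proof.
  split; [| split].
  - notag.
  - intros v Hv. apply S9. exact Hv.
  - intros f x (ps & -> & Hph & Hps & E). cbn [ce cph cfs cas] in *.
    exists ps. split; auto. unfold tailc. confs. rewrite ite_false.
    + rewrite ite_true by (split; [reflexivity | apply code_nz; discriminate]).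
      rewrite hdc_tag, tlc_code. reflexivity.
    + unfold okS6. confs. notag.
Qed.

(** Besides S6 and S9 this covers configurations that fit no scheme. They pass to themselves, which
    merely hands the turn to the opponent. *)
Lemma tails_exist c : tail_kind c -> exists c', tails c c'.
Proof.
  intros Hk. destruct c as [e ph fs a].
  destruct (classic (okc6 (Cfg e ph fs a))) as [H6 | H6].
  { destruct H6 as (HS & P1 & P2 & P3). cbn [ce cph cfs cas] in *.
    destruct (code_surj (nthc e 2)) as (q1 & E1). destruct (code_surj (nthc e 3)) as (q2 & E2).
    destruct (code_surj (nthc e 4)) as (q3 & E3).
    rewrite E1, isperm_eq in P1. rewrite E2, isperm_eq in P2. rewrite E3, isperm_eq in P3.
    unfold isS6 in HS. rewrite E1, E2, E3, i6_code in HS. rewrite HS.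
    eexists. apply tails_S6; auto. }
  destruct (classic (e = code [9] /\ a <> [])) as [[-> H9] | H9].
  { destruct a as [| d a]; [tauto |]. eexists. apply tails_S9. }
  exists (Cfg e ph fs a). split; [exact Hk | split; [auto |]].
  intros f x Hx. replace (tailc x) with x; auto.
  destruct Hx as (ps & -> & _ & _ & E). cbn [ce cph cfs cas] in *.
  assert (El : length ps = length fs) by (rewrite <- E, length_map; reflexivity).
  unfold tailc. rewrite ite_false, ite_false; auto.
  - confs. rewrite code_nz. auto.
  - unfold okS6. confs. rewrite !lenc_code, El. exact H6.
Qed.
End Race2.

Lemma S4_not_S8 k e : isS4 e -> isS8 k e -> False.
Proof. notag. Qed.

Lemma S82_not_S83 e : isS8 2 e -> isS8 3 e -> False.
Proof. notag. Qed.

(** * The operator that collects subcomputations *)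

Section Query.
Variables (cEq cSv s : nat) (HP : programs cEq cSv s) (F : list ((nat -> nat) -> nat)).
Notation K := (length F).
Notation Fv := (fun i => nth i F (fun _ => 0)).
Notation rep := (rep F). Notation race := (race s F).
Notation claim := (claim s F). Notation good := (good s F).
Ltac confs := rewrite ?c_e_conf, ?c_ph_conf, ?c_ps_conf, ?c_al_conf.

Lemma rep_cons g f c x : rep f c x -> rep (g :: f) c x.
Proof.
  intros (ps & -> & Hph & Hps & E). exists ps. repeat split; auto.
  - revert Hps. apply Forall_impl. intros r. apply refok_S.
  - rewrite <- E. apply map_ext_in. intros r Hr. apply refval_cons.
    rewrite Forall_forall in Hps. auto.
Qed.

(* The stage of the simulated induction, for S8.3. *)
Definition user (X : C) : C := fun j => X (pr 1 j).
Definition first (X : C) : nat := mu (fun b => X (pr 0 (pr 0 b)) = true).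

(* The [k]-th subcomputation of [c]. *)
Definition sub (c : cfg) (X : C) (k : nat) : cfg :=
  if tb (isS4 (ce c)) then
    match k with
    | 0 => Cfg (nthc (ce c) 2) (cph c) (cfs c) (cas c)
    | S _ => Cfg (nthc (ce c) 1) (cph c) (cfs c) (first X :: cas c)
    end
  else if tb (isS8 2 (ce c)) then Cfg (nthc (ce c) 2) (cph c) (cfs c) (k :: cas c)
  else Cfg (nthc (ce c) 2) (cph c) (ncons k (user X) :: cfs c) (tl (cas c)).

Lemma rep_sub f c x n X k : rep f c x ->
  rep (ncons n X :: f) (sub c X k) (query X (length f) x k).
Proof.
  intros Hx. pose proof (rep_cons (ncons n X) _ _ _ Hx) as (ps & -> & Hph & Hps & E).
  unfold sub, query. confs. unfold ite.
  destruct (tb (isS4 (ce c))) eqn:E4; [destruct k |destruct (tb (isS8 2 (ce c)))].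
  - rewrite (proj2 (tb_true (0 = 0))) by auto. exists ps. auto.
  - rewrite (proj2 (tb_false _)) by auto. exists ps. cbn [ce cph cfs cas].
    rewrite code_cons'. auto.
  - exists ps. cbn [ce cph cfs cas]. rewrite code_cons'. auto.
  - exists (pr 1 (pr k (length f)) :: ps). cbn [ce cph cfs cas]. rewrite code_cons', tlc_code.
    repeat split; auto.
    + constructor; auto. unfold refok. rewrite p1_pr, !p2_pr. simpl. lia.
    + cbn [map]. rewrite refval_new, E. reflexivity.
Qed.

Variables (c d : cfg) (Om : C -> nat -> outcome).

Definition qk (X : C) (k : nat) : Prop :=
  isS4 (ce c) -> k = 0 \/ (k = 1 /\ exists b, X (pr 0 (pr 0 b)) = true).

Definition table (X : C) : nat -> nat := fun m => mu (fun y => X (pr 0 (pr m y)) = true).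

(** The roles in [Om X k] are exchanged: [own w] is a victory of [d], [other v] gives the value of
    the subcomputation. A victory of [d] also sets the bit tagged 1, but it raises a flag at the
    same step, after which no simulated stage is consulted by the operator. *)
Definition race_news (X : C) (n : nat) : Prop :=
  (exists k w, n = pr 2 (pr k w) /\ qk X k /\ Om X k = own w) \/
  (exists k v, n = pr 0 (pr k v) /\ qk X k /\ ~ isS8 3 (ce c) /\ Om X k = other v) \/
  (exists k, n = pr 1 k /\ isS8 3 (ce c) /\ Om X k <> other 0) \/
  (exists v, n = pr 4 v /\ isS4 (ce c) /\ X (pr 0 (pr 1 v)) = true) \/
  (exists v, n = pr 4 v /\ isS8 2 (ce c) /\ (forall k, exists y, X (pr 0 (pr k y)) = true) /\
     Fv (hd 0 (cph c)) (table X) = v).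

Definition summary (X : C) (n : nat) : Prop :=
  n = pr 5 0 \/ exists w, n = pr 3 w /\ exists k, X (pr 2 (pr k w)) = true.

Definition race_op (X : C) : C :=
  fun n => tb ((flagged X /\ summary X n) \/ (~ flagged X /\ race_news X n)).

Hypothesis Hkind : isS4 (ce c) \/ (isS8 2 (ce c) /\ cph c <> []) \/ isS8 3 (ce c).

Lemma tb_neg (P : Prop) : negb (tb P) = tb (~ P).
Proof.
  destruct (tb P) eqn:E; symmetry; simpl; [apply tb_false | apply tb_true];
  rewrite ?tb_true, ?tb_false in E; tauto.
Qed.

(** At a flagged stage the program answers by quotation alone, so convergent races are demanded at
    unflagged stages only. *)
Lemma k_op f a x y r X n : rep f c x -> rep f d y ->
  (~ flagged X -> forall k, qk X k -> good d (sub c X k) (Om X k)) ->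
  kleene (actG cEq cSv X n (mk 0 s K (length f) (S (length a)) (pr x (pr y r)))) F (ncons n X :: f)
    (n :: mk 0 s K (length f) (S (length a)) (pr x (pr y r)) :: a) (Nat.b2n (race_op X n)).
Proof.
  intros Hx Hy HG. set (p := mk 0 s _ _ _ _). unfold p at 1. rewrite actG_mk.
  assert (Hq : forall k, rep (ncons n X :: f) (sub c X k) (query X (length f) x k))
    by (intros; apply rep_sub; exact Hx).
  apply (rep_cons (ncons n X)) in Hy.
  assert (Hcall : forall k t a', ~ flagged X -> qk X k -> p1 t < 2 ->
    kleene (call 0 s K (S (length f)) (length a') (pr y (pr (query X (length f) x k) t)))
      F (ncons n X :: f) a' (Nat.b2n (tb (t = codeo (Om X k))))).
  { intros k t a' Hf Hk Ht. apply (race_call s F d (sub c X k) (Om X k) (ncons n X :: f) a'); auto.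
    apply HG; auto. }
  destruct Hx as (ps & Ex & Hph & Hps & E).
  assert (Ece : c_e x = ce c) by (rewrite Ex; apply c_e_conf).
  assert (Ecph : c_ph x = code (cph c)) by (rewrite Ex; apply c_ph_conf).
  assert (Eqk : forall k, qok X x k <-> qk X k) by (intros; unfold qok, qk; rewrite Ece; tauto).
  unfold actG'. rewrite Ece, Ecph.
  destruct (classic (flagged X)) as [Hf | Hf].
  { rewrite ite_true, b2n_ite by auto. replace (race_op X n) with (tb (n = pr 5 0 \/
      n = pr 3 (p2 n) /\ (exists k, X (pr 2 (pr k (p2 n))) = true))); [apply k_quote |].
    apply tb_iff. unfold summary. split.
    - intros [H | [H H']]; left; split; eauto.
    - intros [[_ [H | (w & -> & H)]] | [H _]]; [tauto | | tauto].
      rewrite p2_pr. auto. }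
  rewrite ite_false by auto.
  assert (Eop : race_op X n = tb (race_news X n)) by (apply tb_iff; tauto). rewrite Eop. clear Eop.
  assert (Hn : n = pr (p1 n) (p2 n)) by (symmetry; apply pr_eta).
  destruct (classic (p1 n = 2 /\ qk X (p1 (p2 n)))) as [[H1 H2] | N2].
  { rewrite ite_true by (rewrite Eqk; auto).
    eapply eq_rect; [apply (Hcall _ _ (n :: p :: a)); auto; rewrite p1_pr; lia |].
    f_equal. apply tb_iff. unfold race_news. split.
    - intros Ho. left. exists (p1 (p2 n)), (p2 (p2 n)). rewrite pr_eta. split; [congruence | split; auto].
      destruct (Om X _); apply pr_inj in Ho; destruct Ho as [Ho Ho']; [congruence | discriminate].
    - intros [(k & w & -> & _ & Ho) | [(k & v & -> & _) | [(k & -> & _) | [(v & -> & _) | (v & -> & _)]]]];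
        rewrite ?p1_pr, ?p2_pr, ?p1_pr, ?p2_pr in *; try discriminate.
      rewrite Ho. reflexivity. }
  rewrite ite_false by (rewrite Eqk; auto).
  destruct (classic (p1 n = 0 /\ qk X (p1 (p2 n)) /\ ~ isS8 3 (ce c))) as [(H1 & H2 & H3) | N0].
  { rewrite ite_true by (rewrite Eqk; auto).
    eapply eq_rect; [apply (Hcall _ _ (n :: p :: a)); auto; rewrite p1_pr; lia |].
    f_equal. apply tb_iff. unfold race_news. split.
    - intros Ho. right; left. exists (p1 (p2 n)), (p2 (p2 n)). rewrite pr_eta. split; [congruence | split; auto].
      split; auto. destruct (Om X _); apply pr_inj in Ho; destruct Ho as [Ho Ho']; [discriminate | congruence].
    - intros [(k & w & -> & _) | [(k & v & -> & _ & _ & Ho) | [(k & -> & _) | [(v & -> & _) | (v & -> & _)]]]];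
        rewrite ?p1_pr, ?p2_pr, ?p1_pr, ?p2_pr in *; try discriminate.
      rewrite Ho. reflexivity. }
  rewrite ite_false by (rewrite Eqk; auto).
  destruct (classic (p1 n = 1 /\ isS8 3 (ce c))) as [(H1 & H3) | N1].
  { rewrite ite_true by auto.
    eapply eq_rect; [eapply k_nimp; [apply k_quote | apply (Hcall (p2 n) (pr 1 0) (1 :: n :: p :: a)); auto] |].
    - intros H4. exfalso. eauto using S4_not_S8, S82_not_S83.
    - replace (tb (race_news X n)) with (negb (tb (pr 1 0 = codeo (Om X (p2 n))))).
      + destruct (tb _); reflexivity.
      + rewrite tb_neg. apply tb_iff. unfold race_news. split.
        * intros Ho. do 2 right; left. exists (p2 n). split; [congruence | split; auto].
          intros E0. apply Ho. rewrite E0. reflexivity.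
        * intros [(k & w & -> & _) | [(k & v & -> & _) | [(k & -> & _ & Ho) | [(v & -> & _) | (v & -> & _)]]]];
            rewrite ?p1_pr, ?p2_pr, ?p1_pr, ?p2_pr in *; try discriminate.
          intros H. apply Ho. destruct (Om X k); apply pr_inj in H; [lia |].
          f_equal. symmetry. apply H. }
  rewrite ite_false by auto.
  destruct (classic (p1 n = 4 /\ isS4 (ce c))) as [(H1 & H4) | N4].
  { rewrite ite_true by auto. rewrite b2n_ite.
    replace (tb (race_news X n)) with (tb (X (pr 0 (pr 1 (p2 n))) = true)); [apply k_quote |].
    apply tb_iff. unfold race_news. split.
    - intros Ho. do 3 right; left. exists (p2 n). split; [congruence | auto].
    - intros [(k & w & -> & _) | [(k & v & -> & _) | [(k & -> & _) | [(v & -> & _ & Ho) | (v & -> & H8 & _)]]]];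
        rewrite ?p1_pr, ?p2_pr, ?p1_pr, ?p2_pr in *; try discriminate; auto.
      exfalso. eauto using S4_not_S8, S82_not_S83. }
  rewrite ite_false by auto.
  destruct (classic (p1 n = 4 /\ isS8 2 (ce c) /\ forall k, exists v, X (pr 0 (pr k v)) = true))
    as [(H1 & H8 & Hall) | N8].
  { rewrite ite_true by auto.
    assert (Hc : cph c <> []) by (destruct Hkind as [H | [[_ H] | H]]; auto; exfalso; eauto using S4_not_S8, S82_not_S83).
    destruct (cph c) as [| i ph] eqn:Ei; [tauto |]. rewrite hdc_tag.
    eapply eq_rect; [apply (k_test cEq cSv s HP F (ncons n X :: f) (n :: p :: a)) |].
    - apply (k_Fa cEq cSv s HP F f (p2 n :: n :: p :: a) i X n). inversion Hph. auto.
    - f_equal. apply tb_iff. fold (table X). unfold race_news. rewrite Ei. cbn [hd]. split.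
      + intros Ho. do 4 right. exists (p2 n). split; [congruence | auto].
      + intros [(k & w & -> & _) | [(k & v & -> & _) | [(k & -> & _) | [(v & -> & H4 & _) | (v & -> & _ & _ & Ho)]]]];
          rewrite ?p1_pr, ?p2_pr, ?p1_pr, ?p2_pr in *; try discriminate; auto.
        exfalso. eauto using S4_not_S8, S82_not_S83. }
  rewrite ite_false by auto.
  rewrite (proj2 (tb_false (race_news X n))); [apply k_quote |].
  intros [(k & w & -> & ? & ?) | [(k & v & -> & ? & ? & ?) | [(k & -> & ? & ?) | [(v & -> & ? & ?) | (v & -> & ? & ? & ?)]]]];
    rewrite ?p1_pr, ?p2_pr, ?p1_pr, ?p2_pr in *; auto.
Qed.

Definition Z : C := nival race_op.

Lemma k_bit f a x y r b : rep f c x -> rep f d y ->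
  (forall X, tower race_op X -> ~ flagged X -> forall k, qk X k -> good d (sub c X k) (Om X k)) ->
  kleene (niBit s K (length f) (S (length a)) b) F f
    (mk 0 s K (length f) (S (length a)) (pr x (pr y r)) :: a) (Nat.b2n (Z b)).
Proof.
  intros Hx Hy HG. apply (k_niBit cEq cSv s HP). intros X n HX.
  exists (Nat.b2n (race_op X n)). split; [| apply b2n_min]. apply k_op; auto.
Qed.
End Query.

Lemma cmax_true x y n : cmax x y n = true <-> x n = true \/ y n = true.
Proof. unfold cmax. apply Bool.orb_true_iff. Qed.

Lemma csup_true P n : csup P n = true <-> exists x, P x /\ x n = true.
Proof. apply tb_true. Qed.

Lemma nival_closed_at (g : C -> C) n : g (nival g) n = true -> nival g n = true.
Proof. intros H. rewrite <- nival_closed. apply cmax_true. auto. Qed.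

Lemma isS8_code k e : isS8 k (code [8; k; e]).
Proof. unfold isS8. rewrite nthc_code. cbn [nth]. rewrite !code_cons', code_nil. reflexivity. Qed.

(** * Races of S4 and S8.2 *)

Section NIclaims.
Variables (cEq cSv s : nat) (HP : programs cEq cSv s) (F : list ((nat -> nat) -> nat)).
Notation K := (length F).
Notation Fv := (fun i => nth i F (fun _ => 0)).
Notation val := (cfg_val F). Notation rep := (rep F). Notation race := (race s F).
Notation claim := (claim s F). Notation good := (good s F).
Notation op := (race_op F). Notation Z := (Z F). Notation news := (race_news F).
Ltac confs := rewrite ?c_e_conf, ?c_ph_conf, ?c_ps_conf, ?c_al_conf.

Section Inv.
Variables (c : cfg) (Om : C -> nat -> outcome) (A2 A0 : nat -> nat -> Prop) (A4 : nat -> Prop).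

(** Soundness of the bits at every stage: flags, table and values are justified by [A2], [A0] and
    [A4], and summary bits appear only after a flag that explains them. *)
Definition inv (X : C) : Prop :=
  (forall k w, X (pr 2 (pr k w)) = true -> A2 k w) /\
  (forall k v, X (pr 0 (pr k v)) = true -> A0 k v) /\
  (forall v, X (pr 4 v) = true -> A4 v) /\
  (forall w, X (pr 3 w) = true -> exists k, X (pr 2 (pr k w)) = true) /\
  (X (pr 5 0) = true -> flagged X).

Lemma inv_op X : inv X ->
  (~ flagged X -> forall k w, qk c X k -> Om X k = own w -> A2 k w) ->
  (~ flagged X -> forall k v, qk c X k -> ~ isS8 3 (ce c) -> Om X k = other v -> A0 k v) ->
  (isS4 (ce c) -> forall v, X (pr 0 (pr 1 v)) = true -> A4 v) ->
  (isS8 2 (ce c) -> (forall k, exists y, X (pr 0 (pr k y)) = true) ->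
     A4 (Fv (hd 0 (cph c)) (table X))) ->
  inv (cmax X (op c Om X)).
Proof.
  intros (I2 & I0 & I4 & I3 & I5) H2 H0 H4 H8.
  assert (Hop : forall n, op c Om X n = true -> (flagged X /\ summary X n) \/ (~ flagged X /\ news c Om X n))
    by (intros n Hn; unfold race_op in Hn; rewrite tb_true in Hn; exact Hn).
  assert (Hfl : flagged X -> flagged (cmax X (op c Om X))).
  { intros (k & w & H). exists k, w. apply cmax_true. auto. }
  unfold summary, race_news in Hop.
  repeat split; intros; match goal with H : cmax _ _ _ = true |- _ => apply cmax_true in H; destruct H as [H | H]; auto end;
    try (apply Hop in H; clear Hop;
      decompose [and or ex] H; clear H;
      repeat match goal with H : pr _ _ = pr _ _ |- _ => apply pr_inj in H; destruct H; try discriminate end; subst; eauto).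
  - apply I3 in H. destruct H as (k & H). exists k. apply cmax_true. auto.
  - exists x0. apply cmax_true. auto.
Qed.

Lemma inv_sup P : (forall X, P X -> inv X) -> inv (csup P).
Proof.
  intros H. repeat split; intros; match goal with H : csup _ _ = true |- _ => apply csup_true in H; destruct H as (X & HX & H') end;
    destruct (H X HX) as (I2 & I0 & I4 & I3 & I5); auto.
  - destruct (I3 _ H') as (k & Hk). exists k. apply csup_true. eauto.
  - destruct (I5 H') as (k & w & Hk). exists k, w. apply csup_true. eauto.
Qed.
End Inv.

Lemma race_NI c d Om o :
  isS4 (ce c) \/ (isS8 2 (ce c) /\ cph c <> []) ->
  (forall X, tower (op c Om) X -> ~ flagged X -> forall k, qk c X k -> good d (sub c X k) (Om X k)) ->
  (forall v, Z c Om (pr 4 v) = true <-> o = own v) ->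
  (forall w, Z c Om (pr 3 w) = true <-> o = other w) ->
  race c d o.
Proof.
  intros Hk HG Hown Hoth f a x y r Hr Hx Hy. apply (k_actR cEq cSv s HP).
  assert (Hk' : isS4 (ce c) \/ (isS8 2 (ce c) /\ cph c <> []) \/ isS8 3 (ce c)) by tauto.
  assert (Hb := fun b => k_bit cEq cSv s HP F c d Om Hk' f a x y r b Hx Hy HG).
  destruct Hx as (ps & Ex & _).
  assert (Ece : c_e x = ce c) by (rewrite Ex; apply c_e_conf).
  assert (Ecph : c_ph x = code (cph c)) by (rewrite Ex; apply c_ph_conf).
  unfold actR. rewrite Ece, Ecph. clear Ex Ece Ecph HG.
  rewrite ite_false by lia.
  assert (Ht : hdc (ce c) = 4 \/ hdc (ce c) = 8) by (clear - Hk; destruct Hk as [H | [H _]]; tags; auto).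
  rewrite ite_false by (clear - Ht; notag). rewrite ite_false by (clear - Ht; notag).
  rewrite ite_false by (clear - Ht; notag). rewrite ite_false by (clear - Ht; notag).
  rewrite ite_true by (rewrite code_nz; exact Hk).
  eapply eq_rect; [apply Hb |]. f_equal. rewrite (bool_tb (Z c Om _)). apply tb_iff.
  destruct (Nat.eq_dec (p1 r) 0) as [E | E].
  - rewrite ite_true by auto. rewrite Hown. rewrite <- (pr_eta r) at 2. rewrite E.
    destruct o; simpl; split; intros H; try discriminate H.
    + injection H as ->. reflexivity.
    + apply pr_inj in H. destruct H as [_ ->]. reflexivity.
    + apply pr_inj in H. destruct H. discriminate.
  - rewrite ite_false by auto. rewrite Hoth. rewrite <- (pr_eta r) at 2. replace (p1 r) with 1 by lia.
    destruct o; simpl; split; intros H; try discriminate H.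
    + apply pr_inj in H. destruct H. discriminate.
    + injection H as ->. reflexivity.
    + apply pr_inj in H. destruct H as [_ ->]. reflexivity.
Qed.

Lemma inv_tower c Om A2 A0 A4 :
  (forall X, tower (op c Om) X -> inv A2 A0 A4 X ->
     (~ flagged X -> forall k w, qk c X k -> Om X k = own w -> A2 k w) /\
     (~ flagged X -> forall k v, qk c X k -> ~ isS8 3 (ce c) -> Om X k = other v -> A0 k v) /\
     (isS4 (ce c) -> forall v, X (pr 0 (pr 1 v)) = true -> A4 v) /\
     (isS8 2 (ce c) -> (forall k, exists y, X (pr 0 (pr k y)) = true) ->
        A4 (Fv (hd 0 (cph c)) (table X)))) ->
  forall X, tower (op c Om) X -> inv A2 A0 A4 X.
Proof.
  intros H X HX. induction HX as [X HX IH | P HS IH].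
  - destruct (H X HX IH) as (h1 & h2 & h3 & h4). apply inv_op; auto.
  - apply inv_sup; auto.
Qed.

Lemma Z_closed c Om n : op c Om (Z c Om) n = true -> Z c Om n = true.
Proof. apply nival_closed_at. Qed.

Lemma Z_tower c Om : tower (op c Om) (Z c Om).
Proof. apply nival_tower. Qed.

Lemma Z_news c Om n : ~ flagged (Z c Om) -> news c Om (Z c Om) n -> Z c Om n = true.
Proof. intros H H'. apply Z_closed. unfold race_op. rewrite tb_true. auto. Qed.

Lemma Z_flag c Om k w : Z c Om (pr 2 (pr k w)) = true -> Z c Om (pr 3 w) = true.
Proof.
  intros H. apply Z_closed. unfold race_op. rewrite tb_true. left. split.
  - exists k, w. exact H.
  - right. exists w. eauto.
Qed.

(** [claim] only asserts that an outcome exists; one is chosen for each pair, so that the answers at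
    all stages come from a function. *)
Definition verdict (d y : cfg) : outcome := epsilon (inhabits (own 0)) (good d y).

Lemma verdict_good d y : claim d y -> good d y (verdict d y).
Proof. intros H. unfold verdict. apply epsilon_spec. exact H. Qed.

Lemma first_unique (X : C) b : (forall b', X (pr 0 (pr 0 b')) = true -> b' = b) ->
  X (pr 0 (pr 0 b)) = true -> first X = b.
Proof. intros H Hb. apply mu_unique; auto. Qed.

(** The second race is posed only after the first subcomputation has a recorded value. The invariant
    shows that this value is the true one and the only one recorded, which is what the conditional
    claim for [e1] needs. *)
Lemma claim_S4 e1 e2 ph fs a d :
  claim d (Cfg e2 ph fs a) ->
  (forall b, val (Cfg e2 ph fs a) b -> claim d (Cfg e1 ph fs (b :: a))) ->
  claim (Cfg (code [4; e1; e2]) ph fs a) d.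
Proof.
  intros C0 C1. set (c := Cfg (code [4; e1; e2]) ph fs a).
  set (s0 := Cfg e2 ph fs a) in *. set (s1 := fun b => Cfg e1 ph fs (b :: a)).
  set (Om := fun X k => verdict d (sub c X k)).
  assert (HS : isS4 (ce c)) by (unfold isS4; simpl; rewrite !nthc_code, iLet_code; reflexivity).
  assert (HN8 : ~ isS8 2 (ce c)) by (intros H; exact (S4_not_S8 _ _ HS H)).
  assert (Hsub0 : forall X, sub c X 0 = s0).
  { intros X. unfold sub. rewrite (proj2 (tb_true _) HS). simpl. rewrite nthc_code. reflexivity. }
  assert (Hsub1 : forall X, sub c X 1 = s1 (first X)).
  { intros X. unfold sub. rewrite (proj2 (tb_true _) HS). simpl. rewrite nthc_code. reflexivity. }
  set (u := verdict d s0) in *. set (u' := fun b => verdict d (s1 b)).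
  (* With the constructor [own] this describes the possible flags, with [other] the possible table
     entries. *)
  set (A := fun (o : nat -> outcome) k v => (k = 0 /\ u = o v) \/ (k = 1 /\ exists b, u = other b /\ u' b = o v)).
  set (A4 := fun v => exists b, u = other b /\ u' b = other v).
  assert (Hfirst : forall X, inv (A own) (A other) A4 X -> (exists b, X (pr 0 (pr 0 b)) = true) ->
    u = other (first X)).
  { intros X (_ & I0 & _) (b & Hb).
    assert (Hu : forall b, X (pr 0 (pr 0 b)) = true -> u = other b).
    { intros b' H. apply I0 in H. destruct H as [[_ H] | [H _]]; [exact H | discriminate]. }
    rewrite (first_unique X b); auto.
    intros b' H. apply Hu in H. apply Hu in Hb. congruence. }
  assert (HA : forall X, inv (A own) (A other) A4 X -> forall (o : nat -> outcome) k v, qk c X k -> Om X k = o v -> A o k v).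
  { intros X HX o k v Hk Ho. destruct (Hk HS) as [-> | [-> Hb]]; unfold Om in Ho.
    - left. rewrite Hsub0 in Ho. auto.
    - right. rewrite Hsub1 in Ho. split; auto. exists (first X). auto. }
  assert (Hinv : forall X, tower (op c Om) X -> inv (A own) (A other) A4 X).
  { apply inv_tower. intros X HX I. split; [| split; [| split]].
    - eauto.
    - eauto.
    - intros _ v Hv. destruct I as (_ & I0 & _). apply I0 in Hv.
      destruct Hv as [[Hv _] | [_ Hv]]; [discriminate | exact Hv].
    - tauto. }
  assert (Hg0 : good d s0 u) by (apply verdict_good; auto).
  assert (Hg1 : forall b, u = other b -> good d (s1 b) (u' b)).
  { intros b Hb. apply verdict_good. apply C1. rewrite Hb in Hg0. apply Hg0. }
  assert (HG : forall X, tower (op c Om) X -> ~ flagged X -> forall k, qk c X k -> good d (sub c X k) (Om X k)).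
  { intros X HX _ k Hk. unfold Om. destruct (Hk HS) as [-> | [-> Hb]].
    - rewrite Hsub0. exact Hg0.
    - rewrite Hsub1. apply Hg1. apply Hfirst; auto. }
  pose proof (Hinv _ (Z_tower c Om)) as HI. pose proof HI as (I2 & I0 & I4 & I3 & _).
  assert (Hq0 : qk c (Z c Om) 0) by (intros _; auto).
  assert (Hown0 : forall w, u = own w -> Z c Om (pr 2 (pr 0 w)) = true).
  { intros w Hw. destruct (classic (flagged (Z c Om))) as [(k & w' & Hf) | Hf].
    - destruct (I2 _ _ Hf) as [[-> H] | [_ (b & H & _)]]; congruence.
    - apply Z_news; auto. left. exists 0, w. split; [reflexivity | split; auto].
      unfold Om. rewrite Hsub0. exact Hw. }
  assert (Hval0 : forall b, u = other b -> ~ flagged (Z c Om) ->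
    Z c Om (pr 0 (pr 0 b)) = true /\ qk c (Z c Om) 1 /\ Om (Z c Om) 1 = u' b).
  { intros b Hb Hf. assert (H : Z c Om (pr 0 (pr 0 b)) = true).
    { apply Z_news; auto. right; left. exists 0, b. split; [reflexivity | split; auto]. split.
      - intros H. exact (S4_not_S8 _ _ HS H).
      - unfold Om. rewrite Hsub0. exact Hb. }
    split; [exact H | split].
    - intros _. eauto.
    - change (verdict d (sub c (Z c Om) 1) = u' b). rewrite Hsub1. replace (first (Z c Om)) with b; [reflexivity |].
      assert (E : u = other (first (Z c Om))) by (apply Hfirst; eauto). rewrite Hb in E. injection E as E. exact E. }
  assert (Hlose : forall w, (u = own w \/ exists b, u = other b /\ u' b = own w) -> claim c d).
  { intros w Hw. exists (other w). split.
    - destruct Hw as [Hw | (b & Hb & Hw)].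
      + rewrite Hw in Hg0. apply Hg0.
      + specialize (Hg1 b Hb). rewrite Hw in Hg1. apply Hg1.
    - assert (Hw3 : Z c Om (pr 3 w) = true).
      { destruct Hw as [Hw | (b & Hb & Hw)]; [apply (Z_flag c Om 0); auto |].
        destruct (classic (flagged (Z c Om))) as [(k & w' & Hf) | Hf].
        - assert (w' = w); [| subst; eapply Z_flag; eauto].
          destruct (I2 _ _ Hf) as [[-> H] | [_ (b' & H & H')]]; congruence.
        - apply (Z_flag c Om 1). destruct (Hval0 b Hb Hf) as (H1 & H2 & H3).
          apply Z_news; auto. left. exists 1, w. split; [reflexivity | split; auto]. congruence. }
      apply (race_NI c d Om); auto.
      + intros v. split; [| discriminate]. intros Hv. exfalso. destruct (I4 v Hv) as (b & H & H').
        destruct Hw as [Hw | (b' & Hb & Hw)]; congruence.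
      + intros w'. split; [| congruence]. intros H. destruct (I3 _ H) as (k & Hk).
        destruct (I2 _ _ Hk) as [[_ E] | [_ (b & E & E')]];
        destruct Hw as [Hw | (b' & Hb & Hw)]; congruence. }
  destruct u as [w | b] eqn:Eu; [eapply Hlose; left; reflexivity |].
  destruct (u' b) as [w | v] eqn:Eu'; [eapply Hlose; right; eauto |].
  assert (Hf : ~ flagged (Z c Om)).
  { intros (k & w & Hf). destruct (I2 _ _ Hf) as [[_ E] | [_ (b' & E & E')]]; congruence. }
  destruct (Hval0 b eq_refl Hf) as (H1 & H2 & H3).
  exists (own v). split.
  - destruct Hg0 as [V0 _]. destruct (Hg1 b eq_refl) as [V1 _]. rewrite Eu' in V1.
    exact (S4 e1 e2 _ fs a b v V0 V1).
  - assert (Hv : Z c Om (pr 0 (pr 1 v)) = true).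
    { apply Z_news; auto. right; left. exists 1, v. split; [reflexivity | split; auto]. split; [| congruence].
      intros H. exact (S4_not_S8 _ _ HS H). }
    apply (race_NI c d Om); auto.
    + intros v'. split.
      * intros H. destruct (I4 _ H) as (b' & E & E'). congruence.
      * intros H. injection H as ->. apply Z_news; auto. do 3 right; left. eauto.
    + intros w. split; [| discriminate]. intros H. destruct (I3 _ H) as (k & Hk).
      exfalso. apply Hf. exists k, w. exact Hk.
Qed.

(** If [d] wins against some subcomputation, it may win against many at once, but determinacy gives
    all flags the same value. If it wins against none, the table becomes total and yields the
    argument of the functional. *)
Lemma claim_S82 e i ph fs a d :
  (forall n, claim d (Cfg e (i :: ph) fs (n :: a))) ->
  claim (Cfg (code [8; 2; e]) (i :: ph) fs a) d.
Proof.
  intros C0. set (c := Cfg (code [8; 2; e]) (i :: ph) fs a).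
  set (s0 := fun n => Cfg e (i :: ph) fs (n :: a)) in *.
  set (Om := fun X k => verdict d (sub c X k)).
  assert (HS : isS8 2 (ce c)) by apply isS8_code.
  assert (HN4 : ~ isS4 (ce c)) by (intros H; exact (S4_not_S8 _ _ H HS)).
  assert (HN8 : ~ isS8 3 (ce c)) by (intros H; exact (S82_not_S83 _ HS H)).
  assert (Hq : forall X k, qk c X k) by (intros X k H; tauto).
  set (u := fun k => verdict d (s0 k)).
  assert (HOm : forall X k, Om X k = u k).
  { intros X k. unfold Om, u, sub. rewrite (proj2 (tb_false _) HN4), (proj2 (tb_true _) HS).
    simpl. rewrite nthc_code. reflexivity. }
  assert (Hg : forall k, good d (s0 k) (u k)) by (intros k; apply verdict_good; apply C0).
  set (A := fun (o : nat -> outcome) k v => u k = o v).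
  set (A4 := fun v => exists g, (forall k, u k = other (g k)) /\ Fv i g = v).
  assert (Htab : forall X, inv (A own) (A other) A4 X -> (forall k, exists y, X (pr 0 (pr k y)) = true) ->
    forall k, u k = other (table X k)).
  { intros X (_ & I0 & _) Hall k. destruct (Hall k) as (y & Hy).
    rewrite (I0 _ _ Hy). f_equal. symmetry. apply mu_unique; auto.
    intros z Hz. apply I0 in Hz. apply I0 in Hy. unfold A in *. congruence. }
  assert (Hinv : forall X, tower (op c Om) X -> inv (A own) (A other) A4 X).
  { apply inv_tower. intros X HX I. split; [| split; [| split]].
    - intros _ k w _ H. rewrite HOm in H. exact H.
    - intros _ k v _ _ H. rewrite HOm in H. exact H.
    - tauto.
    - intros _ Hall. exists (table X). split; [| reflexivity]. apply Htab; auto. }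
  assert (HG : forall X, tower (op c Om) X -> ~ flagged X -> forall k, qk c X k -> good d (sub c X k) (Om X k)).
  { intros X HX _ k Hk. rewrite HOm. unfold sub. rewrite (proj2 (tb_false _) HN4), (proj2 (tb_true _) HS).
    simpl. rewrite nthc_code. apply Hg. }
  pose proof (Hinv _ (Z_tower c Om)) as HI. pose proof HI as (I2 & I0 & I4 & I3 & _).
  assert (Hk : isS4 (ce c) \/ isS8 2 (ce c) /\ cph c <> []) by (right; split; [exact HS | discriminate]).
  destruct (classic (exists k w, u k = own w)) as [(k & w & Hw) | Hn].
  - assert (Vw : val d w) by (pose proof (Hg k) as [V _]; rewrite Hw in V; exact V).
    assert (Hdet : forall k' w', u k' = own w' -> w' = w).
    { intros k' w' Hw'. pose proof (Hg k') as [V _]. rewrite Hw' in V. eapply kleene_det; [exact V | exact Vw]. }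
    exists (other w). split; [exact Vw |].
    apply (race_NI c d Om); auto.
    + intros v. split; [| discriminate]. intros Hv. exfalso. destruct (I4 v Hv) as (g & Hg' & _).
      rewrite Hg' in Hw. discriminate.
    + intros w'. split.
      * intros H. destruct (I3 _ H) as (k' & Hk'). apply I2 in Hk'. f_equal. symmetry. eapply Hdet. exact Hk'.
      * intros H. injection H as <-.
        destruct (classic (flagged (Z c Om))) as [(k' & w' & Hf) | Hf].
        -- pose proof (I2 _ _ Hf) as E. apply Hdet in E. subst. eapply Z_flag; eauto.
        -- apply (Z_flag c Om k). apply Z_news; auto. left. exists k, w. split; [reflexivity | split; auto].
           rewrite HOm. exact Hw.
  - assert (Hf : ~ flagged (Z c Om)).
    { intros (k & w & Hf). apply Hn. exists k, w. exact (I2 _ _ Hf). }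
    assert (Hall : forall k, exists y, Z c Om (pr 0 (pr k y)) = true).
    { intros k. destruct (u k) as [w | y] eqn:E; [exfalso; eauto |]. exists y.
      apply Z_news; auto. right; left. exists k, y. rewrite HOm. auto. }
    pose proof (Htab _ HI Hall) as Ht. set (g := table (Z c Om)) in *.
    exists (own (Fv i g)). split.
    + refine (S8_2 e (Fv i) (map Fv ph) fs a g _). intros n.
      pose proof (Hg n) as [V _]. rewrite Ht in V. exact V.
    + apply (race_NI c d Om); auto.
      * intros v. split.
        -- intros H. destruct (I4 _ H) as (g' & Hg' & <-). do 2 f_equal. apply functional_extensionality.
           intros k. specialize (Hg' k). rewrite Ht in Hg'. congruence.
        -- intros H. injection H as <-. apply Z_news; auto. do 4 right. exists (Fv i g).
           split; [reflexivity | split; [exact HS |]]. split; [exact Hall | reflexivity].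
      * intros w. split; [| discriminate]. intros H. destruct (I3 _ H) as (k & H').
        exfalso. apply Hf. exists k, w. exact H'.
Qed.
End NIclaims.

(** * Races of S8.3 *)

Lemma user_cmax X Y : user (cmax X Y) = cmax (user X) (user Y).
Proof. reflexivity. Qed.

Lemma user_csup P : user (csup P) = csup (fun z => exists X, P X /\ user X = z).
Proof.
  apply functional_extensionality. intros n. unfold user, csup. apply tb_iff. split.
  - intros (X & HX & H). exists (user X). split; eauto.
  - intros (z & (X & HX & <-) & H). eauto.
Qed.

Lemma flagged_mono X Y : cle X Y -> flagged X -> flagged Y.
Proof. intros H (k & w & Hf). exists k, w. auto. Qed.

Section S83.
Variables (cEq cSv s : nat) (HP : programs cEq cSv s) (F : list ((nat -> nat) -> nat)).
Notation K := (length F).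
Notation Fv := (fun i => nth i F (fun _ => 0)).
Notation val := (cfg_val F). Notation rep := (rep F). Notation race := (race s F).
Notation claim := (claim s F). Notation good := (good s F). Notation verdict := (verdict s F).
Notation op := (race_op F). Notation Z := (Z F). Notation news := (race_news F).

(** The value is a bit of the simulated induction, meaningful only if [pr 5 0] reports no victory of
    [d]; the answer therefore combines two bits of one induction. Inside [iNimp] the instruction is
    no longer on top of the stack, so the second bit is obtained by a fresh call with a question
    tagged 2. *)
Lemma race_S83 c d Om o b a0 :
  isS8 3 (ce c) -> cas c = b :: a0 ->
  (forall X, tower (op c Om) X -> ~ flagged X -> forall k, qk c X k -> good d (sub c X k) (Om X k)) ->
  (forall v, o = own v <-> Z c Om (pr 5 0) = false /\ v = Nat.b2n (Z c Om (pr 1 b))) ->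
  (forall w, Z c Om (pr 3 w) = true <-> o = other w) ->
  race c d o.
Proof.
  intros HS Hcas HG Hown Hoth f a x y r Hr Hx Hy. apply (k_actR cEq cSv s HP).
  assert (Hk' : isS4 (ce c) \/ (isS8 2 (ce c) /\ cph c <> []) \/ isS8 3 (ce c)) by tauto.
  assert (Hb := fun a b => k_bit cEq cSv s HP F c d Om Hk' f a x y r b Hx Hy HG).
  assert (Hc : forall q b, kleene (call 0 s K (length f) (S (S (length a))) (pr x (pr y (pr 2 b)))) F f
      (q :: mk 0 s K (length f) (S (length a)) (pr x (pr y r)) :: a) (Nat.b2n (Z c Om b))).
  { intros q b'. apply (k_call s F f (q :: mk 0 s K (length f) (S (length a)) (pr x (pr y r)) :: a)).
    apply (k_actR cEq cSv s HP). unfold actR. rewrite ite_true by apply p1_pr. rewrite p2_pr.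
    apply (k_bit cEq cSv s HP F c d Om Hk'); auto. }
  destruct Hx as (ps & Ex & _).
  assert (Ece : c_e x = ce c) by (rewrite Ex; apply c_e_conf).
  assert (Eal : c_al x = code (b :: a0)) by (rewrite Ex, c_al_conf, Hcas; reflexivity).
  unfold actR. rewrite Ece, Eal, hdc_tag. clear Ex Ece Eal HG.
  rewrite ite_false by lia.
  pose proof HS as Ht. apply hdc_S8 in Ht.
  rewrite ite_false by (clear - Ht; notag). rewrite ite_false by (clear - Ht; notag).
  rewrite ite_false by (clear - Ht; notag). rewrite ite_false by (clear - Ht; notag).
  rewrite ite_false by (intros [H | [H _]]; eauto using S4_not_S8, S82_not_S83).
  rewrite ite_true by (split; [exact HS | apply code_nz; discriminate]).
  destruct (Nat.eq_dec (p1 r) 1) as [E | E].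
  { rewrite ite_true by auto. eapply eq_rect; [apply Hb |]. f_equal.
    rewrite (bool_tb (Z c Om _)). apply tb_iff. rewrite Hoth. rewrite <- (pr_eta r) at 2. rewrite E.
    destruct o; simpl; split; intros H; try discriminate H.
    - apply pr_inj in H. destruct H. discriminate.
    - injection H as ->. reflexivity.
    - apply pr_inj in H. destruct H as [_ ->]. reflexivity. }
  rewrite ite_false by auto.
  assert (Er : r = pr 0 (p2 r)) by (rewrite <- (pr_eta r) at 1; f_equal; lia).
  assert (Eo : tb (r = codeo o) = tb (Z c Om (pr 5 0) = false /\ p2 r = Nat.b2n (Z c Om (pr 1 b)))).
  { apply tb_iff. rewrite <- Hown. rewrite Er at 1. destruct o; simpl; split; intros H; try discriminate H.
    - apply pr_inj in H. destruct H as [_ ->]. reflexivity.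
    - injection H as ->. reflexivity.
    - apply pr_inj in H. destruct H. discriminate. }
  rewrite Eo. clear Eo Er.
  destruct (Nat.eq_dec (p2 r) 1) as [E1 | E1].
  { rewrite ite_true by auto. eapply eq_rect; [eapply k_nimp; [apply Hb | apply Hc] |].
    rewrite E1. destruct (Z c Om (pr 5 0)), (Z c Om (pr 1 b)); simpl.
    all: repeat first [rewrite (proj2 (tb_true _)) by (repeat split; auto; fail)
      | rewrite (proj2 (tb_false _)) by intuition discriminate]; reflexivity. }
  rewrite ite_false by auto.
  destruct (Nat.eq_dec (p2 r) 0) as [E0 | E0].
  { rewrite ite_true by auto.
    eapply eq_rect; [eapply k_nimp; [eapply k_nimp; [apply k_quote | apply Hc] | apply Hc] |].
    rewrite E0. destruct (Z c Om (pr 5 0)), (Z c Om (pr 1 b)); simpl.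
    all: repeat first [rewrite (proj2 (tb_true _)) by (repeat split; auto; fail)
      | rewrite (proj2 (tb_false _)) by intuition discriminate]; reflexivity. }
  rewrite ite_false by auto. eapply eq_rect; [apply k_quote |].
  destruct (Z c Om (pr 5 0)), (Z c Om (pr 1 b)); simpl;
    rewrite !(proj2 (tb_false _)); intuition.
Qed.

(* [R] bounds the stages at which the subcomputations are known to be raceable:
   the stages of a converging induction, or everything when [d] converges. *)
Lemma claim_S83 e ph fs b a d (R : C -> Prop) :
  (forall y k, R y -> claim d (Cfg e ph (ncons k y :: fs) a)) ->
  (forall P : C -> Prop, (forall z, P z -> R z) -> R (csup P)) ->
  (forall y y', R y ->
     (forall n, exists m, val (Cfg e ph (ncons n y :: fs) a) m /\ Nat.b2n (y' n) = Nat.min m 1) ->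
     R (cmax y y')) ->
  claim (Cfg (code [8; 3; e]) ph fs (b :: a)) d.
Proof.
  intros HR HRsup HRstep. set (c := Cfg (code [8; 3; e]) ph fs (b :: a)).
  set (s0 := fun y k => Cfg e ph (ncons k y :: fs) a).
  set (u := fun y k => verdict d (s0 y k)).
  set (Om := fun X k => u (user X) k).
  assert (HS : isS8 3 (ce c)) by apply isS8_code.
  assert (HN4 : ~ isS4 (ce c)) by (intros H; exact (S4_not_S8 _ _ H HS)).
  assert (HN8 : ~ isS8 2 (ce c)) by (intros H; exact (S82_not_S83 _ H HS)).
  assert (Hq : forall X k, qk c X k) by (intros X k H; tauto).
  assert (Hsub : forall X k, sub c X k = s0 (user X) k).
  { intros X k. unfold sub. rewrite (proj2 (tb_false _) HN4), (proj2 (tb_false _) HN8).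
    simpl. rewrite nthc_code. reflexivity. }
  assert (Hg : forall y k, R y -> good d (s0 y k) (u y k)) by (intros; apply verdict_good; apply HR; auto).
  set (g := fun y n => tb (u y n <> other 0)).
  assert (Hop : forall X, ~ flagged X -> user (op c Om X) = g (user X)).
  { intros X Hf. apply functional_extensionality. intros n. unfold user at 1. unfold race_op, g. apply tb_iff. split.
    - intros [[H _] | [_ H]]; [tauto |].
      destruct H as [(k & w & E & _) | [(k & v & E & _) | [(k & E & _ & H) | [(v & E & _) | (v & E & _)]]]];
        apply pr_inj in E; destruct E as [E E']; try discriminate E. subst. exact H.
    - intros H. right. split; auto. right; right; left. eauto. }
  assert (Hfl : forall X, flagged X -> flagged (cmax X (op c Om X)))
    by (intros X; apply flagged_mono, cmax_l).
  assert (Hval : forall X, R (user X) -> ~ flagged (cmax X (op c Om X)) -> forall n,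
    exists m, val (s0 (user X) n) m /\ Nat.b2n (g (user X) n) = Nat.min m 1).
  { intros X HX Hf n. assert (Hf' : ~ flagged X) by auto.
    pose proof (Hg _ n HX) as [V _]. destruct (u (user X) n) as [w | m] eqn:Eu.
    - exfalso. apply Hf. exists n, w. apply cmax_true. right. unfold race_op. rewrite tb_true. right.
      split; auto. left. exists n, w. split; [reflexivity | split; auto].
    - exists m. split; [exact V |]. unfold g. rewrite Eu, <- b2n_nz. f_equal. apply tb_iff.
      split; intros H H'; apply H; congruence. }
  (* As long as no flag has been raised, all simulated bits were true values, so the simulated stage
     has not left [R]. *)
  assert (HRX : forall X, tower (op c Om) X -> ~ flagged X -> R (user X)).
  { intros X HX. induction HX as [X HX IH | P HT IH]; intros Hf.
    - assert (Hf' : ~ flagged X) by auto. rewrite user_cmax, Hop by auto. apply HRstep; auto.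
      apply Hval; auto.
    - rewrite user_csup. apply HRsup. intros z (X & HPX & <-). apply IH; auto.
      intros H. apply Hf. eapply flagged_mono; [apply csup_ub; exact HPX | exact H]. }
  assert (HG : forall X, tower (op c Om) X -> ~ flagged X -> forall k, qk c X k -> good d (sub c X k) (Om X k)).
  { intros X HX Hf k _. rewrite Hsub. apply Hg. auto. }
  assert (Hinv : forall X, tower (op c Om) X -> inv (fun _ w => val d w) (fun _ _ => True) (fun _ => True) X).
  { apply inv_tower. intros X HX I. split; [| split; [| split]]; auto.
    intros Hf k w _ Ho. pose proof (HG X HX Hf k (Hq X k)) as [V _]. rewrite Ho in V. exact V. }
  pose proof (Hinv _ (Z_tower F c Om)) as (I2 & _ & _ & I3 & I5).
  destruct (classic (flagged (Z c Om))) as [Hf | Hf].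
  - pose proof Hf as (k & w & Hw). assert (Vw := I2 _ _ Hw).
    exists (other w). split; [exact Vw |].
    apply (race_S83 c d Om (other w) b a); auto.
    + intros v. split; [discriminate |]. intros [H _].
      rewrite (Z_closed F c Om (pr 5 0)) in H; [discriminate |].
      unfold race_op. rewrite tb_true. left. split; [exact Hf |]. left. reflexivity.
    + intros w'. split.
      * intros H. destruct (I3 _ H) as (k' & Hk'). f_equal. eapply kleene_det; [exact Vw | exact (I2 _ _ Hk')].
      * intros H. injection H as <-. eapply Z_flag; eauto.
  - assert (Hall : forall X, tower (op c Om) X -> ~ flagged X).
    { intros X HX H. apply Hf. eapply flagged_mono; [apply csup_ub; exact HX | exact H]. }
    (* Without flags the simulated parts of the stages run through exactly the tower of [g], so the
       two inductions close at the same value. *)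
    assert (T1 : forall X, tower (op c Om) X -> tower g (user X)).
    { intros X HX. induction HX as [X HX IH | P HT IH].
      - rewrite user_cmax, Hop by auto. apply tower_step. exact IH.
      - rewrite user_csup. apply tower_sup. intros z (X & HPX & <-). auto. }
    assert (T2 : forall y, tower g y -> exists X, tower (op c Om) X /\ user X = y).
    { intros y Hy. induction Hy as [y Hy (X & HX & E) | P HT IH].
      - exists (cmax X (op c Om X)). split; [apply tower_step; auto |].
        rewrite user_cmax, Hop, E by auto. reflexivity.
      - exists (csup (fun X => tower (op c Om) X /\ P (user X))). split; [apply tower_sup; tauto |].
        rewrite user_csup. f_equal. apply functional_extensionality. intros z.
        apply propositional_extensionality. split.
        + intros (X & (_ & H) & <-). exact H.
        + intros H. destruct (IH z H) as (X & HX & <-). eauto. }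
    assert (EZ : user (Z c Om) = nival g).
    { apply nival_unique; [apply T1, Z_tower |]. rewrite <- Hop by auto.
      intros n Hn. apply Z_closed. exact Hn. }
    exists (own (Nat.b2n (user (Z c Om) b))). split.
    + refine (S8_3 e (map Fv ph) fs b a (user (Z c Om)) _). rewrite EZ. apply NI_nival.
      intros y Hy n. destruct (T2 y Hy) as (X & HX & <-).
      apply Hval; [apply HRX; auto |]. apply Hall. apply tower_step. exact HX.
    + apply (race_S83 c d Om _ b a); auto.
      * intros v. assert (H5 : Z c Om (pr 5 0) = false).
        { destruct (Z c Om (pr 5 0)) eqn:E; auto. exfalso. auto. }
        split; [intros H; injection H as <-; auto |]. intros [_ ->]. reflexivity.
      * intros w. split; [| discriminate]. intros H. destruct (I3 _ H) as (k & Hk).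
        exfalso. apply Hf. exists k, w. exact Hk.
Qed.
End S83.

(** * Races with a converging participant *)

Section Main.
Variables (cEq cSv s : nat) (HP : programs cEq cSv s).
Notation Fv F := (fun i => nth i F (fun _ => 0)).

(** No induction on [c], which may diverge: whatever its index, one step reduces the race to races
    of [d] against other computations, and these are granted. For S8.3 the bound on stages can be
    trivial for the same reason. *)
Lemma claim_against F c d : (forall y, claim s F d y) -> claim s F c d.
Proof.
  intros H. destruct c as [e ph fs a].
  destruct (classic (e = code [1] /\ a <> [])) as [[-> H1] | N1].
  { destruct a as [| n a]; [tauto |]. eapply claim_S1; eauto. }
  destruct (classic (isS2 e)) as [H2 | N2].
  { unfold isS2 in H2. rewrite iQuote_code in H2. rewrite H2. eapply claim_S2; eauto. }
  destruct (classic (e = code [3] /\ a <> [])) as [[-> H3] | N3].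
  { destruct a as [| n a]; [tauto |]. eapply claim_S3; eauto. }
  destruct (classic (e = code [7] /\ fs <> [] /\ a <> [])) as [[-> [H7 H7']] | N7].
  { destruct fs as [| g fs]; [tauto |]. destruct a as [| n a]; [tauto |]. eapply claim_S7; eauto. }
  destruct (classic (isS4 e)) as [H4 | N4].
  { unfold isS4 in H4. rewrite iLet_code in H4. rewrite H4. eapply claim_S4; eauto. }
  assert (E8 : forall k, isS8 k e -> e = code [8; k; nthc e 2]).
  { intros k Hk. unfold isS8 in Hk. rewrite !code_cons', code_nil. exact Hk. }
  destruct (classic (isS8 2 e /\ ph <> [])) as [[H8 Hp] | N8].
  { destruct ph as [| i ph]; [tauto |]. rewrite (E8 _ H8). eapply claim_S82; eauto. }
  destruct (classic (isS8 3 e /\ a <> [])) as [[H83 Ha] | N83].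
  { destruct a as [| b a]; [tauto |]. rewrite (E8 _ H83).
    apply (claim_S83 cEq cSv s HP F _ _ _ _ _ _ (fun _ => True)); auto. }
  destruct (tails_exist F (Cfg e ph fs a)) as (c' & Hc').
  { unfold tail_kind. cbn [ce cph cfs cas]. tauto. }
  eapply claim_tail; eauto.
Qed.

(** Functionals are positions in one ambient list, since S6 may have permuted them differently for
    the two participants while the race runs over a fixed list. *)
Definition races (e : nat) (Fl : list ((nat -> nat) -> nat)) (f : list (nat -> nat)) (a : list nat) (v : nat) : Prop :=
  forall F ph, Fl = map (Fv F) ph -> forall d, claim s F (Cfg e ph f a) d.

Lemma races_against e Fl f a v : races e Fl f a v -> forall F ph, Fl = map (Fv F) ph ->
  forall d, claim s F d (Cfg e ph f a).
Proof. intros H F ph E d. apply claim_against. apply H. exact E. Qed.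

(* The two halves of the induction: [c] can be raced against everything by racing
   everything against its subcomputations, and conversely [claim_against]. *)
Lemma races_all e Fl f a v : kleene e Fl f a v -> races e Fl f a v.
Proof.
  intros H. induction H as [Fl f a1 a | q Fl f a | Fl f a1 a | e1 e2 Fl f a b c K2 IH2 K1 IH1
    | e1 t1 t2 t3 Fl f a F' f' a' c P1 P2 P3 K IH | Fl f1 f a1 a | e F1 Fl f a g K IH
    | e Fl f b a x HNI | e Fl f a c K IH] using kleene_strong; intros F ph E d.
  - eapply claim_S1; eauto.
  - eapply claim_S2; eauto.
  - eapply claim_S3; eauto.
  - eapply claim_S4; eauto.
    + eapply races_against; eauto.
    + intros b' Vb. assert (b' = b) by (subst Fl; eapply kleene_det; [exact Vb | exact K2]). subst b'.
      eapply races_against; eauto.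
  - pose proof P1 as (q1 & -> & Q1 & _). pose proof P2 as (q2 & -> & Q2 & _). pose proof P3 as (q3 & -> & Q3 & _).
    pose proof (permuted_sel (fun _ => 0) q2 f Q2) as D2. pose proof (permuted_sel 0 q3 a Q3) as D3.
    pose proof (permuted_sel (fun _ => 0) q1 Fl Q1) as D1.
    apply (permuted_det _ _ _ _ P1) in D1. apply (permuted_det _ _ _ _ P2) in D2. apply (permuted_det _ _ _ _ P3) in D3.
    subst Fl. rewrite length_map in Q1.
    rewrite (sel_map (Fv F) 0 (fun _ => 0)) in D1 by auto. subst F' f' a'.
    eapply claim_tail; [eauto | apply tails_S6; auto |]. eapply races_against; eauto.
  - eapply claim_S7; eauto.
  - destruct ph as [| i ph]; [discriminate E |]. injection E as -> E.
    eapply claim_S82; eauto. intros n. eapply races_against; [apply (IH n) |]. simpl. f_equal. exact E.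
  (* [R] consists of the true stages of the converging induction; at each of them every bit has a
     derivation that carries the hypothesis. *)
  - apply NI_elim in HNI; [destruct HNI as (R & Rstep & Rsup & Rdef & _) |].
    2: { intros z y y' H1 H2. apply functional_extensionality. intros n.
      destruct (H1 n) as (m & (K1 & _) & E1). destruct (H2 n) as (m' & (K2 & _) & E2).
      rewrite (kleene_det _ _ _ _ _ _ K1 K2) in E1. eapply b2n_min_inj; eauto. }
    apply (claim_S83 cEq cSv s HP F e ph f b a d R); auto.
    + intros y k Hy. destruct (Rdef y Hy) as (y' & Hy'). destruct (Hy' k) as (m & (_ & IH) & _).
      eapply races_against; eauto.
    + intros y y' Hy Hval. apply Rstep; auto. intros n. destruct (Hval n) as (m & V & Em).
      destruct (Rdef y Hy) as (y1 & Hy1). destruct (Hy1 n) as (m' & (K' & IH) & _).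
      assert (m = m') by (eapply kleene_det; [exact V | subst Fl; exact K']). subst m'.
      exists m. auto.
  - eapply claim_tail; [eauto | apply tails_S9 |]. eapply races_against; eauto.
Qed.
End Main.

(** * Selection *)

Lemma map_nth_seq {A : Type} (l : list A) x : map (fun i => nth i l x) (seq 0 (length l)) = l.
Proof.
  apply (nth_ext _ _ x x); rewrite length_map, length_seq; auto.
  intros i Hi. rewrite (nth_indep _ x (nth 0 l x)) by (rewrite length_map, length_seq; auto).
  rewrite (map_nth (fun i => nth i l x)), seq_nth by auto. reflexivity.
Qed.

Lemma refsc_eq L : refsc L = code (map (fun i => pr 0 (L - S i)) (seq 0 L)).
Proof.
  apply mu_code. intros z. rewrite length_map, length_seq.
  assert (H : forall i, i < L -> nth i (map (fun i => pr 0 (L - S i)) (seq 0 L)) 0 = pr 0 (L - S i)).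
  { intros i Hi. rewrite (nth_indep _ 0 (pr 0 (L - S 0))) by (rewrite length_map, length_seq; auto).
    rewrite (map_nth (fun i => pr 0 (L - S i))), seq_nth by auto. reflexivity. }
  split; intros [H1 H2]; split; auto; intros i Hi; rewrite H2 by auto; [symmetry |]; auto.
Qed.

Lemma kleene_S4_inv e1 e2 F f a c : kleene (code [4; e1; e2]) F f a c ->
  exists b, kleene e2 F f a b /\ kleene e1 F f (b :: a) c.
Proof.
  intros H. remember (code [4; e1; e2]) as e eqn:E. inversion H; subst;
  try match goal with H : _ = code _ |- _ => apply code_inj in H; try discriminate H; injection H; intros; subst end.
  eauto.
Qed.

Section Gandy.
Variables (cEq cSv s : nat) (HP : programs cEq cSv s).
Variables (F : list ((nat -> nat) -> nat)) (f : list (nat -> nat)) (e : nat) (a : list nat).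
Notation K := (length F).
Notation L := (length f).
Notation al := (code a).

Definition conv (k : nat) : Prop := converges e F f (k :: a).
Definition cfgE (k : nat) : cfg := Cfg (iLet (iQuote 0) e) (seq 0 K) f (k :: a).
Definition cfgH (k : nat) : cfg := Cfg (iU s K L 1) (seq 0 K) f [mk 2 s K L 1 (pr e (pr al k))].

Lemma rep_base e' l : rep F f (Cfg e' (seq 0 K) f l) (conf e' (seqc 0 K) (refsc L) (code l)).
Proof.
  exists (map (fun i => pr 0 (L - S i)) (seq 0 L)). rewrite seqc_eq, refsc_eq. cbn [ce cph cfs cas].
  split; [reflexivity | split; [| split]].
  - apply Forall_forall. intros i Hi. apply in_seq in Hi. lia.
  - apply Forall_map, Forall_forall. intros i Hi. apply in_seq in Hi.
    unfold refok. rewrite p1_pr, p2_pr. simpl. lia.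
  - rewrite map_map. transitivity (map (fun i => nth i f (fun _ => 0)) (seq 0 L)); [| apply map_nth_seq]. apply map_ext_in.
    intros i Hi. apply in_seq in Hi. unfold refval. rewrite p1_pr, p2_pr. simpl.
    unfold fbot. f_equal. lia.
Qed.

Lemma rep_E k : rep F f (cfgE k) (cE K L e al k).
Proof. unfold cE. rewrite <- code_cons'. apply rep_base. Qed.

Lemma rep_H k : rep F f (cfgH k) (cH s K L e al k).
Proof. unfold cH. rewrite <- code_nil, <- code_cons'. apply rep_base. Qed.

Lemma val_H k v : cfg_val F (cfgH k) v <-> kleene (iU s K L 1) F f [mk 2 s K L 1 (pr e (pr al k))] v.
Proof. unfold cfg_val. cbn [ce cph cfs cas cfgH]. rewrite (map_nth_seq F (fun _ => 0)). reflexivity. Qed.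

Lemma val_E k v : cfg_val F (cfgE k) v <-> v = 0 /\ conv k.
Proof.
  unfold cfg_val. cbn [ce cph cfs cas cfgE]. rewrite (map_nth_seq F (fun _ => 0)).
  rewrite iLet_code. split.
  - intros H. apply kleene_S4_inv in H. destruct H as (b & H1 & H2). split; [| exists b; exact H1].
    eapply kleene_det; [exact H2 | apply k_quote].
  - intros (-> & b & Hb). eapply S4; [exact Hb | apply k_quote].
Qed.

Lemma races_cfg e' l v d : kleene e' F f l v ->
  claim s F (Cfg e' (seq 0 K) f l) d /\ claim s F d (Cfg e' (seq 0 K) f l).
Proof.
  intros H. assert (E : F = map (fun i => nth i F (fun _ => 0)) (seq 0 K))
    by (symmetry; apply (map_nth_seq F (fun _ => 0))).
  apply (races_all _ _ _ HP) in H. split; [apply H; exact E |].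
  eapply races_against; eauto.
Qed.

Lemma claim_E k d : conv k -> claim s F (cfgE k) d /\ claim s F d (cfgE k).
Proof.
  intros (v & Hv). apply (races_cfg _ _ 0). rewrite iLet_code. eapply S4; [exact Hv | apply k_quote].
Qed.

Lemma k_actH tag x r v a' : tag <> 0 ->
  (forall p M, p = mk tag s K L M x -> M = S (length a') ->
     kleene (ite (tag = 1) (iVar K L M (M - p1 x + p1 (p2 x)))
  (ite (tag = 2) (call 0 s K L M (pr (cE K L (p1 x) (p1 (p2 x)) (p2 (p2 x)))
     (pr (cH s K L (p1 x) (p1 (p2 x)) (S (p2 (p2 x)))) (pr 0 0))))
  (ite (tag = 3) (call 0 s K L M (pr (cE K L (p1 x) (p1 (p2 x)) (p1 (p2 (p2 x))))
     (pr (cH s K L (p1 x) (p1 (p2 x)) (S (p1 (p2 (p2 x))))) (pr 1 (p2 (p2 (p2 x)))))))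
  (call 0 s K L M (pr (cE K L (p1 x) (p1 (p2 x)) (p1 (p2 (p2 x))))
     (pr (cE K L (p1 x) (p1 (p2 x)) (p2 (p2 (p2 x)))) (pr 0 0))))))) F f (p :: a') r) ->
  (forall p M, p = mk tag s K L M x -> M = S (length a') ->
     kleene (act2' r tag s K L M x) F f (r :: p :: a') v) ->
  kleene (iU s K L (S (length a'))) F f (mk tag s K L (S (length a')) x :: a') v.
Proof.
  intros Ht Hr Hv. set (p := mk _ _ _ _ _ _).
  assert (Ep : p1 p = tag) by apply p1_pr.
  apply (k_U cEq cSv s HP). unfold actU. rewrite Ep, ite_false by auto. unfold p at 1 2 3 4 5.
  rewrite gs_mk, gK_mk, gL_mk, gM_mk, gx_mk. unfold actH.
  eapply k_let; [apply Hr; reflexivity |]. apply (k_2 cEq cSv s HP).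
  unfold act2. rewrite Ep. unfold p at 1 2 3 4 5.
  rewrite gs_mk, gK_mk, gL_mk, gM_mk, gx_mk. apply Hv; reflexivity.
Qed.

Definition runs (tag x v : nat) : Prop := forall a',
  kleene (iU s K L (S (length a'))) F f (mk tag s K L (S (length a')) x :: a') v.

Lemma runs_call tag x v a' : runs tag x v -> kleene (call tag s K L (length a') x) F f a' v.
Proof. intros H. apply k_call. apply H. Qed.

Lemma call_race c d o x y r a' : race s F c d o -> rep F f c x -> rep F f d y -> p1 r < 2 ->
  kleene (call 0 s K L (length a') (pr x (pr y r))) F f a' (Nat.b2n (tb (r = codeo o))).
Proof. intros. eapply race_call; eauto. Qed.

Lemma b2n_true (P : Prop) : P -> Nat.b2n (tb P) = 1.
Proof. intros H. rewrite (proj2 (tb_true P)); auto. Qed.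

Lemma b2n_false (P : Prop) : ~ P -> Nat.b2n (tb P) = 0.
Proof. intros H. rewrite (proj2 (tb_false P)); auto. Qed.

(** Both participants can only have the value 0, so the single question [pr 0 0] settles which of
    them has won. *)
Lemma runs_4 k w : claim s F (cfgE k) (cfgE w) ->
  exists v, conv v /\ runs 4 (pr e (pr al (pr k w))) v.
Proof.
  intros (o & Ho & Hr). set (x := pr e (pr al (pr k w))).
  assert (Hv : exists v, conv v /\ v = ite (pr 0 0 = codeo o) k w).
  { eexists. split; [| reflexivity]. destruct o as [v | v]; apply val_E in Ho; destruct Ho as [-> Ho].
    - rewrite ite_true by reflexivity. exact Ho.
    - rewrite ite_false; [exact Ho |]. intros H. apply pr_inj in H. destruct H. discriminate. }
  destruct Hv as (v & Hv & Ev). exists v. split; [exact Hv |]. intros a'.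
  apply (k_actH 4 x (Nat.b2n (tb (pr 0 0 = codeo o)))); [discriminate | |]; intros p M Ep EM;
    [| unfold act2']; rewrite ite_false by discriminate; rewrite ite_false by discriminate;
    rewrite ite_false by discriminate; unfold x; rewrite ?p2_pr, ?p1_pr.
  - rewrite EM. apply (call_race (cfgE k) (cfgE w) o _ _ _ (p :: a')); auto using rep_E; rewrite p1_pr; lia.
  - rewrite Ev. unfold ite. destruct (tb (pr 0 0 = codeo o)); simpl;
      [rewrite (proj2 (tb_true _)) by reflexivity | rewrite (proj2 (tb_false _)) by discriminate]; apply k_quote.
Qed.

(** Induction on the distance to the value [w] of the winner: candidates below [w] are denied, at
    [w] the next phase starts. *)
Lemma runs_3 k w v n : race s F (cfgE k) (cfgH (S k)) (other w) ->
  runs 4 (pr e (pr al (pr k w))) v -> n <= w -> runs 3 (pr e (pr al (pr k (w - n)))) v.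
Proof.
  intros Hr H4. induction n as [| n IH]; intros Hn a'.
  - rewrite Nat.sub_0_r. set (x := pr e (pr al (pr k w))).
    apply (k_actH 3 x 1); [discriminate | |]; intros p M Ep EM;
      [| unfold act2']; rewrite ite_false by discriminate; rewrite ite_false by discriminate;
      rewrite ite_true by reflexivity.
    + unfold x; rewrite ?p2_pr, ?p1_pr. rewrite EM.
      eapply eq_rect; [apply (call_race _ _ _ _ _ _ (p :: a') Hr) | apply b2n_true; reflexivity];
        auto using rep_E, rep_H; rewrite p1_pr; lia.
    + rewrite ite_true by reflexivity. rewrite EM. apply (runs_call _ _ _ (1 :: p :: a')). exact H4.
  - set (x := pr e (pr al (pr k (w - S n)))).
    apply (k_actH 3 x 0); [discriminate | |]; intros p M Ep EM;
      [| unfold act2']; rewrite ite_false by discriminate; rewrite ite_false by discriminate;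
      rewrite ite_true by reflexivity.
    + unfold x; rewrite ?p2_pr, ?p1_pr. rewrite EM.
      eapply eq_rect; [apply (call_race _ _ _ _ _ _ (p :: a') Hr) | apply b2n_false];
        auto using rep_E, rep_H; [rewrite p1_pr; lia |].
      intros H. apply pr_inj in H. lia.
    + rewrite ite_false by discriminate. rewrite EM. apply (runs_call _ _ _ (0 :: p :: a')).
      unfold x. rewrite ?p2_pr, ?p1_pr, ?p2_pr, ?p1_pr.
      replace (S (w - S n)) with (w - n) by lia. apply IH. lia.
Qed.

Lemma runs_2 k : claim s F (cfgE k) (cfgH (S k)) ->
  (forall w, cfg_val F (cfgH (S k)) w -> claim s F (cfgE k) (cfgE w)) ->
  exists v, conv v /\ runs 2 (pr e (pr al k)) v.
Proof.
  intros (o & Ho & Hr) H4. set (x := pr e (pr al k)).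
  assert (H : exists v, conv v /\ forall a', kleene
    (ite (Nat.b2n (tb (pr 0 0 = codeo o)) = 1) (iQuote k) (call 3 s K L (length a') (pr e (pr al (pr k 0)))))
    F f a' v).
  { destruct o as [v | w].
    - apply val_E in Ho. destruct Ho as [-> Ho]. exists k. split; [exact Ho |]. intros a'.
      rewrite ite_true by (apply b2n_true; reflexivity). apply k_quote.
    - destruct (runs_4 k w) as (v & Hv & H); [apply H4; exact Ho |].
      exists v. split; [exact Hv |]. intros a'. rewrite ite_false.
      + apply runs_call. pose proof (runs_3 k w v w Hr H (le_n w)) as H3. rewrite Nat.sub_diag in H3. exact H3.
      + rewrite b2n_false; [discriminate |]. intros E. apply pr_inj in E. destruct E. discriminate. }
  destruct H as (v & Hv & H). exists v. split; [exact Hv |]. intros a'.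
  apply (k_actH 2 x (Nat.b2n (tb (pr 0 0 = codeo o)))); [discriminate | |]; intros p M Ep EM;
    [| unfold act2']; rewrite ite_false by discriminate; rewrite ite_true by reflexivity;
    unfold x; rewrite ?p2_pr, ?p1_pr.
  - rewrite EM. apply (call_race _ _ _ _ _ _ (p :: a') Hr); auto using rep_E, rep_H; rewrite p1_pr; lia.
  - rewrite EM. apply (H (_ :: p :: a')).
Qed.

(** At [n] all races converge because [{e}(n)] does, whatever happens beyond. Below, the next
    selection has a value [v] at which [e] converges; determinacy identifies its value in the race
    with [v], so the final race converges as well. *)
Lemma runs_from n k : conv n -> k <= n -> exists v, conv v /\ runs 2 (pr e (pr al (n - k))) v.
Proof.
  intros Hn. induction k as [| k IH]; intros Hk.
  - rewrite Nat.sub_0_r. apply runs_2; intros; apply (claim_E n _ Hn).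
  - destruct IH as (v & Hv & Hr); [lia |].
    assert (HH : cfg_val F (cfgH (S (n - S k))) v).
    { apply val_H. replace (S (n - S k)) with (n - k) by lia. apply (Hr []). }
    apply runs_2.
    + apply val_H in HH. eapply races_cfg. exact HH.
    + intros w Hw. assert (w = v) by (eapply kleene_det; [exact Hw | exact HH]). subst w.
      apply claim_E. exact Hv.
Qed.

Notation M0 := (S (length a)).

(** Entries are collected from the last to the first, so that consing produces them in order; place
    0 of the block holds [e], which is fetched at the end. [pre] consists of the numbers left by
    earlier rounds. *)
Lemma runs_1 v : runs 2 (pr e (pr al 0)) v -> forall t pre, t < M0 ->
  kleene (iU s K L (S (length (pre ++ e :: a)))) F f
    (mk 1 s K L (S (length (pre ++ e :: a))) (pr M0 (pr t (code (skipn t a)))) :: pre ++ e :: a) v.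
Proof.
  intros H2 t. induction t as [| t IH]; intros pre Ht.
  - set (x := pr M0 _). apply (k_actH 1 x e); [discriminate | |]; intros p M Ep EM;
      [| unfold act2']; rewrite ite_true by reflexivity; unfold x; rewrite ?p2_pr, ?p1_pr, ?p2_pr, ?p1_pr.
    + rewrite EM. rewrite length_app. cbn [length].
      replace (S (length pre + M0) - M0 + 0) with (length (p :: pre)) by (cbn [length]; lia).
      replace (S (length pre + M0)) with (length ((p :: pre) ++ e :: a)) by (rewrite length_app; cbn [length]; lia).
      apply (k_var F f (p :: pre) a e).
    + rewrite ite_true by reflexivity. rewrite EM. apply (runs_call _ _ _ (e :: p :: pre ++ e :: a)). exact H2.
  - destruct (split_nth a t 0) as (l1 & l2 & E & El); [lia |].
    set (x := pr M0 _). remember (nth t a 0) as r eqn:Er. clear Er.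
    apply (k_actH 1 x r); [discriminate | |]; intros p M Ep EM;
      [| unfold act2']; rewrite ite_true by reflexivity; unfold x; rewrite ?p2_pr, ?p1_pr, ?p2_pr, ?p1_pr.
    + rewrite EM. replace (p :: pre ++ e :: a) with ((p :: pre ++ e :: l1) ++ r :: l2)
        by (rewrite E; simpl; rewrite <- app_assoc; reflexivity).
      replace (S (length (pre ++ e :: a)) - M0 + S t) with (length (p :: pre ++ e :: l1))
        by (cbn [length]; rewrite !length_app; cbn [length]; lia).
      replace (S (length (pre ++ e :: a))) with (length ((p :: pre ++ e :: l1) ++ r :: l2)).
      * apply k_var.
      * rewrite E. cbn [length]. rewrite !length_app. cbn [length]. rewrite !length_app. cbn [length]. lia.
    + rewrite ite_false by discriminate. rewrite EM.
      replace (cons' r (code (skipn (S t) a))) with (code (skipn t a)).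
      * replace (S t - 1) with t by lia.
        apply (k_call s F f (r :: p :: pre ++ e :: a)). apply (IH (r :: p :: pre)). lia.
      * rewrite <- code_cons'. f_equal. rewrite E, <- El.
        rewrite !skipn_app, skipn_all, Nat.sub_diag, (skipn_all2 l1) by lia.
        replace (S (length l1) - length l1) with 1 by lia. reflexivity.
Qed.
End Gandy.

Theorem theorem2p14 :
  exists nu : nat,
    forall (e : nat) (F : list ((nat -> nat) -> nat)) (f : list (nat -> nat))
      (a : list nat),
      (exists n, converges e F f (n :: a)) ->
      exists n, seq_value nu F f (e :: a) n /\ converges e F f (n :: a).
Proof.
  destruct programs_exist as (cEq & cSv & s & HP).
  (* [nu] receives the three lengths, hence its template is evaluated at 0, 0 and 3. As [v 2] is the
     length of [e :: a], its predecessor is the place of the last entry, where collecting starts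
     with the code 0 of the empty sequence. *)
  destruct (dfnF_run 3 0 (fun X v => call 1 s (v 0) (v 1) (v 2) (pr (v 2) (pr (Nat.pred (v 2)) 0)))) as (t & Ht).
  { unfold_act. dfn. }
  exists (ev t 0 0 3). intros e F f a (n & Hn).
  destruct (runs_from cEq cSv s HP F f e a n n Hn (le_n n)) as (v & Hv & Hr).
  rewrite Nat.sub_diag in Hr. exists v. split; [| exact Hv].
  exists (call 1 s (length F) (length f) (length (e :: a)) (pr (length (e :: a)) (pr (length a) 0))). split.
  - refine (Ht [] [] [length F; length f; length (e :: a)] (fun _ => czero) _ _); [simpl; lia | intros; lia].
  - apply (k_call s F f (e :: a)). pose proof (runs_1 cEq cSv s HP F f e a v Hr (length a) [] (le_n _)) as H.
    rewrite skipn_all, code_nil in H. exact H.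
Qed.
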